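(* Let $p\in\mathbb Z$ and let $X_p$ be the total space of the bundle $\mathcal O(p)\oplus\mathcal O(-p-2)\to\mathbb P^1$. Let $$Z_{X_p}(\mathbf x,\mathbf y)=\sum_{\mu,\nu}Z_{\mu,\nu}\,s_\mu(\mathbf x)\,s_\nu(\mathbf y)$$ be the generating function of the open Gromov-Witten invariants of $X_p$ with two outer branes on different vertices (the sum being over all partitions $\mu,\nu$). Then there is a Bogoliubov transform $V\in\mathcal F_1\otimes\mathcal F_2$ such that $$Z_{\mu,\nu}=\langle\mu|\otimes\langle\nu|V\rangle$$ for all partitions $\mu,\nu$.
   Context: Partitions. For a partition $\mu=(\mu_1\ge\dots\ge\mu_l>0)$: $|\mu|=\sum\mu_i$, $\kappa_\mu=\sum_i\mu_i(\mu_i-2i+1)$, $\mu^t$ is the conjugate, $s_\mu$ and $s_{\mu/\eta}$ are Schur and skew Schur functions. Topological vertex. With $q^{\mu+\rho}=(q^{\mu_i-i+1/2})_{i\ge1}$ and $q^{-\rho}=(q^{i-1/2})_{i\ge1}$ (specializations being interpreted as rational functions of $q^{1/2}$), $$W_{\mu^1,\mu^2,\mu^3}(q)=(-1)^{|\mu^2|}q^{\kappa_{\mu^3}/2}s_{(\mu^2)^t}(q^{-\rho})\sum_\eta s_{\mu^1/\eta}(q^{(\mu^2)^t+\rho})\,s_{(\mu^3)^t/\eta}(q^{\mu^2+\rho}),$$ and for a framing $(a_1,a_2,a_3)\in\mathbb Z^3$, $$W^{(a_1,a_2,a_3)}_{\mu^1,\mu^2,\mu^3}(q)=(-1)^{\sum_i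 a_i|\mu^i|}q^{\sum_i a_i\kappa_{\mu^i}/2}W_{\mu^1,\mu^2,\mu^3}(q).$$ Generating function of $X_p$. The toric diagram of $X_p$ is obtained by gluing two trivalent vertices, one with edges $L_1,L_2,L_a$ and one with edges $L_b,L_3,L_4$ (each in clockwise order), along $L_a$ and $L_b$. With framings $a_1,\dots,a_4\in\mathbb Z$ on the noncompact edges $L_1,\dots,L_4$, the generating function of the Gromov-Witten invariants of $X_p$ is, by the gluing rule of the topological vertex, the one with coefficients $$\tilde Z_{\mu^1\mu^2\mu^3\mu^4}=\sum_\mu W^{(a_1,a_2,0)}_{\mu^1,\mu^2,\mu}(q)\,(-1)^{(f+1)|\mu|}q^{-f\kappa_\mu/2}Q^{|\mu|}\,W^{(0,a_3,a_4)}_{\mu^t,\mu^3,\mu^4}(q),$$ where $Q=e^{-t}$, $t$ is the Kähler parameter of the compact edge (treated as a formal variable $Q$), and $f\in\mathbb Z$ is the integer, depending only on $p$, such that framing $f$ on $L_b$ matches the canonical framing on $L_a$. The closed generating function is $Z_{closed}=\tilde Z_{\emptyset\emptyset\emptyset\emptyset}$, and the open Gromov-Witten generating function has coefficients $\tilde Z_{\mu^1\mu^2\mu^3\mu^4}/Z_{closed}$. ''Two outer branes on different vertices'' means that one brane is on $L_1$ or $L_2$ and one is on $L_3$ or $L_4$: $Z_{\mu,\nu}$ is $\tilde Z_{\mu^1\mu^2\mu^3\mu^4}/Z_{closed}$ with $\mu$ placed on the chosen one of $L_1,L_2$, $\nu$ placed on the chosen one of $L_3,L_4$, and the empty partition on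 the other two edges. Fermionic Fock space. A set $A=\{a_1>a_2>\cdots\}\subset\mathbb Z+\frac12$ is admissible if both $\{r\in\mathbb Z+\frac12: r<0\}\setminus A$ and $A\setminus\{r\in\mathbb Z+\frac12: r<0\}$ are finite. $\mathcal F$ is the vector space with orthonormal basis (for a bilinear inner product) the semi-infinite wedges $\underline A=\underline{a_1}\wedge\underline{a_2}\wedge\cdots$, $A$ admissible. For a partition $\mu$, $|\mu\rangle=\underline A$ with $A=\{\mu_i-i+\frac12\}_{i\ge1}$ ($\mu_i=0$ for large $i$); $|0\rangle$ is the vector of the empty partition; $\langle\mu|$ denotes pairing with $|\mu\rangle$. For $r\in\mathbb Z+\frac12$: $\psi_r(\underline A)=(-1)^k\,\underline{a_1}\wedge\cdots\wedge\underline{a_k}\wedge\underline r\wedge\underline{a_{k+1}}\wedge\cdots$ if $a_k>r>a_{k+1}$ ($k=0$ if $r>a_1$), and $0$ if $r\in A$; $\psi_r^*$ is the adjoint: $\psi_r^*(\underline A)=(-1)^{k+1}\,\underline{a_1}\wedge\cdots\wedge\widehat{\underline{a_k}}\wedge\cdots$ if $a_k=r$, and $0$ if $r\notin A$. $\mathcal F_1,\mathcal F_2$ are copies of $\mathcal F$; on $\mathcal F_1\otimes\mathcal F_2$ the operators $\psi^i_r,\psi^{i*}_r$ act on the $i$-th factor, with the Koszul sign convention (operators with different upper indices anticommute). A Bogoliubov transform in $\mathcal F_1\otimes\mathcal F_2$ is a vector of the form $\exp(\sum_{i,j=1}^2\sum_{m,n\ge0}A^{ij}_{mn}\psi^i_{m+1/2}\psi^{j*}_{-n-1/2})|0\rangle\otimes|0\rangle$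 with coefficients $A^{ij}_{mn}$ possibly depending on parameters (here: formal power series in $Q$, or in a root of $Q$, with coefficients functions of fractional powers of $q$). Infinite sums of basis vectors are understood formally. *)

(* Defs.v *)
From HB Require Import structures.
From mathcomp Require Import all_boot all_order all_algebra.
From mathcomp Require Import finmap zify.
From mathcomp Require Import boolp classical_sets cardinality fsbigop.

Set Implicit Arguments.
Unset Strict Implicit.
Unset Printing Implicit Defensive.

Import Order.TTheory GRing.Theory Num.Theory.

Local Open Scope classical_set_scope.
Local Open Scope ring_scope.

(* Sums [\sum_(i \in A) F i] over infinite index sets below always have only
   finitely many nonzero terms. *)

(** Course-of-values recursion: [F s] computes the [size s]-th value from the
    list [s] of all the earlier ones. *)

Fixpoint cvrec_prefix (T : Type) (F : seq T -> T) (n : nat) : seq T :=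
  if n is n'.+1 then
    let s := cvrec_prefix F n' in rcons s (F s)
  else [::].

Definition cvrec (T : Type) (F : seq T -> T) (n : nat) : T :=
  F (cvrec_prefix F n).

Lemma size_cvrec_prefix (T : Type) (F : seq T -> T) n :
  size (cvrec_prefix F n) = n.
Proof. by elim: n => //= n IHn; rewrite size_rcons IHn. Qed.

Lemma nth_cvrec_prefix (T : Type) (F : seq T -> T) x0 m n :
  (n < m)%N -> nth x0 (cvrec_prefix F m) n = cvrec F n.
Proof.
elim: m => // m IHm; rewrite ltnS leq_eqVlt /= nth_rcons size_cvrec_prefix.
by case/orP => [/eqP->|lt_nm]; rewrite ?ltnn ?eqxx // lt_nm IHm.
Qed.

(** Formal power series in one variable over a field *)

Record fps (K : fieldType) := Fps { fcoef : nat -> K }.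

Section FpsRing.

Variable K : fieldType.
Implicit Types f g h : fps K.

Lemma fpsP f g : (forall n, fcoef f n = fcoef g n) -> f = g.
Proof. by case: f g => [f] [g] /= fg; congr Fps; apply/funext. Qed.

HB.instance Definition _ := gen_eqMixin (fps K).
HB.instance Definition _ := gen_choiceMixin (fps K).

Definition fpsC (c : K) : fps K := Fps (fun n => if n == 0%N then c else 0).
Definition fpsX : fps K := Fps (fun n => (n == 1%N)%:R).
Definition fps_add f g : fps K := Fps (fun n => fcoef f n + fcoef g n).
Definition fps_opp f : fps K := Fps (fun n => - fcoef f n).
Definition fps_mul f g : fps K :=
  Fps (fun n => \sum_(i < n.+1) fcoef f i * fcoef g (n - i)).

Fact fps_addA : associative fps_add.
Proof. by move=> f g h; apply: fpsP => n /=; rewrite addrA. Qed.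
Fact fps_addC : commutative fps_add.
Proof. by move=> f g; apply: fpsP => n /=; rewrite addrC. Qed.
Fact fps_add0 : left_id (fpsC 0) fps_add.
Proof. by move=> f; apply: fpsP => n /=; rewrite if_same add0r. Qed.
Fact fps_addN : left_inverse (fpsC 0) fps_opp fps_add.
Proof. by move=> f; apply: fpsP => n /=; rewrite if_same addNr. Qed.

HB.instance Definition _ :=
  GRing.isZmodule.Build (fps K) fps_addA fps_addC fps_add0 fps_addN.

Let trunc n f : {poly K} := \poly_(i < n.+1) fcoef f i.

Let truncE n f i : (i <= n)%N -> (trunc n f)`_i = fcoef f i.
Proof. by rewrite coef_poly ltnS => ->. Qed.

Let truncM n f g i :
  (i <= n)%N -> fcoef (fps_mul f g) i = (trunc n f * trunc n g)`_i.
Proof.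
move=> le_in; rewrite coefM; apply: eq_bigr => j _.
rewrite !truncE //; first exact: leq_trans (leq_subr _ _) le_in.
by apply: leq_trans le_in; rewrite -ltnS.
Qed.

Fact fps_mulC : commutative fps_mul.
Proof. by move=> f g; apply: fpsP => n; rewrite !(@truncM n) // mulrC. Qed.

Fact fps_mulA : associative fps_mul.
Proof.
move=> f g h; apply: fpsP => n.
have left_assoc f1 f2 f3 : fcoef (fps_mul f1 (fps_mul f2 f3)) n
    = (trunc n f1 * (trunc n f2 * trunc n f3))`_n.
  rewrite coefM; apply: eq_bigr => i _.
  by rewrite truncE -1?ltnS // (@truncM n) // leq_subr.
by rewrite (fps_mulC (fps_mul f g)) !left_assoc mulrA mulrC.
Qed.

Fact fps_mul1 : left_id (fpsC 1) fps_mul.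
Proof.
move=> f; apply: fpsP => n /=; rewrite big_ord_recl /= subn0 mul1r big1 ?addr0 //.
by move=> i _; rewrite mul0r.
Qed.

Fact fps_mulDl : left_distributive fps_mul fps_add.
Proof.
move=> f g h; apply: fpsP => n /=; rewrite -big_split; apply: eq_bigr => i _.
by rewrite mulrDl.
Qed.

Fact fps_1_neq0 : fpsC 1 != 0 :> fps K.
Proof.
by apply/eqP => /(congr1 (fun f => fcoef f 0)) /= /eqP; rewrite oner_eq0.
Qed.

HB.instance Definition _ := GRing.Zmodule_isComNzRing.Build (fps K)
  fps_mulA fps_mulC fps_mul1 fps_mulDl fps_1_neq0.

Definition fps_unit : {pred fps K} := fun f => fcoef f 0 != 0.

Definition fps_inv_step f (s : seq K) : K :=
  if s is [::] then (fcoef f 0)^-1 else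
  - (fcoef f 0)^-1 * \sum_(i < size s) fcoef f i.+1 * s`_(size s - i.+1).

Definition fps_inv f : fps K :=
  if fps_unit f then Fps (cvrec (fps_inv_step f)) else f.

Fact fps_mulV : {in fps_unit, left_inverse (1 : fps K) fps_inv *%R}.
Proof.
move=> f uf; rewrite mulrC; apply: fpsP => n.
have f0 : fcoef f 0 != 0 by [].
rewrite /fps_inv [fps_unit f]uf /= big_ord_recl subn0 /=.
case: n => [|n]; first by rewrite big_ord0 addr0 /cvrec /= mulfV.
rewrite {1}/cvrec /fps_inv_step.
case Es: (cvrec_prefix _ n.+1) => [|x s].
  by move/(congr1 size): Es; rewrite size_cvrec_prefix.
rewrite -Es size_cvrec_prefix mulrA mulrN mulfV // mulN1r.
apply/eqP; rewrite addrC subr_eq add0r; apply/eqP; apply: eq_bigr => i _.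
by rewrite nth_cvrec_prefix // subSS ltnS leq_subr.
Qed.

Fact fps_unitPl f g : g * f = 1 -> fps_unit f.
Proof.
move=> /(congr1 (fun f => fcoef f 0)) /=; rewrite big_ord_recl big_ord0 addr0.
by rewrite subnn => gf; apply/eqP => f0; move/eqP: gf; rewrite f0 mulr0 eq_sym oner_eq0.
Qed.

Fact fps_inv_out : {in [predC fps_unit], fps_inv =1 id}.
Proof. by move=> f /negbTE uf; rewrite /fps_inv [fps_unit f]uf. Qed.

HB.instance Definition _ := GRing.ComNzRing_hasMulInverse.Build (fps K)
  fps_mulV fps_unitPl fps_inv_out.

End FpsRing.

(* coefficientwise sum of a family of power series *)
Definition fps_sum (K : fieldType) (I : choiceType) (F : I -> fps K) : fps K :=
  Fps (fun n => \sum_(i \in [set: I]) fcoef (F i) n).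

(** Integer partitions *)

Definition is_intpart (s : seq nat) : bool := sorted geq s && (0%N \notin s).

Record intpart := IntPart { parts :> seq nat; partsP : is_intpart parts }.
HB.instance Definition _ := [isSub for parts].
HB.instance Definition _ := [Choice of intpart by <:].

(* [part mu i] is the part mu_{i+1} of the informal notation: indices start
   at 0 *)
Definition part (mu : seq nat) (i : nat) : nat := nth 0%N mu i.

Definition empty_part : intpart := @IntPart [::] isT.

Definition psize (mu : intpart) : nat := sumn mu.

Definition conj_seq (s : seq nat) : seq nat :=
  [seq count (fun m => (i < m)%N) s | i <- iota 0 (head 0%N s)].

Lemma conj_seqP s : is_intpart s -> is_intpart (conj_seq s).
Proof.
case: s => [//|x s] _; apply/andP; split.
  apply: (@homo_sorted _ _ _ ltn geq); last exact: iota_ltn_sorted.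
  move=> i j lt_ij; apply: sub_count => m; exact: ltn_trans.
apply/negP => /mapP[i]; rewrite mem_iota add0n /= => lt_ix /eqP.
by rewrite lt_ix.
Qed.

Definition conj_part (mu : intpart) : intpart := IntPart (conj_seqP (partsP mu)).

Definition kappa (mu : intpart) : int :=
  \sum_(i < size mu) (part mu i)%:Z * ((part mu i)%:Z - 2 * i.+1%:Z + 1).

(** Specializations of (skew) Schur functions.
    A specialization of the ring of symmetric functions is given by the values
    [p k], k >= 1, of the power sums ([p 0] is unused). *)

Section Specialization.

Variables (K : fieldType) (p : nat -> K).

(* Newton's identity  n h_n = sum_(1 <= k <= n) p_k h_(n-k)  *)
Definition hsym_step (s : seq K) : K :=
  if s is [::] then 1 else
  (size s)%:R^-1 * \sum_(k < size s) p k.+1 * s`_(size s - k.+1).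

Definition hsym (n : int) : K :=
  if n is Posz m then cvrec hsym_step m else 0.

(* the Jacobi-Trudi determinant; it vanishes unless eta is contained in lam *)
Definition skew_schur (lam eta : intpart) : K :=
  \det (\matrix_(i < maxn (size lam) (size eta), j < maxn (size lam) (size eta))
     hsym ((part lam i)%:Z - (part eta j)%:Z - i%:Z + j%:Z)).

Definition schur (lam : intpart) : K := skew_schur lam empty_part.

End Specialization.

(** The topological vertex.
    In this part [h] stands for q^(1/2), so that q^(n/2) is [h ^ n]. *)

Section Vertex.

Variables (K : fieldType) (h : K).

(* p_k(q^(mu+rho)) = sum_(i >= 1) q^(k (mu_i - i + 1/2)); the terms i > l(mu)
   form a geometric series of first term h^(- k (2 l(mu) + 1)) and ratio
   h^(- 2 k) *)
Definition psum_rho (mu : intpart) (k : nat) : K :=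
  \sum_(i < size mu) h ^ (k%:Z * (2 * ((part mu i)%:Z - i%:Z) - 1))
  + h ^ (- (k * (2 * size mu + 1))%:Z) / (1 - h ^ (- (2 * k)%:Z)).

(* p_k(q^(-rho)) = sum_(i >= 1) q^(k (i - 1/2)) *)
Definition psum_mrho (k : nat) : K := h ^+ k / (1 - h ^+ (2 * k)).

Definition vertex (mu1 mu2 mu3 : intpart) : K :=
  (-1) ^+ psize mu2 * h ^ kappa mu3 * schur psum_mrho (conj_part mu2)
  * \sum_(eta \in [set: intpart])
      skew_schur (psum_rho (conj_part mu2)) mu1 eta
      * skew_schur (psum_rho mu2) (conj_part mu3) eta.

Definition framed_vertex (a1 a2 a3 : int) (mu1 mu2 mu3 : intpart) : K :=
  (-1) ^ (a1 * (psize mu1)%:Z + a2 * (psize mu2)%:Z + a3 * (psize mu3)%:Z)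
  * h ^ (a1 * kappa mu1 + a2 * kappa mu2 + a3 * kappa mu3)
  * vertex mu1 mu2 mu3.

End Vertex.

(** The toric diagram of X_p = O(p) + O(-p-2) -> P^1.
    Primitive vectors along the edges, pointing away from the vertex; at each
    vertex they sum to 0 and are listed in clockwise order.  The zero section
    has self-intersection p in the toric divisor between L1 and L4 and -p-2 in
    the one between L2 and L3. *)

Section Toric.

Variable p : int.

Definition dir1 : int * int := (0, -1).
Definition dir2 : int * int := (-1, 1).
Definition dira : int * int := (1, 0).
Definition dirb : int * int := (-1, 0).
Definition dir3 : int * int := (p + 1, 1).
Definition dir4 : int * int := (- p, -1).

Lemma dir_balanced :
  dir1 + dir2 + dira = 0 /\ dirb + dir3 + dir4 = 0.
Proof.
split; first by [].
by congr pair; rewrite /= ?addrN // [-1 + _]addrCA addNr addr0 addrN.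
Qed.

(* The canonical framing of an edge is the next edge [w] in clockwise order,
   and the framing [n] of an edge with direction [v] is the vector [w - n v].
   As [dirb = - dira], two framing vectors agree along the compact edge when
   they are opposite. *)
Definition framing_matches (f : int) : Prop := dir3 - dirb *~ f = - dir1.

Lemma framing_matchesE f : framing_matches f <-> f = - (p + 1).
Proof.
rewrite /framing_matches /dir3 /dirb /dir1.
have -> : ((-1, 0) : int * int) *~ f = (- f, 0).
  have natE (n : nat) : ((-1, 0) : int * int) *+ n = (- n%:Z, 0).
    by elim: n => [|n IHn]; rewrite ?mulr0n // mulrS IHn; congr pair;
       rewrite ?addr0 // -opprD -intS.
  case: f => n; first exact: natE.
  by rewrite NegzE mulrNz [_ *~ _]natE; congr pair; rewrite opprK.
split=> [/(congr1 fst) /= /eqP|->]; last by congr pair; rewrite opprK addrN.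
by rewrite opprK oppr0 addrC addr_eq0 => /eqP.
Qed.

End Toric.

(** The generating function of X_p.
    [h] stands for q^(1/2) and [Q] for the Kaehler parameter, which is a power
    series without constant term. *)

Variant leg12 := L1 | L2.
Variant leg34 := L3 | L4.

Section GluedZ.

Variables (K : fieldType) (h : K) (Q : fps K) (f a1 a2 a3 a4 : int).

Definition Ztilde (mu1 mu2 mu3 mu4 : intpart) : fps K :=
  fps_sum (fun mu : intpart =>
    fpsC (framed_vertex h a1 a2 0 mu1 mu2 mu
          * (-1) ^ ((f + 1) * (psize mu)%:Z) * h ^ (- f * kappa mu)
          * framed_vertex h 0 a3 a4 (conj_part mu) mu3 mu4)
    * Q ^+ psize mu).

Definition Zclosed : fps K :=
  Ztilde empty_part empty_part empty_part empty_part.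

Definition Zopen (e : leg12) (e' : leg34) (mu nu : intpart) : fps K :=
  let mu1 := if e is L1 then mu else empty_part in
  let mu2 := if e is L2 then mu else empty_part in
  let mu3 := if e' is L3 then nu else empty_part in
  let mu4 := if e' is L4 then nu else empty_part in
  Ztilde mu1 mu2 mu3 mu4 / Zclosed.

End GluedZ.

(** The fermionic Fock space.
    The integer [r] encodes the half-integer r + 1/2: thus m + 1/2 and
    - n - 1/2 are [Posz m] and [Negz n].  An admissible set A is encoded by the
    finite set D of elements in exactly one of A and {r | r < 0}; every finite
    D arises from exactly one A. *)

Definition occ (D : {fset int}) (r : int) : bool := (r \in D) (+) (r < 0).

(* adds r to A or removes it from A *)
Definition flip (D : {fset int}) (r : int) : {fset int} :=
  (if r \in D then D `\ r else r |` D)%fset.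

(* the number of a in A such that r < a: those with 0 <= a, then those with
   a < 0 *)
Definition above (D : {fset int}) (r : int) : nat :=
  (count (fun a => (0 <= a)%R && (r < a)%R) D
   + if r is Negz n then count (fun k => occ D (Negz k)) (iota 0 n) else 0)%N.

(* A = { mu_i - i + 1/2 | i >= 1 } *)
Definition maya (mu : intpart) : {fset int} :=
  let A := [fset x in [seq (part mu i)%:Z - i.+1%:Z | i <- iota 0 (size mu)]]%fset in
  let A0 := [fset x in [seq - i.+1%:Z | i <- iota 0 (size mu)]]%fset in
  ((A `\` A0) `|` (A0 `\` A))%fset.

Lemma occ_maya mu r :
  occ (maya mu) r <-> exists i : nat, r = (part mu i)%:Z - i.+1%:Z.
Proof.
have in_map g : reflect (exists2 i, (i < size mu)%N & r = g i)
    (r \in [seq g i | i <- iota 0 (size mu)]).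
  apply: (iffP mapP) => -[i]; first by rewrite mem_iota => lt_i ->; exists i.
  by move=> lt_i ->; exists i; rewrite ?mem_iota.
have -> : occ (maya mu) r
    = (r \in [seq (part mu i)%:Z - i.+1%:Z | i <- iota 0 (size mu)])
      || (r < - (size mu)%:Z).
  rewrite /occ /maya !inE; case: (in_map _) => [[i lt_i rE]|n0];
    case: (in_map _) => [[k lt_k rkE]|_] /=.
  - by rewrite rkE; lia.
  - by rewrite rE; lia.
  - apply/negP => r_lt0; apply: n0; clear in_map; case: r r_lt0 rkE => // n _ rE.
    by exists n; [move: rE lt_k; rewrite NegzE; lia | rewrite NegzE].
  - apply/idP/idP => [r_lt0|]; last by lia.
    clear in_map; case: r r_lt0 n0 => // n _ n0; rewrite NegzE.
    have [lt_n|] := ltnP n (size mu); last by lia.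
    by case: n0; exists n; rewrite ?NegzE.
split=> [/orP[/in_map[i _ ->]|]|[i rE]]; first by exists i.
  clear in_map; case: r => n r_lt; first by move: r_lt; lia.
  exists n; rewrite /part nth_default ?NegzE ?sub0r //.
  by move: r_lt; rewrite NegzE; lia.
apply/orP; have [lt_i|le_i] := ltnP i (size mu).
  by left; apply/in_map; exists i.
by right; rewrite rE /part nth_default //; lia.
Qed.

Lemma occ_flip D r s : occ (flip D r) s = occ D s (+) (s == r).
Proof.
rewrite /occ /flip; case: ifP => rD; rewrite !inE;
  by case: (eqVneq s r) => [->|_] /=; rewrite ?rD ?addbT ?addbF //; case: (r < 0).
Qed.

Section Fock.

Variable R : comUnitRingType.

(* formal, possibly infinite, combinations of the basis vectors *)
Definition fock := {fset int} -> R.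
Definition fock2 := {fset int} * {fset int} -> R.

(* [psi r v D] is the coefficient of the basis vector D in psi_r v.  The sign
   counts the elements above r, which are the same before and after r is added
   or removed. *)
Definition psi (r : int) (v : fock) : fock := fun D =>
  if occ D r then (-1) ^+ above D r * v (flip D r) else 0.

Definition psis (r : int) (v : fock) : fock := fun D =>
  if occ D r then 0 else (-1) ^+ above D r * v (flip D r).

(* an odd operator acting on a factor of the tensor product; the parity of the
   first factor is that of its charge, i.e. of the cardinal of the finite set *)
Definition on_factor (i : 'I_2) (T : fock -> fock) (v : fock2) : fock2 := fun S =>
  if i == 0 then T (fun D => v (D, S.2)) S.1
  else (-1) ^+ #|` S.1| * T (fun D => v (S.1, D)) S.2.

Definition psi2 (i : 'I_2) (r : int) : fock2 -> fock2 := on_factor i (psi r).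
Definition psis2 (i : 'I_2) (r : int) : fock2 -> fock2 := on_factor i (psis r).

Definition vac2 : fock2 := fun S =>
  (S == (maya empty_part, maya empty_part))%:R.

(* For each basis vector S only finitely many (m, n) contribute: m + 1/2 has to
   be present and - n - 1/2 absent in S. *)
Definition bogoliubov_op (A : 'I_2 -> 'I_2 -> nat -> nat -> R) (v : fock2) :
    fock2 := fun S =>
  \sum_(i < 2) \sum_(j < 2) \sum_(mn \in [set: nat * nat])
    A i j mn.1 mn.2 * psi2 i (Posz mn.1) (psis2 j (Negz mn.2) v) S.

Definition exp_vac2 (X : fock2 -> fock2) : fock2 := fun S =>
  \sum_(k \in [set: nat]) (k`!%:R)^-1 * iter k X vac2 S.

Definition is_bogoliubov (V : fock2) : Prop :=
  exists A : 'I_2 -> 'I_2 -> nat -> nat -> R, V = exp_vac2 (bogoliubov_op A).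

(* <mu| (x) <nu| V> *)
Definition bra2 (mu nu : intpart) (V : fock2) : R := V (maya mu, maya nu).

End Fock.

(* Main.v *)
Require Import Defs.
From HB Require Import structures.
From mathcomp Require Import all_boot all_order all_algebra.
From mathcomp Require Import perm finmap zify ring.
From mathcomp Require Import boolp classical_sets cardinality fsbigop.

(** The sum over the partitions of the compact edge is a Cauchy-Binet sum.  With
    mu encoded by its beads [mu_i + n - i], each of the two vertices is, up to
    signs and powers of Q^|mu|, q^|mu| and q^kappa that are products over the
    beads, an n x n minor of a fixed infinite matrix; hence Z_{mu,nu},
    truncated to a box, is the minor of a finite matrix M with rows mu and
    columns nu^t.  This is a maximal minor of M stacked over unit rows, whose
    rows are listed by the Maya diagrams of mu and nu.  Expressing all rows in
    terms of those of the vacuum by Cramer's rule and dividing by the vacuum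
    minor gives, for some A, the determinant whose rows are the unit rows of
    the holes of the vacuum and, for the particles, their combinations with
    coefficients A; by multilinearity these determinants are the coefficients of
    exp(sum A psi psi^* )|0>.  The entries of A are amplitudes of hooks and of
    charged rows and columns, and they stabilize modulo each power of Q as the
    box grows. *)

(** With the two branes on different vertices, each vertex has an empty outer leg. If that leaves
    the middle entry of the vertex empty, the sum over eta is itself a Cauchy-Binet sum. Otherwise
    the sum over eta collapses, but the variables q^(mu+rho) depend on mu and no minor is in sight:
    s_la(q^(mu+rho)) is a ratio of alternants with an alternant in the q^bead below. Up to products
    over the beads this denominator is s_mu(q^-rho), the other factor of the vertex, so the product
    of the two Schur functions is a single determinant.

    Three choices fix the bookkeeping. The vacuum has an even number N of rows in the first factor,
    so that Koszul signs are signs of moving rows. The unit rows are scaled by X^N, so that the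
    powers of X in front of the minors of charges s and 0 differ only by s(s - 1)/2. The vacuum
    minor is a positive power of X times a unit, so it is cancelled and never inverted. *)

Set Implicit Arguments.
Unset Strict Implicit.
Unset Printing Implicit Defensive.

Import Order.TTheory GRing.Theory Num.Theory.

Local Open Scope ring_scope.

(** * Determinants *)

Section DetList.

Variable R : comNzRingType.
Implicit Types (x y : nat -> R) (s : seq (nat -> R)) (P : nat).

(* Rows are functions on [nat], of which the first [P] values are used, so that
   the number of rows above a given one need not appear in a type. *)
Definition detl P s : R := \det (\matrix_(i < P, j < P) nth (fun=> 0) s i j).

Lemma eq_detl P s s' :
  (forall i j, (i < P)%N -> (j < P)%N ->
     nth (fun=> 0) s i j = nth (fun=> 0) s' i j) -> detl P s = detl P s'.
Proof. by move=> ss'; congr (\det _); apply/matrixP => i j; rewrite !mxE ss'. Qed.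

Lemma detl_swap P s1 x y s2 : size (s1 ++ x :: y :: s2) = P ->
  detl P (s1 ++ y :: x :: s2) = - detl P (s1 ++ x :: y :: s2).
Proof.
rewrite size_cat /= => sP.
have lt1 : (size s1 < P)%N by lia.
have lt2 : ((size s1).+1 < P)%N by lia.
pose i1 := Ordinal lt1; pose i2 := Ordinal lt2.
have ne : i1 != i2 by rewrite -val_eqE /= -[X in X != _]addn0 -addn1 eqn_add2l.
rewrite /detl; set A := (X in _ = - \det X).
have -> : (\matrix_(i < P, j < P) nth (fun=> 0) (s1 ++ y :: x :: s2) i j)
    = xrow i1 i2 A.
  apply/matrixP => i j; rewrite !mxE !nth_cat.
  case: tpermP => [->|->|/eqP n1 /eqP n2] /=.
  - by rewrite ltnn subnn /= ltnNge leqnSn /= subSnn.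
  - by rewrite ltnn subnn /= ltnNge leqnSn /= subSnn.
  move: n1 n2; rewrite -!val_eqE /= => n1 n2; case: ltnP => // le.
  case E : (i - size s1)%N => [|[|k]] //=; lia.
by rewrite xrowE det_mulmx det_perm odd_tperm ne expr1 mulN1r.
Qed.

Lemma detl_move P s1 s2 x s3 : size (s1 ++ x :: s2 ++ s3) = P ->
  detl P (s1 ++ s2 ++ x :: s3) = (-1) ^+ size s2 * detl P (s1 ++ x :: s2 ++ s3).
Proof.
elim: s2 s1 => [|y s2 IH] s1 /=; first by rewrite mul1r.
move=> sP; rewrite -[s1 ++ y :: _]cat_rcons IH; last first.
  by rewrite cat_rcons -sP !size_cat /= size_cat /=; lia.
by rewrite cat_rcons detl_swap // exprS mulrN mulN1r mulNr.
Qed.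

Lemma detl_dup P s1 s2 x s3 : size (s1 ++ x :: s2 ++ x :: s3) = P ->
  detl P (s1 ++ x :: s2 ++ x :: s3) = 0.
Proof.
rewrite size_cat /= size_cat /= => sP.
have lt1 : (size s1 < P)%N by lia.
have lt2 : ((size s1 + size s2).+1 < P)%N by lia.
apply: (@determinant_alternate _ _ _ (Ordinal lt1) (Ordinal lt2)).
  by rewrite -val_eqE /=; lia.
move=> j; rewrite !mxE !nth_cat /= ltnn subnn /=.
rewrite ltnNge (_ : (size s1 <= _)%N) /=; last by lia.
rewrite subSn ?leq_addr //= nth_cat addKn ltnn subnn //=.
Qed.

Lemma detl_lin P s1 s2 (I : Type) (r : seq I) (Pr : pred I) (c : I -> R)
    (x : I -> nat -> R) :
  (size s1 < P)%N ->
  detl P (s1 ++ (fun j => \sum_(k <- r | Pr k) c k * x k j) :: s2)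
  = \sum_(k <- r | Pr k) c k * detl P (s1 ++ x k :: s2).
Proof.
move=> lt1; pose i0 := Ordinal lt1.
pose M y := \matrix_(i < P, j < P) nth (fun=> 0) (s1 ++ y :: s2) i j.
(* Cofactors along row [i0] do not involve that row, so the expansion along it is linear in [y]. *)
have cofE y j : cofactor (M y) i0 j = cofactor (M (fun=> 0)) i0 j.
  rewrite /cofactor; congr (_ * \det _); apply/matrixP => i k; rewrite !mxE.
  rewrite !nth_cat; case: ltnP => // le; case E : (_ - _)%N => //=.
  move: E le; rewrite /= /bump; case: leqP; lia.
have detE y : detl P (s1 ++ y :: s2) = \sum_j y (val j) * cofactor (M (fun=> 0)) i0 j.
  rewrite /detl (expand_det_row _ i0); apply: eq_bigr => j _.
  by rewrite -[in LHS]/(M y) cofE !mxE nth_cat ltnn subnn.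
rewrite detE; under [RHS]eq_bigr => k _ do rewrite detE mulr_sumr.
rewrite exchange_big /=; apply: eq_bigr => j _.
by rewrite mulr_suml; apply: eq_bigr => k _; rewrite mulrA.
Qed.

(** Scaling is multiplication by diagonal matrices. The reindexings [f] and [g] are there because
    the factors will be functions of the beads. *)
Lemma det_scale n (c d : nat -> R) (A : 'I_n -> 'I_n -> R) (f g : nat -> nat) :
  \det (\matrix_(i < n, j < n) (c (f i) * A i j * d (g j)))
  = \prod_(i < n) c (f i) * \det (\matrix_(i < n, j < n) A i j)
    * \prod_(j < n) d (g j).
Proof.
have detd (u : nat -> R) : \prod_(i < n) u i = \det (diag_mx (\row_(i < n) u i)).
  by rewrite det_diag; apply: eq_bigr => i _; rewrite mxE.
rewrite (detd (c \o f)) (detd (d \o g)) -!det_mulmx; congr (\det _).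
by apply/matrixP => i j; rewrite mul_mx_diag mul_diag_mx !mxE.
Qed.

Lemma detl_mul P (s w : seq (nat -> R)) : size s = P ->
  detl P [seq (fun j => \sum_(k < P) x k * nth (fun=> 0) w k j) | x <- s]
  = detl P s * detl P w.
Proof.
move=> sP; rewrite /detl -det_mulmx; congr (\det _); apply/matrixP => i j.
rewrite !mxE (nth_map (fun=> 0)) ?sP //; apply: eq_bigr => k _.
by rewrite !mxE.
Qed.

Definition unit_row (k : nat) : nat -> R := fun j => (j == k)%:R.

(* The sign of a permutation, found by peeling off the largest element of the
   interval, which comes first or last. *)
Lemma detl_unit_rows P (J : pred nat) :
  detl P (map unit_row (rev [seq j <- iota 0 P | J j]
                        ++ [seq j <- iota 0 P | ~~ J j]))
  = (-1) ^+ (\sum_(j < P | J j) j).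
Proof.
elim: P => [|P IH]; first by rewrite /detl det_mx00 big_ord0.
rewrite -addn1 iotaD !filter_cat /= add0n rev_cat addn1 big_mkcond big_ord_recr /=.
rewrite -big_mkcond /=.
set l1 := rev [seq j <- iota 0 P | J j].
set l2 := [seq j <- iota 0 P | ~~ J j].
have szP : size (l1 ++ l2) = P.
  by rewrite size_cat size_rev !size_filter -[RHS](size_iota 0) -(count_predC J).
have l12P k : k \in l1 ++ l2 -> (k < P)%N.
  rewrite mem_cat mem_rev !mem_filter mem_iota; lia.
have nthE i : (i < P)%N -> (nth 0%N (l1 ++ l2) i < P)%N.
  by move=> ltiP; apply/l12P/mem_nth; rewrite szP.
have nthM i : (i < P)%N -> nth (fun=> 0) (map unit_row (l1 ++ l2)) i =
    unit_row (nth 0%N (l1 ++ l2) i).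
  by move=> ltiP; rewrite (nth_map 0%N) ?szP.
case: (J P) => /=.
  rewrite cats0 /detl (expand_det_row _ ord0) (bigD1 ord_max) //= big1 ?addr0.
    rewrite !mxE /= /unit_row eqxx mul1r /cofactor /= add0n exprD mulrC.
    congr (_ * _); rewrite -IH; congr (\det _).
    by apply/matrixP => i j; rewrite !mxE lift_max lift0.
  by move=> j /negbTE nj; rewrite !mxE /= /unit_row -[j == P :> nat]/(j == ord_max) nj mul0r.
rewrite addn0 -IH /= catA map_cat /= /detl (expand_det_row _ ord_max).
rewrite (bigD1 ord_max) //= big1 ?addr0.
  rewrite !mxE /= nth_cat size_map szP ltnn subnn /= /unit_row eqxx mul1r.
  rewrite /cofactor /= addnn -signr_odd odd_double mul1r.
  congr (\det _); apply/matrixP => i j; rewrite !mxE !lift_max /=.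
  by rewrite nth_cat size_map szP ltn_ord.
move=> j /negbTE nj; rewrite !mxE /= nth_cat size_map szP ltnn subnn /= /unit_row.
by rewrite -[j == P :> nat]/(j == ord_max) nj mul0r.
Qed.

End DetList.

(** * The Cauchy-Binet formula, with column sets as decreasing functions *)

Section CauchyBinet.

Variables (R : comNzRingType) (n P : nat).
Implicit Types (f g : {ffun 'I_n -> 'I_P}) (s : 'S_n).

(** An n-subset of ['I_P] is represented by its decreasing enumeration, the order in which the beads
    of a partition come. *)
Definition decreasing g : bool :=
  [forall i : 'I_n, forall j : 'I_n, (i < j)%N ==> (g j < g i)%N].

Lemma decreasing_lt g (i j : 'I_n) : decreasing g -> (g j < g i)%N = (i < j)%N.
Proof.
move=> /forallP dg; apply/idP/idP => [|lt_ij]; last first.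
  by have /forallP/(_ j)/implyP := dg i; apply.
case: (ltngtP i j) => // [lt_ji|/val_inj ->]; last by rewrite ltnn.
have /forallP/(_ i)/implyP/(_ lt_ji) := dg j; lia.
Qed.

Let comp g s : {ffun 'I_n -> 'I_P} := [ffun i => g (s i)].

(** The rank of [f i] among the values of [f] recovers [s i]. Hence an injective function is in only
    one way a decreasing one composed with a permutation. *)
Let compE f g s : decreasing g -> comp g s = f ->
  forall i, (s i : nat) = #|[set k | (f i < f k)%N]|.
Proof.
move=> dg <- i.
have -> : [set k | (comp g s i < comp g s k)%N] = [set k | (s k < s i)%N].
  by apply/setP => k; rewrite !inE !ffunE decreasing_lt.
rewrite -(card_imset _ (@perm_inj _ s)).
rewrite (_ : [set _ | _ in _] = [set k : 'I_n | (k < s i)%N]); last first.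
  apply/setP => k; rewrite inE; apply/imsetP/idP => [[j]|lt_k].
    by rewrite inE => ? ->.
  by exists ((s^-1)%g k); rewrite ?inE permKV.
rewrite -sum1_card (eq_bigl (fun k : 'I_n => (k < s i)%N)); last by move=> k; rewrite inE.
rewrite -(big_ord_widen n (fun=> 1%N)); last exact/ltnW/ltn_ord.
by rewrite sum1_card card_ord.
Qed.

Let comp_inj g g' s s' : decreasing g -> decreasing g' ->
  comp g s = comp g' s' -> (g, s) = (g', s').
Proof.
move=> dg dg' E.
have ss' : s = s'.
  by apply/permP => i; apply: val_inj; rewrite /= (compE dg E) (compE dg' erefl).
rewrite -ss' in E *; congr pair; apply/ffunP => i.
by move/ffunP/(_ ((s^-1)%g i)): E; rewrite !ffunE permKV.
Qed.

Let comp_surj f : injective f -> exists2 g, decreasing g & exists s, comp g s = f.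
Proof.
move=> inj_f.
have rk_lt i : (#|[set k | (f i < f k)%N]| < n)%N.
  rewrite -[n in (_ < n)%N]card_ord -cardsT; apply: proper_card.
  by apply/properP; split; [apply: finset.subsetT|exists i; rewrite ?inE ?ltnn].
pose rk i := Ordinal (rk_lt i).
have rkS i j : (f i < f j)%N -> (rk j < rk i)%N.
  move=> lt_ij; apply: proper_card; apply/properP; split.
    by apply/fintype.subsetP => k; rewrite !inE; apply: ltn_trans.
  by exists j; rewrite !inE ?ltnn.
have inj_rk : injective rk.
  move=> i j Eij; case: (ltngtP (f i) (f j)) => [/rkS|/rkS|/val_inj/inj_f //];
    by rewrite Eij ltnn.
pose s := perm inj_rk.
exists [ffun i => f ((s^-1)%g i)].
  apply/forallP => i; apply/forallP => j; apply/implyP => lt_ij; rewrite !ffunE.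
  have E k : rk ((s^-1)%g k) = k by rewrite -[rk _](permE inj_rk) permKV.
  rewrite ltnNge leq_eqVlt; apply/negP => /orP[/eqP/val_inj/inj_f/perm_inj Eij|/rkS].
    by rewrite Eij ltnn in lt_ij.
  by rewrite !E; lia.
by exists s; apply/ffunP => i; rewrite !ffunE permK.
Qed.

(** Expanding the rows of the product gives a sum over all functions [f]; the injective ones regroup
    as a column set [g] and a permutation, and summing over the latter rebuilds the minor of [A]. *)
Lemma cauchy_binet (A : 'I_n -> 'I_P -> R) (B : 'I_P -> 'I_n -> R) :
  \det (\matrix_(i < n, j < n) \sum_(c < P) A i c * B c j)
  = \sum_(g | decreasing g) \det (\matrix_(i < n, k < n) A i (g k))
                            * \det (\matrix_(k < n, j < n) B (g k) j).
Proof.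
pose Bf f := \det (\matrix_(k < n, j < n) B (f k) j).
have lhsE : \det (\matrix_(i < n, j < n) \sum_(c < P) A i c * B c j)
    = \sum_(f : {ffun 'I_n -> 'I_P}) (\prod_i A i (f i)) * Bf f.
  transitivity (\sum_(s : 'S_n) \sum_(f : {ffun 'I_n -> 'I_P})
      (-1) ^+ s * \prod_i (A i (f i) * B (f i) (s i))).
    apply: eq_bigr => s _; rewrite -mulr_sumr; congr (_ * _).
    rewrite -(bigA_distr_bigA (fun i c => A i c * B c (s i))) /=.
    by apply: eq_bigr => i _; rewrite mxE.
  rewrite exchange_big; apply: eq_bigr => f _ /=.
  rewrite /Bf /determinant mulr_sumr; apply: eq_bigr => s _.
  rewrite big_split /= mulrCA; congr (_ * (_ * _)).
  by apply: eq_bigr => i _; rewrite mxE.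
(* A function that is not injective repeats a row of [B]. *)
rewrite lhsE (bigID (fun f => injectiveb f)) /= [X in _ + X]big1 ?addr0; last first.
  move=> f /injectivePn[i [j ne_ij Eij]]; rewrite /Bf.
  by rewrite (determinant_alternate ne_ij) ?mulr0 // => k; rewrite !mxE Eij.
transitivity (\sum_(gs : {ffun 'I_n -> 'I_P} * 'S_n | decreasing gs.1)
    (\prod_i A i (comp gs.1 gs.2 i)) * Bf (comp gs.1 gs.2)); last first.
  transitivity (\sum_(g | decreasing g) \sum_(s : 'S_n)
      (\prod_i A i (comp g s i)) * Bf (comp g s)).
    by rewrite pair_big_dep; apply: eq_bigl => gs; rewrite andbT.
  apply: eq_bigr => g _; rewrite [in RHS]/determinant mulr_suml.
  apply: eq_bigr => s _; rewrite -[in RHS]mulrA mulrCA; congr (_ * _).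
    by apply: eq_bigr => i _; rewrite mxE ffunE.
  rewrite /Bf -det_perm -det_mulmx -row_permE.
  by congr (\det _); apply/matrixP => i j; rewrite !mxE ffunE.
rewrite [RHS](partition_big (fun gs => comp gs.1 gs.2) (fun f => injectiveb f)) /=.
  apply: eq_bigr => f /injectiveP inj_f.
  have [g dg [s E]] := comp_surj inj_f.
  rewrite (big_pred1 (g, s)) /= ?E // => -[g' s'] /=.
  apply/andP/eqP => [[dg' /eqP E']|[-> ->]]; last by rewrite E eqxx.
  by apply: comp_inj; rewrite ?E.
move=> [g s] /= dg; apply/injectiveP => i j; rewrite !ffunE => E.
apply: (@perm_inj _ s); apply: val_inj; case: (ltngtP (s i) (s j)) => //;
  by rewrite -(decreasing_lt _ _ dg) E ltnn.
Qed.

End CauchyBinet.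

(** * Partitions and beads *)

Arguments part : simpl never.

Section Partitions.

Implicit Types (mu nu : intpart) (n m P : nat).

Lemma part_noninc mu i j : (i <= j)%N -> (part mu j <= part mu i)%N.
Proof.
case/andP: (partsP mu) => smu _ le_ij; rewrite /part.
have [lt_j|le_j] := ltnP j (size mu); last by rewrite nth_default.
apply: (sorted_leq_nth _ _ 0%N smu) => //; rewrite ?inE //; try exact: leq_ltn_trans lt_j.
- by move=> a b c; rewrite /geq /=; lia.
- by move=> a; rewrite /geq /=.
Qed.

Lemma part_gt0 mu i : (0 < part mu i)%N = (i < size mu)%N.
Proof.
case/andP: (partsP mu) => _ n0; rewrite /part.
have [lt_i|le_i] := ltnP i (size mu); last by rewrite nth_default.
by rewrite lt0n; apply/eqP => E; case/negP: n0; rewrite -E mem_nth.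
Qed.

Lemma map_iotaP (T : eqType) (f : nat -> T) n x :
  reflect (exists2 i, (i < n)%N & x = f i) (x \in [seq f i | i <- iota 0 n]).
Proof.
apply: (iffP mapP) => -[i]; first by rewrite mem_iota => lt_i ->; exists i.
by move=> lt_i ->; exists i; rewrite ?mem_iota.
Qed.

Lemma part0 mu i : (size mu <= i)%N -> part mu i = 0%N.
Proof. exact: nth_default. Qed.

Lemma intpart_eq mu nu : (forall i, part mu i = part nu i) -> mu = nu.
Proof.
move=> E; have Esz : size mu = size nu.
  have le (a b : intpart) : (forall i, part a i = part b i) -> (size a <= size b)%N.
    move=> Eab; rewrite leqNgt -part_gt0 Eab part_gt0; lia.
  by apply/eqP; rewrite eqn_leq !le // => i; rewrite E.
apply: val_inj; apply: (@eq_from_nth _ 0%N) => // i _; exact: E.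
Qed.

(** Both sides say that the box (i, j) lies in the diagram of [mu]; most of what is used about
    conjugates is drawn from this. *)
Lemma part_conj mu i j : (i < part (conj_part mu) j)%N = (j < part mu i)%N.
Proof.
have -> : part (conj_part mu) j = count (fun k => (j < k)%N) mu.
  rewrite /part /= /conj_seq; have [lt_j|le_j] := ltnP j (head 0%N mu).
    by rewrite (nth_map 0%N) ?size_iota // nth_iota.
  rewrite nth_default ?size_map ?size_iota //; apply/esym/eqP; rewrite -leqn0 leqNgt -has_count.
  apply/hasPn => k /(nthP 0%N)[a _ <-]; rewrite -leqNgt.
  by apply: leq_trans (part_noninc mu (leq0n a)) _; rewrite /part nth0.
have cE s : sorted geq s ->
    (i < count (fun k => (j < k)%N) s)%N = (j < nth 0%N s i)%N.
  elim: s i => [|x s IH] i /=; first by rewrite nth_default.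
  move=> ps; have ss := path_sorted ps.
  case: (ltnP j x) => [lt_jx|le_xj].
    by case: i => //= i; rewrite add1n ltnS IH.
  have -> : count (fun k => (j < k)%N) s = 0%N.
    apply/eqP; rewrite -leqn0 leqNgt -has_count; apply/hasPn => k ks; rewrite -leqNgt.
    have: all (geq x) s by apply: order_path_min ps => a b c; rewrite /geq /=; lia.
    by move/allP/(_ k ks); rewrite /geq /=; lia.
  rewrite addn0 ltn0; apply/esym/negbTE; rewrite -leqNgt.
  case: i => //= i; have [lt_i|le_i] := ltnP i (size s); last by rewrite nth_default.
  have: all (geq x) s by apply: order_path_min ps => a b c; rewrite /geq /=; lia.
  by move/allP/(_ _ (mem_nth 0%N lt_i)); rewrite /geq /=; lia.
by apply: cE; case/andP: (partsP mu).
Qed.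

Lemma conj_partK : involutive conj_part.
Proof.
move=> mu; apply: intpart_eq => i; apply/eqP.
have E j : (j < part (conj_part (conj_part mu)) i)%N = (j < part mu i)%N.
  by rewrite !part_conj.
by rewrite eqn_leq leqNgt E ltnn leqNgt -E ltnn.
Qed.

Lemma size_conj mu : size (conj_part mu) = part mu 0.
Proof. by rewrite size_map size_iota -nth0. Qed.

Lemma part_conj0 mu : part (conj_part mu) 0 = size mu.
Proof. by rewrite -{2}[mu]conj_partK size_conj. Qed.

Lemma part_empty i : part empty_part i = 0%N.
Proof. by rewrite /part /= nth_nil. Qed.

Lemma conj_empty : conj_part empty_part = empty_part.
Proof. exact: val_inj. Qed.

Definition in_box n m mu : bool := (size mu <= n)%N && (part mu 0 <= m)%N.

Lemma in_box_conj n m mu : in_box n m (conj_part mu) = in_box m n mu.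
Proof. by rewrite /in_box size_conj part_conj0 andbC. Qed.

Lemma psize_box n m mu : (psize mu <= n)%N -> (psize mu <= m)%N -> in_box n m mu.
Proof.
have le1 : (size mu <= psize mu)%N.
  case/andP: (partsP mu) => _; rewrite /psize; elim: (val mu) => //= x s IH.
  by rewrite inE negb_or => /andP[x0 /IH]; lia.
have le2 : (part mu 0 <= psize mu)%N.
  by rewrite /part /psize; case: (val mu) => //= x s; rewrite leq_addr.
by move=> le_n le_m; rewrite /in_box (leq_trans le1) ?(leq_trans le2).
Qed.

(** For [i < n], the i-th element of the Maya set of [mu] shifted by [n] into the natural
    numbers. *)
Definition bead n (mu : seq nat) i : nat := (part mu i + (n - i.+1))%N.

Lemma bead_dec n mu i j : (i < j)%N -> (j < n)%N -> (bead n mu j < bead n mu i)%N.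
Proof. by move=> ij jn; have := part_noninc mu (ltnW ij); rewrite /bead; lia. Qed.

Lemma bead_lt n m mu i : in_box n m mu -> (i < n)%N -> (bead n mu i < n + m)%N.
Proof.
by case/andP => _ le_m lt_i; have := part_noninc mu (leq0n i); rewrite /bead; lia.
Qed.

Lemma bead_empty n i : bead n empty_part i = (n - i.+1)%N.
Proof. by rewrite /bead part_empty. Qed.

Definition parts_of n (f : nat -> nat) : seq nat := [seq x <- mkseq f n | (0 < x)%N].

Lemma parts_ofP n f : sorted geq (mkseq f n) -> is_intpart (parts_of n f).
Proof.
move=> sf; apply/andP; split; last by rewrite mem_filter.
by apply: sorted_filter => // a b c; rewrite /geq /=; lia.
Qed.

Lemma part_parts_of n f i : sorted geq (mkseq f n) ->
  part (parts_of n f) i = if (i < n)%N then f i else 0%N.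
Proof.
move=> sf; have -> : part (parts_of n f) i = nth 0%N (mkseq f n) i.
  rewrite /parts_of /part; elim: (mkseq f n) sf i => //= x s IH ps i.
  case: posnP => [x0|_] /=; last by case: i => //= i; apply/IH/path_sorted/ps.
  have s0 y : y \in s -> y = 0%N.
    have: all (geq x) s by apply: order_path_min ps => a b c; rewrite /geq /=; lia.
    by move/allP => al /al; rewrite /geq /= x0; lia.
  have -> : [seq x <- s | (0 < x)%N] = [::].
    by apply/eqP; rewrite -[_ == _]negbK -has_filter; apply/hasPn => y /s0 ->.
  rewrite nth_nil; case: i => //= i; have [lt_i|le_i] := ltnP i (size s).
    by rewrite (s0 (nth 0%N s i)) // mem_nth.
  by rewrite nth_default.
case: ltnP => [lt_i|le_i]; first by rewrite nth_mkseq.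
by rewrite nth_default // size_mkseq.
Qed.

Lemma mkseq_geq n f : (forall i j, (i < j)%N -> (j < n)%N -> (f j <= f i)%N) ->
  sorted geq (mkseq f n).
Proof.
move=> fP; apply/(sortedP 0%N) => i; rewrite size_mkseq => lt_i.
by rewrite !nth_mkseq ?(ltnW lt_i) //; apply: fP.
Qed.

Section BoxSum.

Variables (n P : nat).
Implicit Types g : {ffun 'I_n -> 'I_P}.

Let value g (i : nat) : nat := if insub i is Some k then g k else 0%N.

Let valueE g (i : 'I_n) : value g i = g i.
Proof. by rewrite /value valK. Qed.

Let lower g i := (value g i - (n - i.+1))%N.

Let value_dec g i j : decreasing g -> (i <= j)%N -> (j < n)%N ->
  (value g j + (j - i) <= value g i)%N.
Proof.
move=> dg; elim: j => [|j IH]; first by rewrite leqn0 => /eqP ->; rewrite addn0.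
rewrite leq_eqVlt => /orP[/eqP->|]; first by rewrite subnn addn0.
rewrite ltnS => le_ij lt_j; have /IH := le_ij => /(_ (ltnW lt_j)).
have := decreasing_lt (Ordinal (ltnW lt_j)) (Ordinal lt_j) dg.
rewrite -!valueE /= ltnSn; lia.
Qed.

Let lower_sorted g : decreasing g -> sorted geq (mkseq (lower g) n).
Proof.
move=> dg; apply: mkseq_geq => i j ij jn.
by have := value_dec dg (ltnW ij) jn; rewrite /lower; lia.
Qed.

Let le_value g i : decreasing g -> (i < n)%N -> (n - i.+1 <= value g i)%N.
Proof.
move=> dg lt_i; have lt_n : (n.-1 < n)%N by lia.
by have := @value_dec g i n.-1 dg ltac:(lia) lt_n; lia.
Qed.

(** Subtracting the staircase from a strictly decreasing function leaves a partition. The default of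
    [insubd] can only be reached when [g] is not decreasing. *)
Definition part_of g : intpart :=
  insubd empty_part (parts_of n (lower g)).

Lemma part_part_of g i : decreasing g ->
  part (part_of g) i = if (i < n)%N then lower g i else 0%N.
Proof.
move=> dg; rewrite /part_of -part_parts_of ?lower_sorted //.
by rewrite insubdK //; apply/parts_ofP/lower_sorted.
Qed.

Lemma bead_part_of g (i : 'I_n) : decreasing g -> bead n (part_of g) i = g i.
Proof.
move=> dg; rewrite /bead part_part_of // ltn_ord /lower subnK; first exact: valueE.
exact: le_value.
Qed.

Definition boxparts : seq intpart :=
  [seq part_of g | g <- enum [pred g : {ffun 'I_n -> 'I_P} | decreasing g]].

Lemma boxparts_uniq : uniq boxparts.
Proof.
rewrite map_inj_in_uniq ?enum_uniq // => g g'; rewrite !mem_enum !inE => dg dg' E.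
by apply/ffunP => i; apply: val_inj; rewrite /= -!bead_part_of // E.
Qed.

Lemma big_boxparts (R : nmodType) (F : intpart -> R) :
  \sum_(la <- boxparts) F la
  = \sum_(g : {ffun 'I_n -> 'I_P} | decreasing g) F (part_of g).
Proof. by rewrite big_map big_enum_cond /=; apply: eq_bigl => g; rewrite andbT. Qed.

Lemma mem_boxparts la : (n <= P)%N -> (la \in boxparts) = in_box n (P - n) la.
Proof.
move=> le_nP; apply/mapP/idP => [[g]|bx].
  rewrite mem_enum inE => dg ->; apply/andP; split.
    by rewrite leqNgt -part_gt0 part_part_of // ltnn.
  rewrite part_part_of //; case: ltnP => // lt0; rewrite /lower.
  by have := ltn_ord (g (Ordinal lt0)); rewrite -valueE /=; lia.
have ltP (i : 'I_n) : (bead n la i < P)%N.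
  by rewrite -(subnKC le_nP); apply: bead_lt.
have dg : decreasing [ffun i => Ordinal (ltP i)].
  apply/forallP => i; apply/forallP => j; apply/implyP => ij; rewrite !ffunE /=.
  exact: bead_dec.
exists [ffun i => Ordinal (ltP i)]; first by rewrite mem_enum inE.
apply: intpart_eq => i; rewrite part_part_of //; case: ltnP => [lt_i|le_i].
  by rewrite /lower -[i]/(val (Ordinal lt_i)) valueE ffunE /= /bead addnK.
by apply: part0; case/andP: bx; lia.
Qed.

Lemma cauchy_binet_part (R : comNzRingType) (A B : nat -> nat -> R) :
  \det (\matrix_(i < n, j < n) \sum_(c < P) A i c * B c j)
  = \sum_(la <- boxparts) \det (\matrix_(i < n, k < n) A i (bead n la k))
                        * \det (\matrix_(k < n, j < n) B (bead n la k) j).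
Proof.
rewrite (cauchy_binet (fun (i : 'I_n) (c : 'I_P) => A i c)
  (fun (c : 'I_P) (j : 'I_n) => B c j)) big_boxparts.
apply: eq_bigr => g dg; congr (_ * _); congr (\det _);
  by apply/matrixP => i j; rewrite !mxE bead_part_of.
Qed.

End BoxSum.

(* Macdonald, Symmetric Functions and Hall Polynomials, I (1.7). *)
Lemma bead_compl n m mu c : in_box n m mu -> (c < n + m)%N ->
  (c \in [seq bead n mu i | i <- iota 0 n])
  = (c \notin [seq (n + m).-1 - bead m (conj_part mu) i | i <- iota 0 m]%N).
Proof.
move=> bx lt_c; set l1 := map _ _; set l2 := map _ _.
have bx' : in_box m n (conj_part mu) by rewrite in_box_conj.
have disj x : x \in l1 -> x \notin l2.
  move=> /map_iotaP[i lt_i ->].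
  apply/negP => /map_iotaP[j lt_j].
  have := bead_lt bx' lt_j; have := part_conj mu i j; rewrite /bead.
  by case: ltnP; case: ltnP => //; lia.
have u1 : uniq l1.
  rewrite map_inj_in_uniq ?iota_uniq // => i j; rewrite !mem_iota !add0n => /andP[_ li] /andP[_ lj] E.
  case: (ltngtP i j) => // lij; [have := bead_dec mu lij lj|have := bead_dec mu lij li];
    by rewrite E ltnn.
have u2 : uniq l2.
  rewrite map_inj_in_uniq ?iota_uniq // => i j; rewrite !mem_iota !add0n => /andP[_ li] /andP[_ lj] E.
  have := bead_lt bx' li; have := bead_lt bx' lj => Hi Hj.
  case: (ltngtP i j) => // lij; [have := bead_dec (conj_part mu) lij lj|have := bead_dec (conj_part mu) lij li]; lia.
have sub : {subset l1 ++ l2 <= iota 0 (n + m)}.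
  move=> x; rewrite mem_cat mem_iota add0n => /orP[] /map_iotaP[i li ->].
    exact: bead_lt.
  lia.
have u12 : uniq (l1 ++ l2).
  rewrite cat_uniq u1 u2 andbT; apply/hasPn => x x2; apply/negP => /disj.
  by rewrite x2.
have [_ E] : (size (l1 ++ l2) = size (iota 0 (n + m))) * (l1 ++ l2 =i iota 0 (n + m)).
  by apply: uniq_min_size => //; rewrite size_cat !size_map !size_iota.
have := E c; rewrite mem_cat mem_iota add0n /= lt_c.
by have := disj c; case: (c \in l1) => [/(_ isT)|_ /= ->].
Qed.

Lemma beads_sorted n mu : sorted ltn (rev [seq bead n mu i | i <- iota 0 n]).
Proof.
rewrite rev_sorted; apply/(sortedP 0%N) => i; rewrite size_map size_iota => lt_i.
rewrite !(nth_map 0%N) ?size_iota ?(ltnW lt_i) // !nth_iota ?(ltnW lt_i) //.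
by apply: bead_dec; rewrite ?add0n.
Qed.

(** Both lists decrease and have the same elements. The filtered interval is the form in which
    [detl_unit_rows] takes a set of columns. *)
Lemma beadsE n m mu : in_box n m mu ->
  [seq bead n mu i | i <- iota 0 n]
  = rev [seq j <- iota 0 (n + m) | j \in [seq bead n mu i | i <- iota 0 n]].
Proof.
move=> bx; rewrite -[LHS]revK; congr rev.
apply: (@irr_sorted_eq _ ltn) => //.
- by move=> a b c; apply: ltn_trans.
- by move=> a; apply: ltnn.
- exact: beads_sorted.
- by apply: sorted_filter; [move=> a b c; apply: ltn_trans | apply: iota_ltn_sorted].
move=> c; rewrite mem_rev mem_filter mem_iota add0n; apply/esym/andb_idr.
by move=> /map_iotaP[i li ->]; apply: bead_lt.
Qed.

Lemma beads_conjE n m mu : in_box n m mu ->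
  [seq (n + m).-1 - bead m (conj_part mu) i | i <- iota 0 m]%N
  = [seq j <- iota 0 (n + m) | j \notin [seq bead n mu i | i <- iota 0 n]].
Proof.
move=> bx; have bx' : in_box m n (conj_part mu) by rewrite in_box_conj.
apply: (@irr_sorted_eq _ ltn) => //.
- by move=> a b c; apply: ltn_trans.
- by move=> a; apply: ltnn.
- apply/(sortedP 0%N) => i; rewrite size_map size_iota => lt_i.
  rewrite !(nth_map 0%N) ?size_iota ?(ltnW lt_i) // !nth_iota ?(ltnW lt_i) // !add0n.
  have := @bead_dec m (conj_part mu) i i.+1 (ltnSn i) lt_i.
  by have := bead_lt bx' (ltnW lt_i); lia.
- by apply: sorted_filter; [move=> a b c; apply: ltn_trans | apply: iota_ltn_sorted].
move=> c; rewrite mem_filter mem_iota add0n /=.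
case: (ltnP c (n + m)) => [lt_c|le_c]; first by rewrite (bead_compl bx) // negbK andbT.
rewrite andbF; apply/negbTE/negP => /map_iotaP[i li E].
by have := bead_lt bx' li; lia.
Qed.

Lemma sum_ltn_ord k l : (k <= l)%N -> (\sum_(j < l) (j < k))%N = k.
Proof.
move=> le_kl; rewrite -[RHS]card_ord -sum1_card (big_ord_widen l (fun=> 1%N)) //.
by rewrite [RHS]big_mkcond; apply: eq_bigr => j _; case: ltnP.
Qed.

(** Row [i] contributes to kappa twice the sum of its contents j - i. The indicator extends the sum
    to a full box, where rows and columns can be exchanged; this is how conjugation is seen to
    change the sign of kappa. *)
Lemma content_sum (i k l : nat) : (k <= l)%N ->
  \sum_(j < l) (j < k)%:R * (2 * (j%:Z - i%:Z)) = k%:Z * (k%:Z - 2 * i.+1%:Z + 1).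
Proof.
move=> le_kl; transitivity (\sum_(j < k) (2 * (j%:Z - i%:Z))).
  rewrite (big_ord_widen l (fun j => 2 * (j%:Z - i%:Z))) // [RHS]big_mkcond.
  by apply: eq_bigr => j _; case: ltnP => _; rewrite ?mul1r ?mul0r.
elim: (k) => [|a IH]; first by rewrite big_ord0 mul0r.
by rewrite big_ord_recr /= IH; lia.
Qed.

Lemma psizeE n mu : (size mu <= n)%N -> psize mu = (\sum_(i < n) part mu i)%N.
Proof.
move=> le_n; rewrite /psize sumnE (big_nth 0%N) big_mkord.
rewrite (big_ord_widen n (nth 0%N mu)) // big_mkcond /=.
by apply: eq_bigr => i _; case: ltnP => // le; rewrite part0.
Qed.

Lemma kappaE n mu : (size mu <= n)%N ->
  kappa mu = \sum_(i < n) (part mu i)%:Z * ((part mu i)%:Z - 2 * i.+1%:Z + 1).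
Proof.
move=> le_n; rewrite /kappa.
rewrite (big_ord_widen n (fun i => (part mu i)%:Z * ((part mu i)%:Z - 2 * i.+1%:Z + 1))) //.
rewrite big_mkcond /=; apply: eq_bigr => i _; case: ltnP => // le.
by rewrite part0 // mul0r.
Qed.

Lemma psize_conj mu : psize (conj_part mu) = psize mu.
Proof.
pose n := size mu; pose m := part mu 0.
have boxE (nu : intpart) k l : in_box k l nu ->
    psize nu = (\sum_(i < k) \sum_(j < l) (j < part nu i))%N.
  case/andP => sk sl; rewrite (psizeE sk); apply: eq_bigr => i _.
  by rewrite sum_ltn_ord // (leq_trans (part_noninc _ (leq0n i))).
have bx : in_box n m mu by rewrite /in_box !leqnn.
rewrite (boxE _ n m bx) (boxE _ m n) ?in_box_conj // exchange_big /=.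
by apply: eq_bigr => i _; apply: eq_bigr => j _; rewrite part_conj.
Qed.

Lemma kappa_box n m mu : in_box n m mu ->
  kappa mu = \sum_(i < n) \sum_(j < m) (j < part mu i)%:R * (2 * (j%:Z - i%:Z)).
Proof.
case/andP => le_n le_m; rewrite (kappaE le_n); apply: eq_bigr => i _.
exact/esym/content_sum/(leq_trans (part_noninc _ (leq0n i))).
Qed.

Lemma kappa_conj mu : kappa (conj_part mu) = - kappa mu.
Proof.
have bx : in_box (size mu) (part mu 0) mu by rewrite /in_box !leqnn.
have bx' : in_box (part mu 0) (size mu) (conj_part mu) by rewrite in_box_conj.
rewrite (kappa_box bx) (kappa_box bx') exchange_big /= -sumrN.
apply: eq_bigr => i _; rewrite -sumrN; apply: eq_bigr => j _; rewrite part_conj.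
by rewrite -mulrN; congr (_ * _); lia.
Qed.

End Partitions.

(** * Symmetric functions *)

Lemma fsum_seq (R : nmodType) (I : choiceType) (s : seq I) (F : I -> R) :
  uniq s -> (forall i, i \notin s -> F i = 0) ->
  \sum_(i \in [set: I]%classic) F i = \sum_(i <- s) F i.
Proof.
move=> us F0; rewrite (fsbigE s) //; last by move=> i _ /F0.
by rewrite big_mkcond; apply: eq_bigr => i _; rewrite in_setT.
Qed.

Section Weights.

Variable K : fieldType.

(** The exponent of [be] is chosen so that, for a = x + t, a(a + 1) - t(t + 1) = x(x + 2t + 1); with
    t = -i this is the term of kappa of the i-th part x. *)
Definition weight (al be : K) (a : int) : K := al ^ a * be ^ (a * (a + 1)).

Lemma weight_neq0 al be a : al != 0 -> be != 0 -> weight al be a != 0.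
Proof. by move=> al0 be0; rewrite mulf_neq0 // expfz_neq0. Qed.

(** The first product on the right is the value at the empty partition. A shift of all the beads by
    [s] only multiplies [al] by [be ^ (2 * s)]. *)
Lemma prod_weight n (mu : intpart) al be (s : int) :
  (size mu <= n)%N -> al != 0 -> be != 0 ->
  \prod_(i < n) weight al be ((bead n mu i)%:Z - n%:Z + s)
  = \prod_(i < n) weight al be (s - i.+1%:Z)
    * ((al * be ^ (2 * s)) ^+ psize mu * be ^ kappa mu).
Proof.
move=> le_n al0 be0; rewrite (psizeE le_n) (kappaE le_n) expr_sum.
rewrite (big_morph (fun a => be ^ a) (id1 := 1) (op1 := *%R)); last 2 first.
- by move=> x y; rewrite expfzDr.
- by rewrite expr0z.
rewrite -!big_split /=; apply: eq_bigr => i _.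
rewrite /weight exprMn !exprnP exprz_exp.
set x : int := (part mu i)%:Z; set t : int := s - i.+1%:Z.
have -> : (bead n mu i)%:Z - n%:Z + s = x + t.
  by rewrite /bead /x /t; have := ltn_ord i; lia.
rewrite expfzDr // (_ : (x + t) * (x + t + 1) =
   t * (t + 1) + (2 * s * x + x * (x - 2 * i.+1%:Z + 1))); last first.
  by rewrite /t; lia.
by rewrite !expfzDr //; ring.
Qed.

End Weights.

Arguments hsym : simpl never.

Section CompleteSymmetric.

Variable K : fieldType.
Hypothesis char0 : forall n : nat, n.+1%:R != 0 :> K.
Implicit Types (p : nat -> K) (x c : K).

Lemma hsym_neg p (n : int) : n < 0 -> hsym p n = 0.
Proof. by case: n. Qed.

Lemma hsym0 p : hsym p 0 = 1.
Proof. by []. Qed.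

Lemma hsymS p (n : nat) :
  n.+1%:R * hsym p n.+1 = \sum_(k < n.+1) p k.+1 * hsym p (n%:Z - k%:Z).
Proof.
rewrite /hsym /= /cvrec /hsym_step.
case Es: (cvrec_prefix _ n.+1) => [|y s].
  by move/(congr1 size): Es; rewrite size_cvrec_prefix.
rewrite -Es size_cvrec_prefix mulrA mulfV // mul1r; apply: eq_bigr => k _.
rewrite nth_cvrec_prefix; last by lia.
by rewrite subSS subzn // -ltnS.
Qed.

(** Newton's recursion can be solved because [n.+1] is invertible; identities between complete
    symmetric functions are proved by checking the recursion. *)
Lemma hsym_uniq p (c : nat -> K) : c 0%N = 1 ->
  (forall n, n.+1%:R * c n.+1 = \sum_(k < n.+1) p k.+1 * c (n - k)%N) ->
  forall n : nat, hsym p n = c n.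
Proof.
move=> c0 cS; elim/ltn_ind => -[|n] IH; first by rewrite c0.
apply: (mulfI (char0 n)); rewrite hsymS cS; apply: eq_bigr => k _.
by rewrite subzn -1?ltnS // IH // ltnS leq_subr.
Qed.

Lemma eq_hsym p p' : (forall k, p k.+1 = p' k.+1) -> hsym p =1 hsym p'.
Proof.
move=> E [n|//]; apply: hsym_uniq => // k.
by rewrite hsymS; apply: eq_bigr => i _; rewrite E subzn // -ltnS.
Qed.

Lemma hsym_scale p p' c : (forall k, p' k.+1 = c ^+ k.+1 * p k.+1) ->
  forall n : nat, hsym p' n = c ^+ n * hsym p n.
Proof.
move=> E; apply: hsym_uniq => [|n]; first by rewrite mul1r.
rewrite mulrCA hsymS mulr_sumr; apply: eq_bigr => k _.
rewrite E subzn -1?ltnS // mulrACA -exprD; congr (_ ^+ _ * _); have := ltn_ord k; lia.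
Qed.

(* Adjoining a variable [x] divides the generating series by [1 - x z]. *)
Lemma hsym_addvar p p' x : (forall k, p' k.+1 = p k.+1 + x ^+ k.+1) ->
  forall n, hsym p n = hsym p' n - x * hsym p' (n - 1).
Proof.
move=> E [n|n]; last by rewrite hsym_neg // hsym_neg ?mulr0 ?subr0 //; lia.
apply: (@hsym_uniq p (fun n : nat => hsym p' n - x * hsym p' (n%:Z - 1))) => {n}[|n].
  by rewrite sub0r mulr0 subr0.
(* [S] and [T] are the parts of Newton's sum for [p'] that come from [p] and from [x]. As the power
   sums of [x] are geometric, [T] obeys a first-order recursion. *)
pose S (n : nat) := \sum_(k < n) p k.+1 * hsym p' (n%:Z - 1 - k%:Z).
pose T (n : nat) := \sum_(k < n) x ^+ k.+1 * hsym p' (n%:Z - 1 - k%:Z).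
have thE (m : nat) : m%:R * hsym p' m = S m + T m.
  case: m => [|m]; first by rewrite /S /T !big_ord0 mul0r addr0.
  rewrite hsymS -big_split; apply: eq_bigr => k _ /=.
  by rewrite E mulrDl -[m.+1%:Z - 1]/((m.+1 - 1)%:Z) subn1.
have TS m : T m.+1 = x * (hsym p' m + T m).
  rewrite /T big_ord_recl mulrDr subr0 -[m.+1%:Z - 1]/((m.+1 - 1)%:Z) subn1 /=.
  congr (_ + _); rewrite mulr_sumr; apply: eq_bigr => k _.
  by rewrite mulrA -exprS; congr (_ * hsym _ _); rewrite /= /bump; lia.
have -> : \sum_(k < n.+1) p k.+1 * (hsym p' (n - k)%N - x * hsym p' ((n - k)%N%:Z - 1))
    = S n.+1 - x * S n.
  rewrite /S mulr_sumr !big_ord_recr /= subnn mulr0 subr0 addrAC -sumrB.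
  congr (_ + _); last by rewrite (_ : n.+1%:Z - 1 - n%:Z = 0) //; lia.
  apply: eq_bigr => k _; rewrite mulrBr mulrCA.
  by congr (_ * hsym _ _ - _ * (_ * hsym _ _)); have := ltn_ord k; lia.
have pred_n : n.+1%:Z - 1 = n%:Z by lia.
rewrite mulrBr thE pred_n mulrCA mulrSr mulrDl mul1r thE TS.
by ring.
Qed.

(** Multiplication by the geometric series 1 / (1 - x z). Any bound [m >= b] will do, since [hsym]
    vanishes at negative degrees; this gives all the entries of a matrix the same range. *)
Lemma hsym_addvar_sum p p' x : (forall k, p' k.+1 = p k.+1 + x ^+ k.+1) ->
  forall (b m : nat), (b <= m)%N ->
  hsym p' b = \sum_(t < m.+1) hsym p (b%:Z - t%:Z) * x ^+ t.
Proof.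
move=> E b m; elim: b m => [|b IH] m le_m.
  rewrite big_ord_recl subrr mul1r big1 ?addr0 // => i _.
  by rewrite hsym_neg ?mul0r //= /bump; lia.
case: m le_m => // m le_m; rewrite big_ord_recl mulr1 subr0.
rewrite (hsym_addvar E) (_ : b.+1%:Z - 1 = b%:Z); last by lia.
have -> : \sum_(i < m.+1) hsym p (b.+1%:Z - (lift ord0 i)%:Z) * x ^+ lift ord0 i
    = x * \sum_(t < m.+1) hsym p (b%:Z - t%:Z) * x ^+ t.
  rewrite mulr_sumr; apply: eq_bigr => i _; rewrite lift0 exprS mulrCA.
  by congr (_ * (hsym _ _ * _)); lia.
by rewrite -IH // addrNK.
Qed.

Definition lin_prod (L : seq K) : {poly K} := \prod_(y <- L) (1 - y *: 'X).

Lemma size_lin_prod L : (size (lin_prod L) <= (size L).+1)%N.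
Proof.
rewrite /lin_prod; elim: L => [|y L IH]; first by rewrite big_nil size_poly1.
rewrite big_cons /=; apply: leq_trans (size_polyMleq _ _) _.
have : (size (1 - y *: 'X : {poly K})%R <= 2)%N.
  apply: leq_trans (size_polyD _ _) _; rewrite geq_max size_poly1 /= size_polyN.
  by apply: leq_trans (size_scale_leq _ _) _; rewrite size_polyX.
by move=> le2; have := leq_add le2 IH; case: (_ + _)%N.
Qed.

(** Iterating [hsym_addvar], multiplication of the generating series by the product of the 1 - y z
    removes the variables of [L]; [N] only has to exceed the degree of that product. *)
Lemma hsym_lin_prod p p' L N : (size L < N)%N ->
  (forall k, p' k.+1 = p k.+1 + \sum_(y <- L) y ^+ k.+1) ->
  forall b, \sum_(r < N) hsym p' (b - r%:Z) * (lin_prod L)`_r = hsym p b.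
Proof.
elim: L p' N => [|y L IH] p' N.
  case: N => // N _ E b; rewrite /lin_prod big_nil big_ord_recl coef1 mulr1 subr0.
  rewrite big1 ?addr0; last by move=> i _; rewrite coef1 mulr0.
  by apply: eq_hsym => k; rewrite E big_nil addr0.
case: N => // N lt_N E b.
pose p1 k := p k + \sum_(y <- L) y ^+ k.
have E1 k : p' k.+1 = p1 k.+1 + y ^+ k.+1 by rewrite E big_cons /p1; ring.
rewrite -(IH p1 N) //.
have -> : lin_prod (y :: L) = lin_prod L - y *: ('X * lin_prod L).
  by rewrite /lin_prod big_cons mulrBl mul1r scalerAl.
under eq_bigr => r _ do rewrite coefB coefZ coefXM mulrBr.
rewrite sumrB [X in X - _ = _]big_ord_recr [X in _ - X = _]big_ord_recl /=.
rewrite !mulr0 add0r.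
rewrite nth_default ?mulr0 ?addr0; last first.
  by apply: leq_trans (size_lin_prod L) _.
rewrite -sumrB; apply: eq_bigr => r _; rewrite (hsym_addvar E1) /bump /=.
rewrite mulrBl mulrCA mulrA; congr (_ - _ * hsym _ _ * _); lia.
Qed.

End CompleteSymmetric.

(** From row [m] on, the matrix is triangular with diagonal [c], so expanding along the last row
    peels these rows off. It serves to pad Jacobi-Trudi determinants and to strip unit rows. *)
Lemma det_stable (R : comNzRingType) (f : nat -> nat -> R) c m n : (m <= n)%N ->
  (forall k, (m <= k)%N -> (k < n)%N -> f k k = c) ->
  (forall k j, (m <= k)%N -> (k < n)%N -> (j < k)%N -> f k j = 0) ->
  \det (\matrix_(i < n, j < n) f i j)
  = c ^+ (n - m) * \det (\matrix_(i < m, j < m) f i j).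
Proof.
move=> le_mn; elim: n le_mn => [|n IH] le_mn f1 f0.
  by move: le_mn; rewrite leqn0 => /eqP->; rewrite mul1r.
move: le_mn; rewrite leq_eqVlt => /orP[/eqP Em|]; first by rewrite Em subnn mul1r.
rewrite ltnS => le_mn; rewrite subSn // exprS -mulrA -IH //; last first.
- by move=> k j le_k lt_k; apply: f0 => //; apply: ltnW.
- by move=> k le_k lt_k; apply: f1 => //; apply: ltnW.
rewrite (expand_det_row _ ord_max) (bigD1 ord_max) //= big1 ?addr0.
  rewrite !mxE f1 // /cofactor /= addnn -signr_odd odd_double mul1r; congr (_ * _).
  by congr (\det _); apply/matrixP => i j; rewrite !mxE !lift_max.
move=> j ne_j; rewrite !mxE f0 ?mul0r // ltn_neqAle -ltnS ltn_ord andbT.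
exact: ne_j.
Qed.

(** * Skew Schur functions: sums over eta, ratios of alternants *)

Section SkewSchur.

Variable K : fieldType.
Implicit Types (p : nat -> K) (la mu eta : intpart).

Lemma skew_schurE p n la eta : (size la <= n)%N -> (size eta <= n)%N ->
  skew_schur p la eta = \det (\matrix_(i < n, j < n)
    hsym p ((part la i)%:Z - (part eta j)%:Z - i%:Z + j%:Z)).
Proof.
move=> le1 le2; rewrite /skew_schur; symmetry.
rewrite (@det_stable _ (fun i j => hsym p ((part la i)%:Z - (part eta j)%:Z - i%:Z + j%:Z))
  1 (maxn (size la) (size eta))) ?expr1n ?mul1r ?geq_max ?le1 //.
- move=> k; rewrite geq_max => /andP[le_k1 le_k2] _; rewrite !part0 //.
  by rewrite subrr sub0r addNr.
move=> k j; rewrite geq_max => /andP[le_k1 le_k2] _ lt_j; rewrite part0 // hsym_neg //; lia.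
Qed.

(** If [eta] is too long, the last row of the determinant vanishes; if it is too wide, the first
    column does. These two cases confine the sums over [eta] to a box. *)
Lemma skew_schur_eq0 p la eta :
  ~~ ((size eta <= size la)%N && (part eta 0 <= part la 0)%N) ->
  skew_schur p la eta = 0.
Proof.
rewrite negb_and -!ltnNge => out.
have lt0 : (0 < size eta)%N.
  by case/orP: out => [|lt_p]; last rewrite -part_gt0; lia.
case/orP: out => [lt_s|lt_p].
  rewrite (@skew_schurE _ (size eta)) ?(ltnW lt_s) //.
  have lt_e : ((size eta).-1 < size eta)%N by rewrite prednK.
  rewrite (expand_det_row _ (Ordinal lt_e)) big1 // => j _; rewrite !mxE /=.
  rewrite hsym_neg ?mul0r // part0; last by lia.
  have := part_gt0 eta (size eta).-1; rewrite lt_e => pos.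
  have := @part_noninc eta j (size eta).-1; have := ltn_ord j; lia.
have lt_m : (0 < maxn (size la) (size eta))%N by rewrite leq_max lt0 orbT.
rewrite /skew_schur; set M := (X in \det X).
rewrite (expand_det_col M (Ordinal lt_m)) big1 // => i _.
rewrite !mxE /= hsym_neg ?mul0r //.
by have := part_noninc la (leq0n i); lia.
Qed.

Lemma skew_schur_empty p eta : skew_schur p empty_part eta = (eta == empty_part)%:R.
Proof.
case: eqP => [->|ne]; first by rewrite /skew_schur det_mx00.
apply: skew_schur_eq0; rewrite leqn0 size_eq0 negb_and; apply/orP; left.
by apply/eqP => E; apply: ne; apply: val_inj.
Qed.

(** Cauchy-Binet, with the beads of [eta] as the values of [t]. Stopping at the bead of [mu] loses
    nothing, since [hsym] vanishes beyond, and makes each entry a function of its two beads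
    alone. *)
Lemma sum_skew_schur p p' n la mu : (size la <= n)%N -> (size mu <= n)%N ->
  \sum_(eta \in [set: intpart]%classic) skew_schur p la eta * skew_schur p' mu eta
  = \det (\matrix_(i < n, j < n) \sum_(t < (bead n mu j).+1)
      hsym p ((bead n la i)%:Z - t%:Z) * hsym p' ((bead n mu j)%:Z - t%:Z)).
Proof.
move=> le_la le_mu; pose m := maxn (part la 0) (part mu 0).
have bx_mu : in_box n m mu by rewrite /in_box le_mu leq_maxr.
have -> : \det (\matrix_(i < n, j < n) \sum_(t < (bead n mu j).+1)
      hsym p ((bead n la i)%:Z - t%:Z) * hsym p' ((bead n mu j)%:Z - t%:Z))
  = \det (\matrix_(i < n, j < n) \sum_(t < n + m)
      hsym p ((bead n la i)%:Z - t%:Z) * hsym p' ((bead n mu j)%:Z - t%:Z)).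
  congr (\det _); apply/matrixP => i j; rewrite !mxE.
  rewrite (big_ord_widen (n + m) (fun t =>
    hsym p ((bead n la i)%:Z - t%:Z) * hsym p' ((bead n mu j)%:Z - t%:Z))).
    rewrite big_mkcond; apply: eq_bigr => t _; case: ltnP => // lt_t.
    by rewrite (@hsym_neg _ p') ?mulr0 //; lia.
  exact: (bead_lt bx_mu).
rewrite (cauchy_binet_part n (n + m) (fun i t => hsym p ((bead n la i)%:Z - t%:Z))
  (fun t j => hsym p' ((bead n mu j)%:Z - t%:Z))).
rewrite (fsum_seq (boxparts_uniq n (n + m))) => [|eta].
  apply: eq_big_seq => eta; rewrite mem_boxparts ?leq_addr // => /andP[le_eta _].
  rewrite !(@skew_schurE _ n) //; congr (_ * _).
    congr (\det _); apply/matrixP => i j; rewrite !mxE; congr hsym.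
    by rewrite /bead; have := ltn_ord i; have := ltn_ord j; lia.
  rewrite -[LHS]det_tr; congr (\det _); apply/matrixP => i j; rewrite !mxE; congr hsym.
  by rewrite /bead; have := ltn_ord i; have := ltn_ord j; lia.
rewrite mem_boxparts ?leq_addr // addKn => out.
rewrite skew_schur_eq0 ?mul0r //; apply: contraNN out => /andP[le1 le2].
by rewrite /in_box (leq_trans le1) // leq_max le2.
Qed.

Hypothesis char0 : forall n : nat, n.+1%:R != 0 :> K.

(* Jacobi-Trudi turned into a ratio of alternants.  Multiplying the
   Jacobi-Trudi matrix by the coefficients of the products of all the
   [1 - x_l z] but one removes all but one of the variables [x_l]; the
   determinant of that multiplier is found by taking [la] empty. *)
Lemma schur_alternant p tau (x : nat -> K) n la : (size la <= n)%N ->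
  (forall k, p k.+1 = tau k.+1 + \sum_(i < n) x i ^+ k.+1) ->
  schur p la * \det (\matrix_(i < n, k < n) x k ^+ (n - i.+1))
  = \det (\matrix_(i < n, k < n) \sum_(t < (bead n la i).+1)
      hsym tau ((bead n la i)%:Z - t%:Z) * x k ^+ t).
Proof.
move=> le_la pE.
pose L (k : 'I_n) := [seq x (val l) | l <- enum 'I_n & l != k].
pose p1 (k : 'I_n) r := tau r + x k ^+ r.
have pL k r : p r.+1 = p1 k r.+1 + \sum_(y <- L k) y ^+ r.+1.
  rewrite pE (bigD1 k) //= /p1 -addrA; congr (_ + (_ + _)).
  by rewrite big_map big_filter big_enum_cond.
have szL k : (size (L k) < n)%N.
  rewrite size_map size_filter -[X in (_ < X)%N]card_ord cardE.
  by rewrite -(count_predC (pred1 k) (enum 'I_n)) -[X in (_ < X + _)%N]/(count_mem k (enum 'I_n))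
    count_uniq_mem ?enum_uniq // mem_enum add1n.
pose E := \matrix_(j < n, k < n) (lin_prod (L k))`_(n - j.+1).
pose Rm (mu : intpart) := \matrix_(i < n, k < n) hsym (p1 k) (bead n mu i).
have detE mu : (size mu <= n)%N -> schur p mu * \det E = \det (Rm mu).
  move=> le_mu; rewrite /schur (skew_schurE _ le_mu) // -det_mulmx; congr (\det _).
  apply/matrixP => i k; rewrite !mxE -(hsym_lin_prod char0 (szL k) (pL k)).
  rewrite [RHS](reindex_inj rev_ord_inj) /=; apply: eq_bigr => j _; rewrite !mxE.
  rewrite part_empty; congr (hsym _ _ * _).
  by rewrite /bead; have := ltn_ord i; have := ltn_ord j; lia.
have RmE mu (i k : 'I_n) m : (bead n mu i <= m)%N -> Rm mu i k
    = \sum_(t < m.+1) hsym tau ((bead n mu i)%:Z - t%:Z) * x k ^+ t.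
  by move=> le_m; rewrite mxE; apply: (hsym_addvar_sum char0).
have -> : \det (\matrix_(i < n, k < n) x k ^+ (n - i.+1)) = \det E.
  have -> : \det E = \det (Rm empty_part).
    by rewrite -detE // /schur skew_schur_empty eqxx mul1r.
  (* For the empty partition the reduced matrix is the unitriangular [U] times the alternant. *)
  pose U := \matrix_(i < n, j < n) hsym tau (j%:Z - i%:Z).
  have -> : Rm empty_part = U *m \matrix_(i < n, k < n) x k ^+ (n - i.+1).
    apply/matrixP => i k; have lt_i := ltn_ord i.
    rewrite (@RmE _ _ _ n.-1) ?bead_empty; last by lia.
    rewrite prednK ?(leq_ltn_trans _ lt_i) // [RHS]mxE.
    rewrite [RHS](reindex_inj rev_ord_inj) /=; apply: eq_bigr => t _.
    rewrite !mxE /=; have lt_t := ltn_ord t.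
    by congr (hsym _ _ * _ ^+ _); lia.
  rewrite det_mulmx -[\det U]det_tr det_trig.
    by rewrite big1 ?mul1r // => i _; rewrite !mxE subrr.
  by apply/is_trig_mxP => i j lt_ij; rewrite !mxE hsym_neg //; lia.
by rewrite detE //; congr (\det _); apply/matrixP => i k; rewrite (RmE _ _ _ _ (leqnn _)) mxE.
Qed.

End SkewSchur.

Lemma det_rev (R : comNzRingType) n (f : nat -> nat -> R) :
  \det (\matrix_(i < n, j < n) f (n - i.+1)%N (n - j.+1)%N)
  = \det (\matrix_(i < n, j < n) f i j).
Proof.
pose s : 'S_n := perm (@rev_ord_inj n).
have -> : \matrix_(i < n, j < n) f (n - i.+1)%N (n - j.+1)%N
    = row_perm s (col_perm s (\matrix_(i < n, j < n) f i j)).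
  by apply/matrixP => i j; rewrite !mxE !permE.
rewrite row_permE col_permE !det_mulmx mulrCA -det_mulmx -perm_mxM.
by rewrite fingroup.mulgV perm_mx1 det1 mulr1.
Qed.

Lemma det_alternant (R : comNzRingType) n (y : nat -> R) :
  \det (\matrix_(i < n, j < n) y i ^+ (n - j.+1))
  = \prod_(i < n) \prod_(j < n | (i < j)%N) (y i - y j).
Proof.
pose a := \row_(j < n) y (n - j.+1)%N.
have -> : \det (\matrix_(i < n, j < n) y i ^+ (n - j.+1)) = \det (Vandermonde n a).
  transitivity (\det (\matrix_(i < n, j < n) y (n - i.+1)%N ^+ j)).
    rewrite -(det_rev n (fun i j => y (n - i.+1)%N ^+ j)).
    congr (\det _); apply/matrixP => i j; rewrite !mxE; congr (y _ ^+ _).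
    by have := ltn_ord i; lia.
  by rewrite -[RHS]det_tr; congr (\det _); apply/matrixP => i j; rewrite !mxE.
rewrite det_Vandermonde (reindex_inj rev_ord_inj) /=.
under eq_bigr => i _ do rewrite (reindex_inj rev_ord_inj) /=.
rewrite (exchange_big_dep xpredT) //=; apply: eq_bigr => i _.
apply: eq_big => [j|j _]; have := ltn_ord i; have := ltn_ord j; first by lia.
by move=> lt_j lt_i; rewrite !mxE /=; congr (y _ - y _); lia.
Qed.

(** * The specializations q^(mu+rho) and q^(-rho) *)

Section PrincipalSpecialization.

Variables (K : fieldType) (h : K).
Hypothesis char0 : forall n : nat, n.+1%:R != 0 :> K.
Hypothesis h0 : h != 0.
Hypothesis h1 : forall k : nat, 1 - h ^+ k.+1 != 0.
Implicit Types la mu : intpart.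

Lemma schur_scale (p p' : nat -> K) c la : c != 0 -> (forall k, p' k.+1 = c ^+ k.+1 * p k.+1) ->
  schur p' la = c ^+ psize la * schur p la.
Proof.
move=> c0 E; rewrite /schur !(@skew_schurE _ _ (size la)) // (psizeE (leqnn _)).
pose f (i : nat) := c ^ ((part la i)%:Z - i%:Z); pose g (j : nat) := c ^+ j.
transitivity (\prod_(i < size la) f i * \det (\matrix_(i < size la, j < size la)
    hsym p ((part la i)%:Z - (part empty_part j)%:Z - i%:Z + j%:Z))
  * \prod_(j < size la) g j).
  rewrite -(det_scale f g (fun i j => hsym p ((part la i)%:Z - (part empty_part j)%:Z - i%:Z + j%:Z)) id id).
  congr (\det _); apply/matrixP => i j; rewrite !mxE part_empty subr0.
  set x := part la i; case E1 : (x%:Z - i%:Z + j%:Z) => [k|k]; last first.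
    by rewrite !hsym_neg ?mulr0 ?mul0r.
  rewrite (hsym_scale char0 E) mulrAC; congr (_ * _).
  by rewrite /f /g !exprnP -expfzDr // E1.
rewrite mulrAC; congr (_ * _); rewrite expr_sum -big_split /=.
by apply: eq_bigr => i _; rewrite /f /g !exprnP -expfzDr // subrK.
Qed.

(** The power sums of q^-1, q^-2, ...: these are the variables of q^(mu+rho) beyond the n-th, for
    [n >= size mu], after division by q^(1/2 - n). The same division turns the first n variables
    into powers q^bead. *)
Definition tail_psum (k : nat) : K := h ^ (- (2 * k)%:Z) / (1 - h ^ (- (2 * k)%:Z)).

Lemma tail_denom k : 1 - h ^ (- (2 * k.+1)%:Z) != 0.
Proof.
have -> : h ^ (- (2 * k.+1)%:Z) = (h ^+ (2 * k).+2)^-1 by rewrite mulnS exprnN.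
rewrite subr_eq0 eq_sym invr_eq1 eq_sym -subr_eq0; exact: h1.
Qed.

Lemma psum_rhoE n mu k : (size mu <= n)%N ->
  psum_rho h mu k.+1 = (h ^ (1 - 2 * n%:Z)) ^+ k.+1
    * (tail_psum k.+1 + \sum_(i < n) (h ^+ (2 * bead n mu i)) ^+ k.+1).
Proof.
move=> le_n; have d0 := tail_denom k.
(* [F m] separates [m] variables from the geometric tail; beyond the length of [mu], increasing [m]
   just takes the first term off the tail. *)
pose F m := \sum_(i < m) h ^ (k.+1%:Z * (2 * ((part mu i)%:Z - i%:Z) - 1))
  + h ^ (- (k.+1 * (2 * m + 1))%:Z) / (1 - h ^ (- (2 * k.+1)%:Z)).
have -> : psum_rho h mu k.+1 = F n.
  rewrite -[LHS]/(F (size mu)); elim: n le_n => [|n IH].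
    by rewrite leqn0 => /eqP ->.
  rewrite leq_eqVlt => /orP[/eqP->//|]; rewrite ltnS => le_n; rewrite IH //.
  rewrite /F big_ord_recr /= part0 // -addrA; congr (_ + _).
  apply: (mulIf d0); rewrite mulrDl !mulfVK // mulrBr mulr1 -expfzDr //.
  rewrite (_ : k.+1%:Z * (2 * (0 - n%:Z) - 1) = - (k.+1 * (2 * n + 1))%:Z); last by lia.
  rewrite -[LHS]addr0 -addrA; congr (_ + _); apply/esym/eqP; rewrite addrC subr_eq0.
  by apply/eqP; congr (h ^ _); lia.
rewrite /F mulrDr addrC; congr (_ + _).
  rewrite /tail_psum mulrA; congr (_ / _); rewrite exprnP exprz_exp -expfzDr //.
  by congr (h ^ _); lia.
rewrite mulr_sumr; apply: eq_bigr => i _.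
have bE : (bead n mu i)%:Z = (part mu i)%:Z - i%:Z + n%:Z - 1.
  by rewrite /bead; have := ltn_ord i; lia.
rewrite -exprM !exprnP exprz_exp -expfzDr //; congr (h ^ _).
by rewrite !PoszM bE; ring.
Qed.

(** The alternant is left undivided on the left, because it is the one that [schur_mrho] supplies as
    a factor. *)
Lemma schur_rho n mu la : (size mu <= n)%N -> (size la <= n)%N ->
  schur (psum_rho h mu) la
    * \det (\matrix_(i < n, k < n) (h ^+ (2 * bead n mu k)) ^+ (n - i.+1))
  = (h ^ (1 - 2 * n%:Z)) ^+ psize la
    * \det (\matrix_(i < n, k < n) \sum_(t < (bead n la i).+1)
        hsym tail_psum ((bead n la i)%:Z - t%:Z) * (h ^+ (2 * bead n mu k)) ^+ t).
Proof.
move=> le_mu le_la.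
pose p k := tail_psum k + \sum_(i < n) (h ^+ (2 * bead n mu i)) ^+ k.
rewrite (@schur_scale p _ (h ^ (1 - 2 * n%:Z))) ?expfz_neq0 //; last first.
  by move=> k; apply: psum_rhoE.
rewrite -mulrA; congr (_ * _).
by rewrite (@schur_alternant _ char0 p tail_psum (fun i => h ^+ (2 * bead n mu i))).
Qed.

Lemma psum_mrhoE k : psum_mrho h k.+1 = h ^+ k.+1 / (1 - h ^+ (2 * k.+1)).
Proof. by []. Qed.

(* The q-difference equation (1 - h z) H(z) = H(q z). *)
Lemma hsym_mrho_pred (m : nat) :
  h * hsym (psum_mrho h) (m%:Z - 1) = (1 - h ^+ (2 * m)) * hsym (psum_mrho h) m.
Proof.
pose p k := (h ^+ 2) ^+ k * psum_mrho h k.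
have E k : psum_mrho h k.+1 = p k.+1 + h ^+ k.+1.
  rewrite /p -exprM psum_mrhoE; have d0 : 1 - h ^+ (2 * k.+1) != 0 by rewrite mulnS; apply: h1.
  by field.
have := hsym_addvar char0 E m; rewrite (@hsym_scale _ char0 (psum_mrho h) p (h ^+ 2)) //.
by rewrite -exprM => E1; rewrite mulrBl mul1r E1; ring.
Qed.

(** The ratio h_(b-r) / h_b at q^(-rho) is the product over s < r of (1 - q^(b-s)) / q^(1/2), a
    polynomial in q^b. It has a zero at q^b for b < r, where h_(b-r) vanishes. *)
Definition qpoly (r : nat) : {poly K} :=
  \prod_(s < r) (h^-1)%:P * \prod_(s < r) (1 - (h ^- (2 * s)) *: 'X).

Lemma hsym_mrho_sub (b r : nat) :
  hsym (psum_mrho h) (b%:Z - r%:Z) = hsym (psum_mrho h) b * (qpoly r).[h ^+ (2 * b)].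
Proof.
elim: r => [|r IH]; first by rewrite /qpoly !big_ord0 mulr1 hornerC mulr1; congr hsym; lia.
have -> : (qpoly r.+1).[h ^+ (2 * b)]
    = (qpoly r).[h ^+ (2 * b)] * (h^-1 * (1 - h ^- (2 * r) * h ^+ (2 * b))).
  by rewrite /qpoly !big_ord_recr /= !hornerM !hornerE /=; ring.
rewrite mulrA -IH; case: (leqP r b) => [le_rb|lt_br]; last first.
  by rewrite !hsym_neg ?mul0r //; lia.
have := hsym_mrho_pred (b - r); rewrite -subzn // (_ : b%:Z - r.+1%:Z = b%:Z - r%:Z - 1); last by lia.
move=> E; apply: (mulfI h0); rewrite E subzn //.
have -> : h ^+ (2 * b) = h ^+ (2 * r) * h ^+ (2 * (b - r)) by rewrite -exprD; congr (_ ^+ _); lia.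
by rewrite mulKf ?expf_neq0 //; field.
Qed.

End PrincipalSpecialization.

Section PrincipalSchur.

Variables (K : fieldType) (h : K).
Hypothesis char0 : forall n : nat, n.+1%:R != 0 :> K.
Hypothesis h0 : h != 0.
Hypothesis h1 : forall k : nat, 1 - h ^+ k.+1 != 0.
Implicit Types la mu : intpart.

Definition qlead (r : nat) : K := \prod_(s < r) - h ^- (2 * s).+1.

Lemma qpolyS r : qpoly h r.+1 = qpoly h r * (h^-1 *: (1 - (h ^- (2 * r)) *: 'X)).
Proof.
by rewrite /qpoly !big_ord_recr /= mulrACA mul_polyC.
Qed.

Lemma size_qpoly r : (size (qpoly h r) <= r.+1)%N.
Proof.
elim: r => [|r IH]; first by rewrite /qpoly !big_ord0 mulr1 size_poly1.
rewrite qpolyS; apply: leq_trans (size_polyMleq _ _) _.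
have : (size (h^-1 *: (1 - (h ^- (2 * r)) *: 'X) : {poly K})%R <= 2)%N.
  apply: leq_trans (size_scale_leq _ _) _.
  apply: leq_trans (size_polyD _ _) _; rewrite geq_max size_poly1 /= size_polyN.
  by apply: leq_trans (size_scale_leq _ _) _; rewrite size_polyX.
by move=> le2; have := leq_add IH le2; case: (_ + _)%N => // k; rewrite addn2.
Qed.

Lemma coef_qpoly_gt r k : (r < k)%N -> (qpoly h r)`_k = 0.
Proof. by move=> lt_rk; rewrite nth_default // (leq_trans (size_qpoly r)). Qed.

Lemma coef_qpoly r : (qpoly h r)`_r = qlead r.
Proof.
elim: r => [|r IH]; first by rewrite /qpoly /qlead !big_ord0 mulr1 coef1.
rewrite qpolyS -scalerAr coefZ mulrBr mulr1 coefB coef_qpoly_gt // sub0r.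
rewrite -scalerAr coefZ coefMX /= IH /qlead [in RHS]big_ord_recr /= exprS invfM.
by rewrite !mulrN mulrCA [in RHS]mulrC -mulrA; congr (- _); rewrite mulrCA mulrA.
Qed.

(** The coefficient of degree r in [qpoly h r] is [qlead r], so the passage from monomials to these
    polynomials is triangular. *)
Lemma det_qpoly n (y : nat -> K) :
  \det (\matrix_(i < n, j < n) (qpoly h (n - j.+1)).[y i])
  = \det (\matrix_(i < n, j < n) y i ^+ (n - j.+1)) * \prod_(r < n) qlead r.
Proof.
pose B := \matrix_(k < n, j < n) (qpoly h (n - j.+1))`_(n - k.+1).
have -> : \prod_(r < n) qlead r = \det B.
  rewrite det_trig; last first.
    apply/is_trig_mxP => i j lt_ij; rewrite mxE coef_qpoly_gt //.
    by have := ltn_ord j; lia.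
  rewrite (reindex_inj rev_ord_inj) /=; apply: eq_bigr => i _.
  by rewrite mxE coef_qpoly.
rewrite -det_mulmx; congr (\det _); apply/matrixP => i j; rewrite !mxE.
rewrite (@horner_coef_wide _ n); last first.
  by apply: leq_trans (size_qpoly _) _; have := ltn_ord j; lia.
rewrite (reindex_inj rev_ord_inj) /=; apply: eq_bigr => k _.
by rewrite !mxE mulrC.
Qed.

(** Taking h_bead out of each row of the Jacobi-Trudi matrix leaves the polynomials [qpoly] at
    q^bead, hence an alternant. *)
Lemma schur_mrho n mu : (size mu <= n)%N ->
  schur (psum_mrho h) mu
  = \prod_(i < n) hsym (psum_mrho h) (bead n mu i) * \prod_(r < n) qlead r
    * \det (\matrix_(i < n, j < n) (h ^+ (2 * bead n mu i)) ^+ (n - j.+1)).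
Proof.
move=> le_n; rewrite /schur (skew_schurE _ le_n) // -mulrA [X in _ * X]mulrC.
rewrite -(det_qpoly n (fun i => h ^+ (2 * bead n mu i))).
have := det_scale (fun b : nat => hsym (psum_mrho h) b) (fun=> 1)
  (fun i j : 'I_n => (qpoly h (n - j.+1)).[h ^+ (2 * bead n mu i)]) (bead n mu) id.
rewrite big1_eq mulr1 => <-; congr (\det _); apply/matrixP => i j; rewrite !mxE mulr1.
rewrite -hsym_mrho_sub // part_empty; congr hsym.
by rewrite /bead; have := ltn_ord i; have := ltn_ord j; lia.
Qed.

Definition vertex_mx (a b : nat) : K :=
  (-1) ^+ a * hsym (psum_mrho h) a * h ^- (b ^ 2)
  * \sum_(t < b.+1) hsym (tail_psum h) (b%:Z - t%:Z) * (h ^+ (2 * a)) ^+ t.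

Lemma qleadE r : qlead r = (-1) ^+ r * h ^- (r ^ 2).
Proof.
elim: r => [|r IH]; first by rewrite /qlead big_ord0 mul1r invr1.
rewrite /qlead big_ord_recr -/(qlead r) /= IH [in RHS]exprS.
rewrite (_ : (r.+1 ^ 2 = r ^ 2 + (2 * r).+1)%N); last by lia.
by rewrite exprD invfM mulN1r mulrN mulNr mulrA.
Qed.

(** The alternant of [schur_mrho] is the denominator of [schur_rho], so the product of the two Schur
    functions is one determinant, although the variables of the second depend on [mu]. *)
Lemma schur_mrho_rho n mu la : (size mu <= n)%N -> (size la <= n)%N ->
  schur (psum_mrho h) mu * schur (psum_rho h mu) la
  = (-1) ^+ psize mu * h ^ kappa la
    * \det (\matrix_(i < n, j < n) vertex_mx (bead n mu i) (bead n la j)).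
Proof.
move=> le_mu le_la; rewrite (schur_mrho le_mu) -[\det _]det_tr -[LHS]mulrA.
rewrite [\det _ * _]mulrC.
have -> : (\matrix_(i < n, j < n) (h ^+ (2 * bead n mu i)) ^+ (n - j.+1))^T
  = \matrix_(i < n, k < n) (h ^+ (2 * bead n mu k)) ^+ (n - i.+1).
  by apply/matrixP => i j; rewrite !mxE.
rewrite schur_rho //.
have -> : \det (\matrix_(i < n, j < n) vertex_mx (bead n mu i) (bead n la j))
  = \prod_(i < n) ((-1) ^+ bead n mu i * hsym (psum_mrho h) (bead n mu i))
    * \det (\matrix_(i < n, k < n) \sum_(t < (bead n la i).+1)
        hsym (tail_psum h) ((bead n la i)%:Z - t%:Z) * (h ^+ (2 * bead n mu k)) ^+ t)
    * \prod_(j < n) h ^- (bead n la j ^ 2).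
  rewrite -[X in _ * X * _]det_tr.
  have := det_scale (fun a : nat => (-1) ^+ a * hsym (psum_mrho h) a)
    (fun b : nat => h ^- (b ^ 2))
    (fun i j : 'I_n => \sum_(t < (bead n la j).+1)
        hsym (tail_psum h) ((bead n la j)%:Z - t%:Z) * (h ^+ (2 * bead n mu i)) ^+ t)
    (bead n mu) (bead n la).
  have -> : (\matrix_(i < n, k < n) \sum_(t < (bead n la i).+1)
        hsym (tail_psum h) ((bead n la i)%:Z - t%:Z) * (h ^+ (2 * bead n mu k)) ^+ t)^T
    = \matrix_(i < n, k < n) \sum_(t < (bead n la k).+1)
        hsym (tail_psum h) ((bead n la k)%:Z - t%:Z) * (h ^+ (2 * bead n mu i)) ^+ t.
    by apply/matrixP => i j; rewrite !mxE.
  move=> <-; congr (\det _); apply/matrixP => i j; rewrite !mxE /vertex_mx.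
  by rewrite -!mulrA; congr (_ * (_ * _)); rewrite mulrC.
rewrite big_split /=; set D := \det _; set H := \prod_(i < n) hsym _ _.
have -> : \prod_(i < n) (-1) ^+ bead n mu i = (-1) ^+ psize mu * \prod_(i < n) (-1) ^+ i :> K.
  rewrite (psizeE le_mu) expr_sum [X in _ * X](reindex_inj rev_ord_inj) /= -big_split /=.
  by apply: eq_bigr => i _; rewrite -exprD.
have -> : \prod_(r < n) qlead r = \prod_(r < n) (-1) ^+ r * \prod_(r < n) h ^- (r ^ 2).
  by rewrite -big_split; apply: eq_bigr => r _; rewrite qleadE.
(* Completing the square: the squares of the beads convert the power of [h] that depends on [n] into
   [kappa la], so that the entries of [vertex_mx] do not involve [n]. *)
suff E : (h ^ (1 - 2 * n%:Z)) ^+ psize la * \prod_(r < n) h ^- (r ^ 2)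
    = h ^ kappa la * \prod_(j < n) h ^- (bead n la j ^ 2).
  have s2 : (-1) ^+ psize mu * (-1) ^+ psize mu = 1 :> K.
    by rewrite -expr2 -exprM mulnC exprM sqrrN expr1n expr1n.
  transitivity (((-1) ^+ psize mu * (-1) ^+ psize mu) * H * \prod_(r < n) (-1) ^+ r * D
     * ((h ^ (1 - 2 * n%:Z)) ^+ psize la * \prod_(r < n) h ^- (r ^ 2))).
    by rewrite s2; ring.
  by rewrite E; ring.
rewrite (psizeE le_la) (kappaE le_la) expr_sum.
rewrite (big_morph (fun a => h ^ a) (id1 := 1) (op1 := *%R)); last 2 first.
- by move=> x y; rewrite expfzDr.
- by rewrite expr0z.
rewrite [X in _ * X = _](reindex_inj rev_ord_inj) /= -!big_split /=.
apply: eq_bigr => i _; rewrite !exprnN !exprnP !exprz_exp -!expfzDr //.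
congr (h ^ _).
have -> : bead n la i = (part la i + (n - i.+1))%N by [].
have lt_i := ltn_ord i; set x := part la i; set t := (n - i.+1)%N.
have -> : n%:Z = t%:Z + i.+1%:Z by rewrite /t; lia.
by rewrite -!mulnn !PoszM PoszD; ring.
Qed.

(* All the pairs of a bead and an empty place below it, one for each hook. *)
Definition hook_prod P (J : pred nat) : K :=
  \prod_(b < P) \prod_(c < P) if [&& (c < b)%N, J b & ~~ J c]
                              then 1 - h ^+ (2 * (b - c)) else 1.

Lemma hook_prod_neq0 P J : hook_prod P J != 0.
Proof.
apply/prodf_neq0 => b _; apply/prodf_neq0 => c _.
case: and3P => [[lt_cb _ _]|_]; last exact: oner_neq0.
by have -> : (2 * (b - c) = (2 * (b - c)).-1.+1)%N by lia.
Qed.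

(** Reversing the places and exchanging beads with empty places, as conjugation does, preserves each
    pair together with its distance. *)
Lemma hook_prod_rev P J :
  hook_prod P (fun b => ~~ J (P - b.+1)%N) = hook_prod P J.
Proof.
rewrite /hook_prod exchange_big (reindex_inj rev_ord_inj) /=.
apply: eq_bigr => b _; rewrite (reindex_inj rev_ord_inj) /=; apply: eq_bigr => c _.
have lt_b := ltn_ord b; have lt_c := ltn_ord c.
have rK (a : nat) : (a < P)%N -> (P - (P - a.+1).+1)%N = a by lia.
rewrite !rK // negbK.
rewrite (_ : (P - b.+1 < P - c.+1)%N = (c < b)%N); last by lia.
rewrite (_ : (P - c.+1 - (P - b.+1) = b - c)%N); last by lia.
by case: (c < b)%N; case: (J c); case: (J b).
Qed.

Lemma eq_hook_prod P J J' : (forall b, (b < P)%N -> J b = J' b) ->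
  hook_prod P J = hook_prod P J'.
Proof. by move=> E; apply: eq_bigr => b _; apply: eq_bigr => c _; rewrite !E. Qed.

Lemma hsym_mrho_prod b :
  hsym (psum_mrho h) (Posz b) * \prod_(c < b) (1 - h ^+ (2 * (b - c))) = h ^+ b.
Proof.
elim: b => [|b IH]; first by rewrite big_ord0 mulr1 hsym0.
rewrite big_ord_recl [in RHS]exprS -IH mulrCA !mulrA.
rewrite -hsym_mrho_pred // (_ : b.+1%:Z - 1 = b%:Z) //; lia.
Qed.

(** The hook formula s_mu(q^-rho) = q^(n(mu) + |mu|/2) / prod (1 - q^hook), where n(mu) is the sum
    of the (i - 1) mu_i, with the denominator cleared. *)
Lemma schur_mrho_hook n m mu : in_box n m mu ->
  schur (psum_mrho h) mu
    * hook_prod (n + m) (fun b => b \in [seq bead n mu i | i <- iota 0 n])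
  = \prod_(i < n) h ^+ ((2 * i).+1 * part mu i).
Proof.
move=> bx; have /andP[le_n _] := bx; rewrite (schur_mrho le_n).
rewrite (det_alternant n (fun i => h ^+ (2 * bead n mu i))).
set J := (fun b : nat => b \in _).
have -> : hook_prod (n + m) J
  = \prod_(i < n) \prod_(c < n + m) if (c < bead n mu i)%N && ~~ J c
      then 1 - h ^+ (2 * (bead n mu i - c)) else 1.
  pose G b := \prod_(c < n + m) if (c < b)%N && ~~ J c
      then 1 - h ^+ (2 * (b - c)) else 1.
  transitivity (\prod_(b < n + m | J b) G b).
    rewrite [RHS]big_mkcond; apply: eq_bigr => b _.
    case Jb: (J b); last by rewrite big1 // => c _; rewrite andbF.
    by apply: eq_bigr => c _; rewrite andTb.
  rewrite -(big_mkord J) /index_iota subn0 -big_filter.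
  have := beadsE bx; rewrite -/J => E.
  rewrite -[\prod_(i < n) _](big_mkord xpredT (fun i => G (bead n mu i))) /index_iota subn0.
  rewrite -(big_map (bead n mu) xpredT G) E; apply: perm_big.
  by rewrite perm_sym perm_rev.
pose B i := \prod_(j < n | (i < j)%N) (1 - h ^+ (2 * (bead n mu i - bead n mu j))).
pose C i := \prod_(c < n + m) if (c < bead n mu i)%N && ~~ J c
      then 1 - h ^+ (2 * (bead n mu i - c)) else 1.
(* The places below a bead are beads or empty. The former give [B], which also comes from the
   alternant, the latter the hooks in [C]; together they fill the denominator of h_bead. *)
have hE (i : 'I_n) : hsym (psum_mrho h) (bead n mu i) * (B i * C i) = h ^+ bead n mu i.
  rewrite -[RHS]hsym_mrho_prod; congr (_ * _).
  have lt_b : (bead n mu i < n + m)%N by apply: bead_lt.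
  rewrite (big_ord_widen _ (fun c => 1 - h ^+ (2 * (bead n mu i - c))) (ltnW lt_b)).
  rewrite (bigID (fun c : 'I_(n + m) => J c)) /=; congr (_ * _); last first.
    rewrite /C -big_mkcond /=; by apply: eq_bigl => c.
  pose F c := if (c < bead n mu i)%N then 1 - h ^+ (2 * (bead n mu i - c)) else 1.
  transitivity (\prod_(c < n + m | J c) F c); last first.
    rewrite big_mkcond [RHS]big_mkcond; apply: eq_bigr => c _.
    by rewrite /F; case: (J c); rewrite ?andbT ?andbF.
  rewrite -(big_mkord J F) /index_iota subn0 -big_filter.
  have := beadsE bx; rewrite -/J => E.
  rewrite (perm_big [seq bead n mu i | i <- iota 0 n]); last first.
    by rewrite E perm_sym perm_rev.
  rewrite big_map -{2}[n]subn0 -/(index_iota 0 n) big_mkord.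
  rewrite /B big_mkcond; apply: eq_bigr => j _; rewrite /F.
  case: (ltngtP i j) => [lt_ij|lt_ji|E']; last by rewrite E' ltnn.
    by rewrite bead_dec.
  by rewrite ltnNge (ltnW (bead_dec mu lt_ji (ltn_ord i))).
have -> : \prod_(i < n) \prod_(j < n | (i < j)%N)
    (h ^+ (2 * bead n mu i) - h ^+ (2 * bead n mu j))
  = \prod_(i < n) B i * \prod_(j < n) (- h ^+ (2 * bead n mu j)) ^+ j.
  have -> : \prod_(j < n) (- h ^+ (2 * bead n mu j)) ^+ j
    = \prod_(i < n) \prod_(j < n | (i < j)%N) - h ^+ (2 * bead n mu j).
    rewrite (exchange_big_dep xpredT) //=; apply: eq_bigr => j _.
    rewrite -(big_ord_widen n (fun=> - h ^+ (2 * bead n mu j))) ?(ltnW (ltn_ord j)) //.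
    by rewrite prodr_const card_ord.
  rewrite -big_split; apply: eq_bigr => i _; rewrite -big_split.
  apply: eq_bigr => j lt_ij /=; have lt_b := bead_dec mu lt_ij (ltn_ord j).
  have -> : h ^+ (2 * bead n mu i) = h ^+ (2 * (bead n mu i - bead n mu j)) * h ^+ (2 * bead n mu j).
    by rewrite -exprD; congr (_ ^+ _); lia.
  by ring.
transitivity (\prod_(i < n) (hsym (psum_mrho h) (bead n mu i) * (B i * C i))
   * \prod_(j < n) (qlead j * (- h ^+ (2 * bead n mu j)) ^+ j)).
  by rewrite !big_split /=; ring.
under eq_bigr => i _ do rewrite hE.
rewrite -big_split /=.
(* The balance of the powers of [h] for the empty partition: the squares come from [qlead], the
   other side from its beads n - 1 - j. *)
have sq : (\sum_(j < n) j ^ 2 = \sum_(j < n) (2 * j).+1 * (n - j.+1))%N.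
  elim: (n) => [|a IH]; first by rewrite !big_ord0.
  rewrite !big_ord_recr /= subnn muln0 addn0 IH.
  have -> : (\sum_(j < a) (2 * j).+1 * (a.+1 - j.+1)
     = \sum_(j < a) (2 * j).+1 * (a - j.+1) + \sum_(j < a) (2 * j).+1)%N.
    rewrite -big_split; apply: eq_bigr => j _ /=; have := ltn_ord j => lt_j.
    by rewrite -mulnSr; congr (_ * _)%N; lia.
  congr (_ + _)%N; elim: (a) => [|d IHd]; first by rewrite big_ord0.
  by rewrite big_ord_recr /= -IHd; lia.
transitivity (\prod_(j < n) h ^+ ((2 * j).+1 * bead n mu j) / \prod_(j < n) h ^+ (j ^ 2)).
  rewrite -prodfV -big_split; apply: eq_bigr => j _ /=; rewrite qleadE.
  rewrite (exprNn (h ^+ _)) -exprM.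
  have s2 : (-1) ^+ j * (-1) ^+ j = 1 :> K by rewrite -exprMn mulrNN mulr1 expr1n.
  transitivity (((-1) ^+ j * (-1) ^+ j) * (h ^+ bead n mu j * h ^+ (2 * bead n mu j * j))
     / h ^+ (j ^ 2)); first by ring.
  by rewrite s2 mul1r -exprD; congr (h ^+ _ / _); lia.
rewrite -!expr_sum sq; apply: (mulIf (expf_neq0 (\sum_(j < n) (2 * j).+1 * (n - j.+1)) h0)).
rewrite mulfVK ?expf_neq0 // -exprD; congr (h ^+ _).
by rewrite -big_split; apply: eq_bigr => j _ /=; rewrite /bead mulnDr.
Qed.

(** Conjugate partitions have the same hooks, so only the powers of [h] in the hook formula differ:
    2j + 1 replaces 2i + 1 at each box, and the total difference is kappa. *)
Lemma schur_mrho_conj mu :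
  schur (psum_mrho h) (conj_part mu) = h ^ kappa mu * schur (psum_mrho h) mu.
Proof.
pose n := size mu; pose m := part mu 0.
have bx : in_box n m mu by rewrite /in_box !leqnn.
have bx' : in_box m n (conj_part mu) by rewrite in_box_conj.
set J := fun b => b \in [seq bead n mu i | i <- iota 0 n].
apply: (mulIf (hook_prod_neq0 (n + m) J)); rewrite -mulrA schur_mrho_hook //.
have -> : hook_prod (n + m) J
  = hook_prod (m + n) (fun b => b \in [seq bead m (conj_part mu) i | i <- iota 0 m]).
  rewrite -hook_prod_rev addnC; apply: eq_hook_prod => b lt_b.
  rewrite /J (bead_compl bx) ?negbK; last by lia.
  apply/map_iotaP/map_iotaP => -[i lt_i E]; exists i => //.
    by have := bead_lt bx' lt_i; move: E; lia.
  by have := bead_lt bx' lt_i; move: E; lia.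
rewrite schur_mrho_hook // (kappa_box bx).
have eE k l (nu : intpart) : in_box k l nu -> \prod_(i < k) h ^+ ((2 * i).+1 * part nu i)
    = h ^ (\sum_(i < k) \sum_(j < l) (j < part nu i)%:R * (2 * i%:Z + 1)).
  case/andP => _ le_l.
  rewrite (big_morph (fun a => h ^ a) (id1 := 1) (op1 := *%R)); last 2 first.
  - by move=> x y; rewrite expfzDr.
  - by rewrite expr0z.
  apply: eq_bigr => i _; rewrite exprnP; congr (h ^ _).
  rewrite -mulr_suml -{1}(@sum_ltn_ord (part nu i) l); last first.
    by apply: leq_trans le_l; apply: part_noninc.
  rewrite PoszM mulrC; congr (_ * _); last by lia.
  by rewrite -natz natr_sum; apply: eq_bigr => j _; rewrite natz.
rewrite (eE _ _ _ bx) (eE _ _ _ bx') -expfzDr //; congr (h ^ _).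
rewrite exchange_big -big_split; apply: eq_bigr => i _ /=.
rewrite -big_split; apply: eq_bigr => j _ /=; rewrite part_conj.
by rewrite -mulrDr; congr (_ * _); ring.
Qed.

End PrincipalSchur.

(** * Fock space *)

Lemma maya_empty : maya empty_part = fset0.
Proof. by apply/fsetP => x; rewrite /maya !inE. Qed.

Section FockDeterminant.

Implicit Types (D : {fset int}) (r : int) (n m k : nat).

(** The places from [m - 1] down to [- n], in the order of a wedge. *)
Definition int_range n m : seq int := [seq m%:Z - i.+1%:Z | i <- iota 0 (n + m)].

Definition fin_box n m D : bool := all (fun x => (- n%:Z <= x) && (x < m%:Z)) D.

(* The places below the box are all occupied and are left out. *)
Definition listing n m D : seq int := [seq r <- int_range n m | occ D r].

Lemma mem_int_range n m r : (r \in int_range n m) = (- n%:Z <= r) && (r < m%:Z).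
Proof.
apply/map_iotaP/idP => [[i lt_i ->]|bx]; first by lia.
by exists (absz (m%:Z - r - 1)%R); lia.
Qed.

Lemma uniq_int_range n m : uniq (int_range n m).
Proof. by rewrite map_inj_uniq ?iota_uniq // => i j; lia. Qed.

Lemma fin_box_flip n m D r : fin_box n m D -> - n%:Z <= r < m%:Z ->
  fin_box n m (flip D r).
Proof.
move=> /allP bx bx_r; apply/allP => x; rewrite /flip; case: ifP => _; rewrite !inE.
  by case/andP => _ /bx.
by case/orP => [/eqP ->|/bx].
Qed.

Lemma count_fin_box n m D k : fin_box n m D -> (k <= m)%N ->
  count (fun a => m%:Z - k%:Z <= a) D
  = count (occ D) [seq m%:Z - i.+1%:Z | i <- iota 0 k].
Proof.
move=> /allP bx le_km; rewrite -!size_filter; apply/perm_size/uniq_perm.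
- by rewrite filter_uniq // fset_uniq.
- by rewrite filter_uniq // map_inj_uniq ?iota_uniq // => i j; lia.
move=> x; rewrite !mem_filter /occ; case: (boolP (x \in D)) => [xD|nD] /=; last first.
  rewrite andbF; case: ltP => //= x_lt0; apply/esym/negbTE/negP => /map_iotaP[i]; lia.
have /andP[_ lt_x] := bx x xD; rewrite andbT.
apply/idP/andP => [le_x|[_ /map_iotaP[i]]]; last by lia.
split; first by lia.
by apply/map_iotaP; exists (absz (m%:Z - x - 1)%R); lia.
Qed.

Lemma aboveE n m D r : fin_box n m D -> - n%:Z <= r < m%:Z ->
  above D r = count (occ D) [seq m%:Z - i.+1%:Z | i <- iota 0 (absz (m%:Z - r - 1)%R)].
Proof.
move=> bx bx_r; rewrite /above; case: r bx_r => a bx_a.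
  rewrite addn0 -(count_fin_box bx); last by lia.
  by apply: eq_count => x; rewrite /=; lia.
have -> : absz (m%:Z - Negz a - 1)%R = (m + a)%N by lia.
rewrite iotaD map_cat count_cat -(count_fin_box bx) // add0n; congr (_ + _)%N.
  by apply: eq_count => x; lia.
have -> : iota m a = [seq (m + i)%N | i <- iota 0 a] by rewrite -iotaDl addn0.
rewrite -map_comp count_map; apply: eq_count => i /=.
by congr occ; lia.
Qed.

(** The number of elements above [r] is its position in the listing, so the sign of psi_r or psi_r^*
    is that of moving the row of [r] between the front and its sorted position. *)
Lemma listing_flip n m D r : fin_box n m D -> - n%:Z <= r < m%:Z ->
  exists s1 s2, [/\ size s1 = above D r,
    listing n m D = s1 ++ nseq (occ D r) r ++ s2 &
    listing n m (flip D r) = s1 ++ nseq (~~ occ D r) r ++ s2].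
Proof.
move=> bx bx_r; pose k := absz (m%:Z - r - 1)%R.
have lt_k : (k < n + m)%N by rewrite /k; lia.
pose t1 := [seq m%:Z - i.+1%:Z | i <- iota 0 k].
pose t2 := [seq m%:Z - i.+1%:Z | i <- iota k.+1 (n + m - k.+1)].
have rK : m%:Z - k.+1%:Z = r by rewrite /k; lia.
have rE : int_range n m = t1 ++ r :: t2.
  rewrite /int_range -[in LHS](subnKC lt_k) -addn1 -addnA add1n iotaD map_cat add0n.
  by rewrite /= rK addn1.
have ut := uniq_int_range n m; rewrite rE cat_uniq /= in ut.
case/and3P: ut => _ /norP[/= n1 _] /andP[n2 _].
have flipE t : r \notin t -> [seq x <- t | occ (flip D r) x] = [seq x <- t | occ D x].
  move=> nt; apply: eq_in_filter => x xt; rewrite occ_flip.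
  by case: eqVneq xt nt => [-> ->|] //; rewrite addbF.
exists [seq x <- t1 | occ D x], [seq x <- t2 | occ D x]; split.
- by rewrite size_filter (aboveE bx bx_r).
- by rewrite /listing rE filter_cat /=; case: (occ D r).
rewrite /listing rE filter_cat /= !flipE // occ_flip eqxx addbT.
by case: (occ D r).
Qed.

Lemma odd_count_addb (T : Type) (a b : pred T) s :
  odd (count (fun x => a x (+) b x) s) = odd (count a s) (+) odd (count b s).
Proof. by elim: s => //= x s IH; rewrite !oddD !oddb IH addbACA. Qed.

Lemma count_neg_range n m : count (fun x => x < 0) (int_range n m) = n.
Proof.
rewrite /int_range addnC iotaD map_cat count_cat count_map (_ : count _ _ = 0%N).
  rewrite add0n count_map -[RHS](size_iota m).
  by apply/eqP; rewrite -all_count; apply/allP => i; rewrite mem_iota /=; lia.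
apply/eqP; rewrite -leqn0 leqNgt -has_count; apply/hasPn => i; rewrite mem_iota /=; lia.
Qed.

(** The number of listed places is [n] plus the charge, and the charge has the parity of the
    cardinal of [D]. *)
Lemma odd_listing n m D : fin_box n m D ->
  odd (size (listing n m D)) = odd n (+) odd #|` D|.
Proof.
move=> bx; rewrite size_filter odd_count_addb count_neg_range addbC; congr (_ (+) odd _).
rewrite -size_filter; apply/perm_size/uniq_perm; rewrite ?filter_uniq ?uniq_int_range ?fset_uniq //.
move=> x; rewrite mem_filter mem_int_range.
by apply/andb_idr => xD; have /allP/(_ x xD) := bx.
Qed.

Variables (R : comUnitRingType) (A : 'I_2 -> 'I_2 -> nat -> nat -> R).
Variables (row : 'I_2 -> int -> nat -> R) (d : 'I_2 -> nat).
Implicit Types (i j : 'I_2) (S : {fset int} * {fset int}).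

(* Factor [i] has [d i] occupied and [d (1 - i)] empty places in the box. *)
Local Notation free i := (d (1 - i)%R).
Local Notation P := (d 0%R + d 1%R)%N.

Definition factor i S : {fset int} := if i == 0 then S.1 else S.2.

Definition flip2 i S r : {fset int} * {fset int} :=
  if i == 0 then (flip S.1 r, S.2) else (S.1, flip S.2 r).

Definition fermi_sign i S r : nat := (above (factor i S) r + (i != 0%R) * #|` S.1|)%N.

Lemma psi2E i r (v : fock2 R) S : psi2 i r v S =
  if occ (factor i S) r then (-1) ^+ fermi_sign i S r * v (flip2 i S r) else 0.
Proof.
rewrite /psi2 /on_factor /psi /fermi_sign /factor /flip2; case: (i == 0).
  by rewrite mul0n addn0.
by case: occ; rewrite ?mulr0 // mulrA -exprD mul1n addnC.
Qed.

Lemma psis2E i r (v : fock2 R) S : psis2 i r v S =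
  if occ (factor i S) r then 0 else (-1) ^+ fermi_sign i S r * v (flip2 i S r).
Proof.
rewrite /psis2 /on_factor /psis /fermi_sign /factor /flip2; case: (i == 0).
  by rewrite mul0n addn0.
by case: occ; rewrite ?mulr0 // mulrA -exprD mul1n addnC.
Qed.

Definition box2 S : bool :=
  fin_box (d 0) (free 0) S.1 && fin_box (d 1) (free 1) S.2.

Definition rows S : seq (nat -> R) :=
  [seq row 0 r | r <- listing (d 0) (free 0) S.1]
  ++ [seq row 1 r | r <- listing (d 1) (free 1) S.2].

Lemma ord2 i : i = 0 \/ i = 1.
Proof. by case: i => [[|[|//]] lt]; [left|right]; apply: val_inj. Qed.

Lemma factor_flip2 i j S r : factor j (flip2 i S r) =
  if j == i then flip (factor i S) r else factor j S.
Proof. by rewrite /factor /flip2; case: (ord2 i) => ->; case: (ord2 j) => ->. Qed.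

Lemma box2_factor i S : box2 S -> fin_box (d i) (free i) (factor i S).
Proof. by case/andP; rewrite /factor; case: (ord2 i) => ->. Qed.

Lemma box2_flip i S r : box2 S -> - (d i)%:Z <= r < (free i)%:Z -> box2 (flip2 i S r).
Proof.
case/andP; rewrite /box2 /flip2; case: (ord2 i) => -> /= b1 b2 br.
  by rewrite b2 fin_box_flip.
by rewrite b1 fin_box_flip.
Qed.

Hypothesis even0 : ~~ odd (d 0).

(** For the second factor the row also passes all the rows of the first; as [d 0] is even, their
    number has the parity of the charge, which is the Koszul sign. *)
Lemma rows_flip i S r : box2 S -> - (d i)%:Z <= r < (free i)%:Z ->
  exists s1 s2, [/\ (-1) ^+ size s1 = (-1) ^+ fermi_sign i S r :> R,
    rows S = s1 ++ nseq (occ (factor i S) r) (row i r) ++ s2 &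
    rows (flip2 i S r) = s1 ++ nseq (~~ occ (factor i S) r) (row i r) ++ s2].
Proof.
move=> bx br; have := box2_factor i bx; move: br; case/andP: bx => b1 b2.
rewrite /rows /flip2 /fermi_sign /factor; case: (ord2 i) => -> /= br b.
  have [s1 [s2 [sz -> ->]]] := listing_flip b br.
  exists (map (row 0) s1), (map (row 0) s2 ++ [seq row 1 x | x <- listing (d 1) (free 1) S.2]).
  by rewrite size_map sz mul0n addn0 !map_cat !map_nseq -!catA.
have [s1 [s2 [sz -> ->]]] := listing_flip b br.
exists ([seq row 0 x | x <- listing (d 0) (free 0) S.1] ++ map (row 1) s1), (map (row 1) s2).
rewrite size_cat !size_map sz mul1n !map_cat !map_nseq -!catA; split=> //.
by rewrite -signr_odd -[RHS]signr_odd !oddD odd_listing // (negbTE even0) /= addbC.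
Qed.

Hypothesis row_comb : forall i m, (m < free i)%N ->
  row i (Posz m) = fun c => \sum_(j < 2) 1 * \sum_(n < d j) A i j m n * row j (Negz n) c.

Local Notation F := (fun S => detl P (rows S)).

(** By [row_comb] and linearity, the row of an occupied place [m] is replaced by rows of holes. The
    terms that remain are those of psi psi^* applied to [F], so each particle of [S] gives back
    [F S]. *)
Lemma row_exchange i m S : box2 S -> size (rows S) = P -> (m < free i)%N ->
  occ (factor i S) (Posz m) ->
  \sum_(j < 2) \sum_(n < d j) A i j m n * psi2 i (Posz m) (psis2 j (Negz n) F) S = F S.
Proof.
move=> bx szP lt_m oc.
have br : - (d i)%:Z <= Posz m < (free i)%:Z by lia.
have [s1 [s2 [sg E E']]] := rows_flip bx br; rewrite oc /= in E E'.
have lt1 : (size s1 < P)%N by rewrite -szP E size_cat /=; lia.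
rewrite /= E (row_comb lt_m) detl_lin //; apply: eq_bigr => j _.
rewrite mul1r detl_lin //; apply: eq_bigr => n _; congr (_ * _).
rewrite psi2E oc psis2E.
set S' := flip2 i S m; have bx' : box2 S' by apply: box2_flip.
have br' : - (d j)%:Z <= Negz n < (free j)%:Z by have := ltn_ord n; lia.
have szP' : (size (s1 ++ s2)).+1 = P by rewrite -szP E !size_cat /=; lia.
(* The sign of psi brings the new row to the front. If its place is occupied, the row is repeated
   and both sides vanish; otherwise the sign of psi^* takes it to its sorted position. *)
rewrite -sg -[s1 ++ _ :: s2]/([::] ++ s1 ++ row j (Negz n) :: s2) detl_move ?szP' //=.
congr (_ * _).
have [t1 [t2 [sg' Et Et']]] := rows_flip bx' br'; rewrite E' in Et.
case: ifP => oc'; rewrite oc' /= in Et Et'.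
  by rewrite Et -[_ :: _]/([::] ++ row j (Negz n) :: t1 ++ row j (Negz n) :: t2)
    detl_dup //= -Et szP'.
rewrite -sg' /= Et'.
rewrite -[t1 ++ _ :: t2]/([::] ++ t1 ++ row j (Negz n) :: t2) detl_move /= -?Et ?szP' //.
by rewrite mulrA -expr2 -exprM mulnC exprM sqrrN expr1n expr1n mul1r.
Qed.

Definition npart S : nat :=
  (\sum_(i < 2) \sum_(m < free i) occ (factor i S) (Posz m))%N.

Lemma npart_flip_neg i S n : npart (flip2 i S (Negz n)) = npart S.
Proof.
apply: eq_bigr => j _; apply: eq_bigr => m _; rewrite factor_flip2.
case: eqP => // E; rewrite occ_flip addbF; congr (nat_of_bool (occ _ _)).
by rewrite E.
Qed.

Lemma npart_flip_pos i S m : (m < free i)%N -> occ (factor i S) (Posz m) ->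
  npart S = (npart (flip2 i S (Posz m))).+1.
Proof.
move=> lt_m oc; rewrite /npart (bigD1 i) //= [in RHS](bigD1 i) //= -addSn; congr (_ + _)%N.
  rewrite (bigD1 (Ordinal lt_m)) //= [in RHS](bigD1 (Ordinal lt_m)) //= oc.
  rewrite factor_flip2 eqxx occ_flip oc eqxx add0n add1n; congr (_.+1).
  apply: eq_bigr => k ne; rewrite occ_flip; congr (nat_of_bool _).
  by rewrite (_ : (Posz k == Posz m) = false) ?addbF //; apply/negbTE.
by apply: eq_bigr => j /negbTE ne; apply: eq_bigr => k _; rewrite factor_flip2 ne.
Qed.

Lemma box2_occ i S (m : nat) : box2 S -> occ (factor i S) (Posz m) -> (m < free i)%N.
Proof.
move=> bx; rewrite /occ addbF => mD.
by have /allP/(_ _ mD) := box2_factor i bx; lia.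
Qed.

Lemma box2_nocc i S (n : nat) : box2 S -> ~~ occ (factor i S) (Negz n) -> (n < d i)%N.
Proof.
move=> bx; rewrite /occ addbT negbK => nD.
by have /allP/(_ _ nD) := box2_factor i bx; lia.
Qed.

Lemma bogoliubov_opE (v : fock2 R) S : box2 S ->
  bogoliubov_op A v S = \sum_(i < 2) \sum_(m < free i) \sum_(j < 2) \sum_(n < d j)
    A i j m n * psi2 i (Posz m) (psis2 j (Negz n) v) S.
Proof.
move=> bx; rewrite /bogoliubov_op; apply: eq_bigr => i _.
rewrite exchange_big /=; apply: eq_bigr => j _.
rewrite (@fsum_seq _ _ [seq (m, n) | m <- iota 0 (free i), n <- iota 0 (d j)]).
- rewrite big_allpairs /= -{1}[free i]subn0 -/(index_iota 0 _) big_mkord.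
  by apply: eq_bigr => m _; rewrite -{1}[d j]subn0 -/(index_iota 0 _) big_mkord.
- by apply: allpairs_uniq; rewrite ?iota_uniq // => -[? ?] [].
move=> [m n] out; rewrite /= psi2E; case: ifP => [oc|_]; last by rewrite mulr0.
have lt_m := box2_occ bx oc; rewrite psis2E; case: ifP => [_|/negbT noc]; first by rewrite !mulr0.
have bx' : box2 (flip2 i S m) by apply: box2_flip => //; lia.
have lt_n := box2_nocc bx' noc.
by case/negP: out; apply/allpairsP; exists (m, n); rewrite !mem_iota.
Qed.

Lemma size_rows_flip i j S m n : box2 S -> (m < free i)%N -> (n < d j)%N ->
  occ (factor i S) (Posz m) -> ~~ occ (factor j (flip2 i S (Posz m))) (Negz n) ->
  size (rows (flip2 j (flip2 i S (Posz m)) (Negz n))) = size (rows S).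
Proof.
move=> bx lt_m lt_n oc noc.
have br : - (d i)%:Z <= Posz m < (free i)%:Z by lia.
have br' : - (d j)%:Z <= Negz n < (free j)%:Z by lia.
have [s1 [s2 [_ -> E]]] := rows_flip bx br.
have [t1 [t2 [_ E' ->]]] := rows_flip (box2_flip bx br) br'.
move: E'; rewrite E oc noc (negbTE noc) /= => /(congr1 size).
by rewrite !size_cat /=; lia.
Qed.

Lemma count_sub (T : eqType) (a b : pred T) s : {in s, forall x, a x -> b x} ->
  count b s = (count a s + count (fun x => b x && ~~ a x) s)%N.
Proof.
elim: s => //= x s IH sub; rewrite IH; last by move=> y ys; apply: sub; rewrite inE ys orbT.
by have := sub x (mem_head _ _); case: (a x) => [-> //|_]; case: (b x) => /=; lia.
Qed.

(** The two boxes have [P] negative places in all. With [P] rows and no particle, all of them are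
    occupied. *)
Lemma rows_vacuum S : box2 S -> size (rows S) = P -> npart S = 0%N ->
  S = (fset0, fset0).
Proof.
move=> bx szP np0.
have np i (m : nat) : occ (factor i S) (Posz m) = false.
  apply/negP => oc; have lt_m := box2_occ bx oc.
  by move: np0; rewrite (npart_flip_pos lt_m oc).
have sub i : {in int_range (d i) (free i), forall x, occ (factor i S) x -> x < 0}.
  by move=> [m|//] _; rewrite np.
have cE i := count_sub (sub i).
have c0 i : count (fun x => (x < 0) && ~~ occ (factor i S) x) (int_range (d i) (free i)) = 0%N.
  have ar (a b c e p q : nat) :
      (p = a + b -> q = c + e -> c + a = q + p -> e = 0 /\ b = 0)%N by lia.
  move: szP; rewrite /rows size_cat !size_map !size_filter.
  have E0 := cE 0; have E1 := cE 1; rewrite !count_neg_range in E0 E1.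
  by move=> /(ar _ _ _ _ _ _ E1 E0)[H0 H1]; case: (ord2 i) => ->.
have D0 i : factor i S = fset0.
  apply/fsetP => x; rewrite inE; apply/negP => xD.
  have br : x \in int_range (d i) (free i).
    by rewrite mem_int_range; have /allP/(_ _ xD) := box2_factor i bx.
  case: x xD br => [m|n] xD br; first by have := np i m; rewrite /occ xD.
  move/eqP: (c0 i); rewrite -leqn0 leqNgt -has_count => /negP; apply.
  by apply/hasP; exists (Negz n); rewrite //= /occ xD.
by case: S D0 {bx szP np0 np sub cE c0} => S1 S2 D0; have := D0 1; have := D0 0; rewrite /factor /= => -> ->.
Qed.

Hypothesis F_vac : F (fset0, fset0) = 1.

Lemma vac2E S : box2 S -> size (rows S) = P ->
  vac2 R S = if npart S == 0%N then F S else 0.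
Proof.
move=> bx szP; rewrite /vac2 maya_empty; case: eqP => [->|ne].
  rewrite (_ : npart _ = 0%N) ?F_vac //; apply: big1 => i _; apply: big1 => m _.
  by rewrite /factor; case: (i == 0).
by case: eqP => // /(rows_vacuum bx szP).
Qed.

(** Any of the [k.+1] particles of [S] can be the one created last, and each choice contributes the
    same by [row_exchange]. The resulting factorial is the one that the exponential divides by. *)
Lemma iter_bogoliubov_op k S : box2 S -> size (rows S) = P ->
  iter k (bogoliubov_op A) (vac2 R) S
  = k`!%:R * (if npart S == k then F S else 0).
Proof.
elim: k S => [|k IH] S bx szP; first by rewrite /= vac2E // mul1r.
rewrite iterS bogoliubov_opE //.
set v := iter k _ _.
transitivity (\sum_(i < 2) \sum_(m < free i) if occ (factor i S) (Posz m)
    then (k`!%:R * (if npart S == k.+1 then F S else 0)) else 0).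
  apply: eq_bigr => i _; apply: eq_bigr => m _; case: ifP => oc; last first.
    by rewrite big1 // => j _; rewrite big1 // => n _; rewrite psi2E oc mulr0.
  have -> : (if npart S == k.+1 then F S else 0) = (npart S == k.+1)%:R * F S.
    by case: ifP; rewrite ?mul1r ?mul0r.
  rewrite -(row_exchange bx szP (ltn_ord m) oc) !mulr_sumr; apply: eq_bigr => j _.
  rewrite !mulr_sumr; apply: eq_bigr => n _; rewrite !psi2E oc !psis2E.
  case: ifP => oc'; first by rewrite !mulr0.
  rewrite /v IH ?size_rows_flip ?oc' //; last first.
    apply: box2_flip; last by have := ltn_ord n; lia.
    by apply: box2_flip => //; have := ltn_ord m; lia.
  rewrite npart_flip_neg (npart_flip_pos (ltn_ord m) oc) eqSS.
  case: eqP => _; last by rewrite !(mul0r, mulr0).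
  have ac (a b c d' e : R) : a * (b * (c * (d' * e))) = b * (c * (d' * (a * e))).
    by rewrite (mulrCA a b) (mulrCA a c) (mulrCA a d').
  by rewrite mul1r -ac.
rewrite factS natrM -mulrA.
transitivity ((npart S)%:R * (k`!%:R * (if npart S == k.+1 then F S else 0))).
  rewrite /npart natr_sum mulr_suml; apply: eq_bigr => i _.
  rewrite natr_sum mulr_suml; apply: eq_bigr => m _.
  by case: occ; rewrite ?mul1r ?mul0r.
by case: eqP => [->|_] //; rewrite !mulr0.
Qed.

Hypothesis unit_fact : forall k, k`!%:R \is a @GRing.unit R.

Lemma exp_vac2_det S : box2 S -> size (rows S) = P ->
  exp_vac2 (bogoliubov_op A) S = detl P (rows S).
Proof.
move=> bx szP; rewrite /exp_vac2 (@fsum_seq _ _ [:: npart S]) //=.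
  by rewrite big_seq1 iter_bogoliubov_op // eqxx mulKr.
move=> k; rewrite inE => ne; rewrite iter_bogoliubov_op // eq_sym (negbTE ne).
by rewrite !mulr0.
Qed.

End FockDeterminant.

(** * The gluing sum as a minor *)

Section PowerSeries.

Variable K : fieldType.
Implicit Types f g : fps K.

Local Notation X := (fpsX K).

Lemma fcoef_sum (I : Type) (r : seq I) (Pr : pred I) (F : I -> fps K) k :
  fcoef (\sum_(i <- r | Pr i) F i) k = \sum_(i <- r | Pr i) fcoef (F i) k.
Proof. by apply: (big_morph (fun f => fcoef f k)) => //=; rewrite if_same. Qed.

Lemma fcoef_fpsCM (c : K) f k : fcoef (fpsC c * f) k = c * fcoef f k.
Proof.
rewrite /= big_ord_recl /= subn0 big1 ?addr0 // => i _.
by rewrite mul0r.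
Qed.

Lemma fcoef_fpsXM f k : fcoef (X * f) k = if k is k'.+1 then fcoef f k' else 0.
Proof.
rewrite /=; case: k => [|k]; first by rewrite big_ord_recl big_ord0 /= mul0r addr0.
rewrite !big_ord_recl /= mul0r add0r mul1r subSS subn0 big1 ?addr0 // => i _.
by rewrite mul0r.
Qed.

Lemma fcoef_fpsXn n k : fcoef (X ^+ n) k = (k == n)%:R.
Proof.
elim: n k => [|n IH] k; first by rewrite expr0 /=; case: (k == 0%N).
by rewrite exprS fcoef_fpsXM; case: k.
Qed.

Lemma fpsX_lreg n : GRing.lreg (X ^+ n).
Proof.
apply: lregX => f g E; apply: fpsP => k.
by have := fcoef_fpsXM f k.+1; rewrite E fcoef_fpsXM.
Qed.

Fact fpsC_is_zmod : zmod_morphism (@fpsC K).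
Proof. by move=> a b; apply: fpsP => k /=; case: (k == 0%N); rewrite ?subrr. Qed.
Fact fpsC_is_monoid : monoid_morphism (@fpsC K).
Proof.
split=> // a b; apply: fpsP => k; rewrite fcoef_fpsCM /=.
by case: (k == 0%N); rewrite ?mulr0.
Qed.
HB.instance Definition _ := GRing.isZmodMorphism.Build K (fps K) (@fpsC K) fpsC_is_zmod.
HB.instance Definition _ := GRing.isMonoidMorphism.Build K (fps K) (@fpsC K) fpsC_is_monoid.

Lemma fpsC_unit (c : K) : c != 0 -> fpsC c \is a GRing.unit.
Proof. by []. Qed.

Lemma fps_unitE f : (f \is a GRing.unit) = (fcoef f 0 != 0).
Proof. by []. Qed.

(** Congruence modulo [X ^+ k.+1]. *)
Definition eqm k f g : Prop := forall i, (i <= k)%N -> fcoef f i = fcoef g i.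

Lemma eqm_refl k f : eqm k f f. Proof. by []. Qed.

Lemma eqmM k f f' g g' : eqm k f f' -> eqm k g g' -> eqm k (f * g) (f' * g').
Proof.
move=> ef eg i le_i /=; apply: eq_bigr => j _.
by rewrite ef ?eg //; have := ltn_ord j; lia.
Qed.

Lemma eqmV k f g : f \is a GRing.unit -> g \is a GRing.unit ->
  eqm k f g -> eqm k f^-1 g^-1.
Proof.
move=> uf ug efg; have -> : g^-1 = f^-1 * (f * g^-1) by rewrite mulKr.
have {1}-> : f^-1 = f^-1 * (g * g^-1) by rewrite mulrV // mulr1.
apply: eqmM => //; apply: eqmM => // i le_i; exact/esym/efg.
Qed.

Lemma eqm_sum k (I : Type) (r : seq I) (Pr : pred I) (F G : I -> fps K) :
  (forall i, Pr i -> eqm k (F i) (G i)) ->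
  eqm k (\sum_(i <- r | Pr i) F i) (\sum_(i <- r | Pr i) G i).
Proof. by move=> e j le_j; rewrite !fcoef_sum; apply: eq_bigr => i Pi; apply: e. Qed.

Lemma eqm_prod k (I : Type) (r : seq I) (Pr : pred I) (F G : I -> fps K) :
  (forall i, Pr i -> eqm k (F i) (G i)) ->
  eqm k (\prod_(i <- r | Pr i) F i) (\prod_(i <- r | Pr i) G i).
Proof. by move=> e; apply: (big_ind2 (eqm k)) => // *; apply: eqmM. Qed.

Lemma eqm_det k n (A B : 'M[fps K]_n) : (forall i j, eqm k (A i j) (B i j)) ->
  eqm k (\det A) (\det B).
Proof. by move=> e; apply: eqm_sum => s _; apply: eqmM => //; apply: eqm_prod. Qed.

End PowerSeries.

Section Cramer.

Variable R : comNzRingType.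

(** This is x adj(W) W = det(W) x. The determinant stays a factor, since the vacuum minor to which
    this is applied is not invertible. *)
Lemma detl_cramer P (w : seq (nat -> R)) (x : nat -> R) c : size w = P -> (c < P)%N ->
  detl P w * x c
  = \sum_(k < P) detl P (take k w ++ x :: drop k.+1 w) * nth (fun=> 0) w k c.
Proof.
move=> szw lt_c; pose W := \matrix_(i < P, j < P) nth (fun=> 0) w i j.
pose v := \row_(j < P) x j.
have := congr1 (fun M : 'rV_P => M 0 (Ordinal lt_c)) (mulmxA v (\adj W) W).
rewrite mul_adj_mx mul_mx_scalar !mxE /= => ->.
apply: eq_bigr => k _; rewrite !mxE; congr (_ * _).
rewrite /detl (expand_det_row _ k); apply: eq_bigr => j _; rewrite !mxE.
have szt : size (take k w) = k by rewrite size_takel // szw ltnW.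
rewrite nth_cat szt ltnn subnn /=; congr (_ * _).
rewrite /cofactor; congr (_ * \det _); apply/matrixP => a b; rewrite !mxE.
have : (lift k a : nat) != k by rewrite eq_sym neq_lift.
move: (nat_of_ord (lift k a)) => l ne_l; rewrite nth_cat szt.
case: ltnP => [lt_l|le_l]; first by rewrite nth_take.
have lt_l : (k < l)%N by rewrite ltn_neqAle eq_sym ne_l.
rewrite -[(l - k)%N]prednK ?subn_gt0 //= nth_drop.
by congr (nth _ w _ _); lia.
Qed.

End Cramer.

Definition triangle n : nat := \sum_(i < n) (n - i.+1).

Lemma triangleS n : triangle n.+1 = (n + triangle n)%N.
Proof. by rewrite /triangle big_ord_recl subn1. Qed.

Lemma sum_bead n (mu : intpart) : (size mu <= n)%N ->
  (\sum_(i < n) bead n mu i = psize mu + triangle n)%N.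
Proof. by move=> le_n; rewrite (psizeE le_n) -big_split. Qed.

Section MinorGenerating.

Variables (K : fieldType) (B1 B2 : nat -> nat -> K) (w1 w2 : intpart -> intpart -> K).
Implicit Types mu nu la : intpart.

(** A single infinite matrix [B] serves for every number [n] of beads, so that partitions of
    different charges and boxes of different sizes use minors of the same matrix. *)
Definition determinantal (B : nat -> nat -> K) (w : intpart -> intpart -> K) : Prop :=
  forall n mu la, (size mu <= n)%N -> (size la <= n)%N ->
  w mu la = \det (\matrix_(i < n, j < n) B (bead n mu i) (bead n la j)).

Variables (al1 be1 al be al2 be2 : K).

Local Notation X := (fpsX K).

(* The sector of charge [s] shifts the beads by [s], which only changes the
   weights. *)
Definition wterm (s : int) mu nu la : fps K :=
  fpsC (((al1 * be1 ^ (2 * s)) ^+ psize mu * be1 ^ kappa mu)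
      * ((al * be ^ (2 * s)) ^+ psize la * be ^ kappa la)
      * ((al2 * be2 ^ (2 * s)) ^+ psize nu * be2 ^ kappa nu)
      * (w1 mu la * w2 la nu)) * X ^+ psize la.

Definition Zsum s mu nu : fps K := fps_sum (wterm s mu nu).

Definition Ztrunc n P s mu nu : fps K := \sum_(la <- boxparts n P) wterm s mu nu la.

(** A partition outside the box has more than [k] boxes and contributes only to higher powers of
    X. *)
Lemma Ztrunc_eqm k n P s mu nu : (n <= P)%N -> (k <= n)%N -> (k <= P - n)%N ->
  eqm k (Ztrunc n P s mu nu) (Zsum s mu nu).
Proof.
move=> le_nP le_n le_P i le_i; rewrite /Ztrunc fcoef_sum.
have -> : fcoef (Zsum s mu nu) i
    = \sum_(la \in [set: intpart]%classic) fcoef (wterm s mu nu la) i by [].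
rewrite (fsum_seq (boxparts_uniq n P)) // => la; rewrite mem_boxparts // => out.
rewrite /wterm fcoef_fpsCM fcoef_fpsXn; case: eqP => [E|]; last by rewrite mulr0.
by case/negP: out; apply: psize_box; lia.
Qed.

Hypothesis det1 : determinantal B1 w1.
Hypothesis det2 : determinantal B2 w2.
Hypotheses (al10 : al1 != 0) (be10 : be1 != 0) (al0 : al != 0) (be0 : be != 0).
Hypotheses (al20 : al2 != 0) (be20 : be2 != 0).

(** The weights are taken at positions relative to the fixed origin [N]. A minor with n = N + s
    beads then sees them shifted by [s], so one matrix covers all the charges. *)
Definition minor_mx P N (a b : nat) : fps K :=
  \sum_(c < P) fpsC (weight al1 be1 (a%:Z - N%:Z) * B1 a c)
    * (fpsC (weight al be (c%:Z - N%:Z)) * X ^+ c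
       * fpsC (B2 c b * weight al2 be2 (b%:Z - N%:Z))).

Definition base_weight n (s : int) : K :=
  \prod_(i < n) weight al1 be1 (s - i.+1%:Z) * \prod_(i < n) weight al be (s - i.+1%:Z)
  * \prod_(i < n) weight al2 be2 (s - i.+1%:Z).

Lemma det_minor P N n s mu nu : (n <= P)%N -> n%:Z = N%:Z + s ->
  (size mu <= n)%N -> (size nu <= n)%N ->
  \det (\matrix_(i < n, j < n) minor_mx P N (bead n mu i) (bead n nu j))
  = fpsC (base_weight n s) * X ^+ triangle n * Ztrunc n P s mu nu.
Proof.
move=> le_nP nE le_mu le_nu.
rewrite (cauchy_binet_part n P
  (fun i c => fpsC (weight al1 be1 ((bead n mu i)%:Z - N%:Z) * B1 (bead n mu i) c))
  (fun c j => fpsC (weight al be (c%:Z - N%:Z)) * X ^+ c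
       * fpsC (B2 c (bead n nu j) * weight al2 be2 ((bead n nu j)%:Z - N%:Z)))).
rewrite /Ztrunc mulr_sumr; apply: eq_big_seq => la; rewrite mem_boxparts // => /andP[le_la _].
have wE (nu' : intpart) a b : (size nu' <= n)%N -> a != 0 -> b != 0 ->
   \prod_(i < n) weight a b ((bead n nu' i)%:Z - N%:Z)
   = \prod_(i < n) weight a b (s - i.+1%:Z)
    * ((a * b ^ (2 * s)) ^+ psize nu' * b ^ kappa nu').
  move=> le a0 b0; rewrite -prod_weight //; apply: eq_bigr => i _.
  by congr weight; rewrite nE; ring.
have -> : \det (\matrix_(i < n, k < n)
     fpsC (weight al1 be1 ((bead n mu i)%:Z - N%:Z) * B1 (bead n mu i) (bead n la k)))
  = fpsC (\prod_(i < n) weight al1 be1 ((bead n mu i)%:Z - N%:Z) * w1 mu la).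
  have := det_scale (fun a : nat => weight al1 be1 (a%:Z - N%:Z)) (fun=> 1)
    (fun i j : 'I_n => B1 (bead n mu i) (bead n la j)) (bead n mu) id.
  rewrite big1_eq mulr1 -det1 // => <-; rewrite -det_map_mx; congr (\det _).
  by apply/matrixP => i j; rewrite !mxE mulr1.
have -> : \det (\matrix_(k < n, j < n) (fpsC (weight al be ((bead n la k)%:Z - N%:Z))
      * X ^+ bead n la k
      * fpsC (B2 (bead n la k) (bead n nu j) * weight al2 be2 ((bead n nu j)%:Z - N%:Z))))
  = X ^+ (psize la + triangle n)
    * fpsC (\prod_(i < n) weight al be ((bead n la i)%:Z - N%:Z) * w2 la nu
            * \prod_(i < n) weight al2 be2 ((bead n nu i)%:Z - N%:Z)).
  rewrite -(sum_bead le_la) expr_sum.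
  have := det_scale (fun a : nat => weight al be (a%:Z - N%:Z))
    (fun b : nat => weight al2 be2 (b%:Z - N%:Z))
    (fun i j : 'I_n => B2 (bead n la i) (bead n nu j)) (bead n la) (bead n nu).
  rewrite -det2 // => <-; rewrite -det_map_mx.
  set C := map_mx _ _.
  have := det_scale (fun a : nat => X ^+ a) (fun=> 1) (fun i j : 'I_n => C i j) (bead n la) id.
  rewrite big1_eq mulr1 (_ : \matrix_(i, j) C i j = C); last first.
    by apply/matrixP => i j; rewrite mxE.
  move=> <-; congr (\det _); apply/matrixP => i j; rewrite !mxE mulr1.
  rewrite mulrAC -rmorphM mulrC; congr (_ * fpsC _); ring.
rewrite /wterm !wE // /base_weight exprD !rmorphM /=; ring.
Qed.

End MinorGenerating.

(** * Partitions one particle or one hole away from the vacuum *)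

Fact hook_subproof (m n : nat) : is_intpart (m.+1 :: nseq n 1%N).
Proof.
apply/andP; split; last by rewrite inE mem_nseq andbF.
by rewrite /= path_min_sorted ?all_nseq /geq /= ?orbT //; elim: n => //= -[|n].
Qed.
(** In Frobenius notation this is (m | n): the vacuum with a particle at m + 1/2 and a hole at - n -
    1/2. *)
Definition hook (m n : nat) : intpart := IntPart (hook_subproof m n).

Fact row_subproof (m : nat) : is_intpart (nseq (0 < m) m).
Proof. by case: m. Qed.
Definition row_part (m : nat) : intpart := IntPart (row_subproof m).

Definition col_part (n : nat) : intpart := conj_part (row_part n).

Lemma part_hook m n i : part (hook m n) i = if i == 0%N then m.+1 else (i <= n)%N : nat.
Proof. by case: i => //= i; rewrite /part /= nth_nseq; case: ltnP. Qed.

Lemma part_row m i : part (row_part m) i = if i == 0%N then m else 0%N.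
Proof. by case: m i => [|m] [|i] //; rewrite /part /= nth_nil. Qed.

Lemma part_col n i : part (col_part n) i = (i < n)%N.
Proof.
have E k : (k < part (col_part n) i)%N = (i < if k == 0%N then n else 0)%N.
  by rewrite part_conj part_row.
have := E 0%N; have := E 1%N; rewrite /= ltn0; case: (i < n)%N; lia.
Qed.

Definition vac_beads n : seq nat := [seq bead n empty_part i | i <- iota 0 n].

Lemma size_vac_beads n : size (vac_beads n) = n.
Proof. by rewrite size_map size_iota. Qed.

Lemma nth_vac_beads n i : (i < n)%N -> nth 0%N (vac_beads n) i = (n - i.+1)%N.
Proof. by move=> lt_i; rewrite (nth_map 0%N) ?size_iota // nth_iota // bead_empty. Qed.

Lemma nth_beads n (mu : intpart) i : (i < n)%N ->
  nth 0%N [seq bead n mu i | i <- iota 0 n] i = bead n mu i.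
Proof. by move=> lt_i; rewrite (nth_map 0%N) ?size_iota // nth_iota. Qed.

Lemma nth_vac_beads_del n k i : (k < n)%N -> (i < n.-1)%N ->
  nth 0%N (take k (vac_beads n) ++ drop k.+1 (vac_beads n)) i
  = (n - (if i < k then i else i.+1).+1)%N.
Proof.
move=> lt_k lt_i; rewrite nth_cat size_takel ?size_vac_beads ?(ltnW lt_k) //.
case: ltnP => [lt_ik|le_ki]; first by rewrite nth_take // nth_vac_beads //; lia.
by rewrite nth_drop nth_vac_beads; lia.
Qed.

Lemma size_vac_beads_del n k : (k < n)%N ->
  size (take k (vac_beads n) ++ drop k.+1 (vac_beads n)) = n.-1.
Proof.
move=> lt_k; rewrite size_cat size_drop size_take size_vac_beads lt_k; lia.
Qed.

(** One vacuum bead is deleted and a new one comes in front. With one bead more or one bead fewer,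
    only one of the two operations takes place, and the partition is a row or a column. *)
Lemma beads_hook n m k : (k < n)%N ->
  [seq bead n (hook m k) i | i <- iota 0 n]
  = (n + m)%N :: take k (vac_beads n) ++ drop k.+1 (vac_beads n).
Proof.
move=> lt_k; apply: (@eq_from_nth _ 0%N).
  by rewrite /= size_vac_beads_del // size_map size_iota; lia.
move=> i; rewrite size_map size_iota => lt_i; rewrite nth_beads // /bead part_hook.
case: i lt_i => [|i] lt_i /=; first by lia.
by rewrite nth_vac_beads_del; [case: ltnP; lia|lia|lia].
Qed.

Lemma beads_row n m :
  [seq bead n.+1 (row_part m) i | i <- iota 0 n.+1] = (n + m)%N :: vac_beads n.
Proof.
apply: (@eq_from_nth _ 0%N); first by rewrite /= !size_map !size_iota.
move=> i; rewrite size_map size_iota => lt_i; rewrite nth_beads // /bead part_row.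
case: i lt_i => [|i] lt_i /=; first by lia.
by rewrite nth_vac_beads.
Qed.

Lemma beads_col n k : (k < n)%N ->
  [seq bead n.-1 (col_part k) i | i <- iota 0 n.-1]
  = take k (vac_beads n) ++ drop k.+1 (vac_beads n).
Proof.
move=> lt_k; apply: (@eq_from_nth _ 0%N).
  by rewrite size_vac_beads_del // size_map size_iota; lia.
move=> i; rewrite size_map size_iota => lt_i; rewrite nth_beads // /bead part_col.
by rewrite nth_vac_beads_del //; case: ltnP; lia.
Qed.

Section GluedMinors.

Variables (R : comNzRingType) (M : nat -> nat -> R) (z : R).

(* The unit rows delete the columns at the reflected beads of [nu], which leaves
   those at the beads of the conjugate of [nu]. *)
Definition glued_rows P (mu nu : seq nat) : seq (nat -> R) :=
  [seq M b | b <- mu] ++ [seq (fun j => z * unit_row R (P.-1 - b) j) | b <- nu].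

(** Sort the columns by a permutation matrix that puts the beads of the conjugate of [nu] first. The
    reflected beads of [nu] are the remaining columns, so the unit rows become [z] times an identity
    block, which [det_stable] strips; the sign is given by [detl_unit_rows]. *)
Lemma detl_glued_rows n m mu nu : (size mu <= n)%N -> in_box m n nu ->
  detl (n + m) (glued_rows (n + m) [seq bead n mu i | i <- iota 0 n]
                               [seq bead m nu i | i <- iota 0 m])
  = (-1) ^+ (psize nu + triangle n) * (z ^+ m
    * \det (\matrix_(i < n, j < n) M (bead n mu i) (bead n (conj_part nu) j))).
Proof.
move=> le_mu bx; pose la := conj_part nu; have bx' : in_box n m la by rewrite in_box_conj.
pose J (b : nat) := b \in [seq bead n la i | i <- iota 0 n].
pose u := [seq bead n la i | i <- iota 0 n]
  ++ [seq ((n + m).-1 - bead m nu i)%N | i <- iota 0 m].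
have uE : u = rev [seq j <- iota 0 (n + m) | J j] ++ [seq j <- iota 0 (n + m) | ~~ J j].
  by have := beads_conjE bx'; rewrite conj_partK /u => ->; congr (_ ++ _); apply: beadsE.
have szu : size u = (n + m)%N by rewrite size_cat !size_map !size_iota.
have sgE : (\sum_(j < n + m | J j) j)%N = (psize nu + triangle n)%N.
  rewrite -(psize_conj nu) -sum_bead; last by case/andP: bx'.
  rewrite -(big_mkord J id) /index_iota subn0 -big_filter /=.
  rewrite (perm_big [seq bead n la i | i <- iota 0 n]); last first.
    by rewrite (beadsE bx') perm_sym perm_rev.
  by rewrite big_map -[RHS](big_mkord xpredT (bead n la)) /index_iota subn0.
have uniq_u : uniq u.
  rewrite uE cat_uniq rev_uniq !filter_uniq ?iota_uniq // andbT.
  by apply/hasPn => x; rewrite mem_rev !mem_filter => /andP[/negbTE -> _].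
have u_lt k : (k < n + m)%N -> (nth 0%N u k < n + m)%N.
  move=> lt_k; have : nth 0%N u k \in u by rewrite mem_nth ?szu.
  by rewrite {2}uE mem_cat mem_rev !mem_filter !mem_iota; lia.
have detU : detl (n + m) (map (unit_row R) u) = (-1) ^+ (psize nu + triangle n).
  by rewrite uE detl_unit_rows sgE.
rewrite -detU mulrC.
set rs := glued_rows _ _ _.
have szr : size rs = (n + m)%N by rewrite size_cat !size_map !size_iota.
have sq1 : detl (n + m) (map (unit_row R) u) * detl (n + m) (map (unit_row R) u) = 1.
  by rewrite detU -expr2 -exprM mulnC exprM sqrrN expr1n expr1n.
rewrite -[LHS]mulr1 -sq1 mulrA; congr (_ * _).
rewrite [X in _ * X = _]/detl -[X in _ * X = _]det_tr -det_mulmx.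
pose f i j := nth (fun=> 0) rs i (nth 0%N u j).
have -> : (\matrix_(i < n + m, j < n + m) nth (fun=> 0) rs i j)
    *m (\matrix_(i < n + m, j < n + m) nth (fun=> 0) (map (unit_row R) u) i j)^T
  = \matrix_(i < n + m, j < n + m) f i j.
  apply/matrixP => i j; rewrite !mxE (bigD1 (Ordinal (u_lt j (ltn_ord j)))) //= big1 ?addr0.
    by rewrite !mxE (nth_map 0%N) ?szu // /unit_row eqxx mulr1.
  move=> k ne; rewrite !mxE (nth_map 0%N) ?szu // /unit_row.
  by rewrite (_ : (k == nth 0%N u j :> nat) = false) ?mulr0 //; apply/negbTE.
have fE i j : (n <= i)%N -> (i < n + m)%N -> (j < n + m)%N -> f i j = z * (i == j)%:R.
  move=> le_i lt_i lt_j.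
  have uiE : nth 0%N u i = ((n + m).-1 - bead m nu (i - n))%N.
    rewrite nth_cat size_map size_iota ltnNge le_i /= (nth_map 0%N) ?size_iota; last by lia.
    by rewrite nth_iota //; lia.
  rewrite /f nth_cat !size_map !size_iota ltnNge le_i /= -map_comp.
  rewrite (nth_map 0%N) ?size_iota; last by lia.
  rewrite nth_iota /= ?add0n; last by lia.
  by rewrite -uiE /unit_row nth_uniq ?szu // eq_sym.
rewrite (@det_stable _ f z n) ?leq_addr // => [|k le_k lt_k|k j le_k lt_k lt_j].
- rewrite addKn; congr (_ * \det _); apply/matrixP => i j; rewrite !mxE /f.
  rewrite !nth_cat !size_map !size_iota !ltn_ord -map_comp.
  by rewrite !(nth_map 0%N) ?size_iota // !nth_iota.
- by rewrite fE // eqxx mulr1.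
by rewrite fE ?(ltn_trans lt_j) // gtn_eqF // mulr0.
Qed.

End GluedMinors.

(** * The Bogoliubov transform *)

Section Maya.

Lemma fin_box_maya n m (mu : intpart) : in_box n m mu -> fin_box n m (maya mu).
Proof.
case/andP => le_n le_m; apply/allP => x; rewrite /maya !inE.
have le_p i := part_noninc mu (leq0n i).
case/orP => /andP[_ /map_iotaP[i lt_i ->]]; last by lia.
by have := le_p i; lia.
Qed.

Lemma listing_maya n m (mu : intpart) : in_box n m mu ->
  listing n m (maya mu) = [seq (b%:Z - n%:Z) | b <- [seq bead n mu i | i <- iota 0 n]].
Proof.
move=> bx; apply: (@irr_sorted_eq _ (fun x y : int => y < x)).
- by move=> x y z; lia.
- by move=> x; rewrite ltxx.
- apply: sorted_filter; first by move=> x y z; lia.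
  apply/(sortedP 0) => i; rewrite size_map size_iota => lt_i.
  by rewrite !(nth_map 0%N) ?size_iota ?(ltnW lt_i) // !nth_iota ?(ltnW lt_i) //; lia.
- apply/(sortedP 0) => i; rewrite !size_map size_iota => lt_i.
  rewrite !(nth_map 0%N) ?size_map ?size_iota ?(ltnW lt_i) //.
  rewrite !nth_iota ?(ltnW lt_i) // !add0n.
  by have := bead_dec mu (ltnSn i) lt_i; lia.
move=> x; rewrite mem_filter mem_int_range -map_comp.
apply/andP/map_iotaP => [[/occ_maya[i xE] /andP[le_x lt_x]]|[i lt_i ->]].
  have lt_i : (i < n)%N.
    rewrite ltnNge; apply/negP => le_i.
    by move: xE; rewrite part0; [lia | case/andP: bx => le_n _; apply: leq_trans le_i].
  by exists i; rewrite //= /bead xE; lia.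
have lt_b := bead_lt bx lt_i; split; last by rewrite /=; lia.
by apply/occ_maya; exists i; rewrite /= /bead; lia.
Qed.

End Maya.

Definition factor_dim (N L : nat) (i : 'I_2) : nat := if i == 0 then N else L.

(* The place of the hole [- n - 1/2] of factor [i] in the listing of the vacuum. *)
Definition hole_index (N : nat) (i : 'I_2) (n : nat) : nat :=
  if i == 0 then n else (N + n)%N.

Section Bogoliubov.

Variables (K : fieldType) (B1 B2 : nat -> nat -> K) (w1 w2 : intpart -> intpart -> K).
Hypothesis det1 : determinantal B1 w1.
Hypothesis det2 : determinantal B2 w2.
Variables (al1 be1 al be al2 be2 : K).
Hypotheses (al10 : al1 != 0) (be10 : be1 != 0) (al0 : al != 0) (be0 : be != 0).
Hypotheses (al20 : al2 != 0) (be20 : be2 != 0).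
Implicit Types (mu nu la : intpart) (i j : 'I_2).

Local Notation X := (fpsX K).
Local Notation Zs := (Zsum w1 w2 al1 be1 al be al2 be2).
Local Notation Zt := (Ztrunc w1 w2 al1 be1 al be al2 be2).
Local Notation bw := (base_weight al1 be1 al be al2 be2).
Local Notation empty := empty_part.

Lemma weight0 (a b : K) : weight a b 0 = 1.
Proof. by rewrite /weight mul0r !expr0z mulr1. Qed.

Lemma weightN1 (a b : K) : weight a b (-1) = a^-1.
Proof. by rewrite /weight mulr0 expr0z mulr1. Qed.

Lemma base_weightS n : bw n.+1 1 = bw n 0.
Proof.
have E (a b : K) : \prod_(i < n.+1) weight a b (1 - i.+1%:Z) = \prod_(i < n) weight a b (0 - i.+1%:Z) :> K.
  rewrite big_ord_recl /= subrr weight0 mul1r; apply: eq_bigr => i _.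
  by congr weight; rewrite /bump /=; lia.
by rewrite /base_weight !E.
Qed.

(** Charge -1 lacks the weights at position -1, which are the inverses of [al1], [al] and [al2];
    this is the origin of their product in [amplitude]. *)
Lemma base_weightP n : (0 < n)%N -> bw n.-1 (-1) = al1 * al * al2 * bw n 0.
Proof.
case: n => // n _; have E (a b : K) : a != 0 ->
    \prod_(i < n) weight a b (-1 - i.+1%:Z) = a * \prod_(i < n.+1) weight a b (0 - i.+1%:Z) :> K.
  by move=> a0; rewrite big_ord_recl /= sub0r weightN1 mulVKf.
by rewrite /base_weight !E //; ring.
Qed.

Lemma base_weight_neq0 n s : bw n s != 0.
Proof. by rewrite !mulf_neq0 //; apply/prodf_neq0 => i _; apply: weight_neq0. Qed.

(* Normalized amplitudes of the basis vectors obtained from the vacuum by one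
   [psi psi^*]; the signs come from sorting them. *)
Definition amplitude (Z : int -> intpart -> intpart -> fps K) i j (m n : nat) : fps K :=
  (if i == 0 then
     if j == 0 then (-1) ^+ n * Z 0 (hook m n) empty
     else (-1) ^+ n * ((-1) ^+ psize (col_part n) * Z 1 (row_part m) (conj_part (col_part n)))
   else
     if j == 0 then (-1) ^+ n.+1 * ((-1) ^+ (psize (row_part m)).+1
       * (fpsC (al1 * al * al2) * X * Z (-1) (col_part n) (conj_part (row_part m))))
     else (-1) ^+ n * ((-1) ^+ psize (hook m n) * Z 0 empty (conj_part (hook m n))))
  / Z 0 empty empty.

Lemma determinantal_empty B w : determinantal B w -> w empty empty = 1 :> K.
Proof. by move=> dB; rewrite (dB 0%N) // det_mx00. Qed.

Lemma fcoef_wterm0 s mu nu la : (0 < psize la)%N ->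
  fcoef (wterm w1 w2 al1 be1 al be al2 be2 s mu nu la) 0 = 0.
Proof. by move=> lt0; rewrite fcoef_fpsCM fcoef_fpsXn eq_sym (gtn_eqF lt0) mulr0. Qed.

Lemma Zsum_unit : Zs 0 empty empty \is a GRing.unit.
Proof.
rewrite fps_unitE (_ : fcoef _ 0 = 1) ?oner_eq0 //; rewrite -[LHS]/(\sum_(la \in [set: intpart]%classic)
  fcoef (wterm w1 w2 al1 be1 al be al2 be2 0 empty empty la) 0).
rewrite (@fsum_seq _ _ [:: empty]) //.
  rewrite big_seq1 fcoef_fpsCM fcoef_fpsXn (determinantal_empty det1) (determinantal_empty det2).
  have p0 : psize empty = 0%N by [].
  have k0 : kappa empty = 0 by rewrite /kappa big_ord0.
  by rewrite p0 k0 eqxx !expr0 !expr0z !mulr1.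
move=> la; rewrite inE => /eqP ne; apply: fcoef_wterm0.
rewrite lt0n; apply/eqP => p0; apply: ne; apply: intpart_eq => i.
have := psize_box (n := 0) (m := 0) (mu := la); rewrite p0 => /(_ isT isT)/andP[s0 _].
by rewrite !part0 //; apply: leq_trans s0 _.
Qed.

Section Truncation.

Variables N L : nat.
Hypotheses (evenN : ~~ odd N) (N0 : (0 < N)%N) (L0 : (0 < L)%N).
Local Notation P := (N + L)%N.
Local Notation M := (minor_mx B1 B2 al1 be1 al be al2 be2 P N).
Local Notation rowsOf := (glued_rows M (X ^+ N) P).
Local Notation beads n mu := [seq bead n mu k | k <- iota 0 n].

Definition Zbox (s : int) : intpart -> intpart -> fps K := Zt (absz (N%:Z + s)) P s.

(** What the minors of charges 0, 1 and -1 share. With n = N + s and m = L - s, the exponent N m +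
    n(n - 1)/2 of X exceeds its value at s = 0 by s(s - 1)/2, so charge -1 keeps one extra X. As N
    is even, charge -1 also keeps an extra sign. *)
Definition common_factor : fps K :=
  (-1) ^+ triangle N * (X ^+ (N * L) * fpsC (bw N 0) * X ^+ triangle N).

Lemma detl_rowsOf n m s mu nu : (n + m = P)%N -> n%:Z = N%:Z + s ->
  (size mu <= n)%N -> in_box m n nu ->
  detl P (rowsOf (beads n mu) (beads m nu))
  = (-1) ^+ (psize nu + triangle n) * (X ^+ (N * m)
     * (fpsC (bw n s) * X ^+ triangle n * Zbox s mu (conj_part nu))).
Proof.
move=> nm nE le_mu bx; have := detl_glued_rows M (X ^+ N) le_mu bx.
rewrite nm -exprM => ->; congr (_ * (_ * _)).
rewrite (@det_minor _ B1 B2 w1 w2 al1 be1 al be al2 be2 det1 det2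
  al10 be10 al0 be0 al20 be20 P N n s) //; first by rewrite /Zbox -nE.
- by rewrite -nm leq_addr.
by rewrite size_conj; case/andP: bx.
Qed.

Lemma detl_rows0 mu nu : (size mu <= N)%N -> in_box L N nu ->
  detl P (rowsOf (beads N mu) (beads L nu))
  = common_factor * ((-1) ^+ psize nu * Zbox 0 mu (conj_part nu)).
Proof.
move=> le_mu bx; rewrite (@detl_rowsOf _ _ 0) ?addr0 //.
by rewrite /common_factor exprD; ring.
Qed.

Lemma detl_rows1 mu nu : (size mu <= N.+1)%N -> in_box L.-1 N.+1 nu ->
  detl P (rowsOf (beads N.+1 mu) (beads L.-1 nu))
  = common_factor * ((-1) ^+ psize nu * Zbox 1 mu (conj_part nu)).
Proof.
move=> le_mu bx; rewrite (@detl_rowsOf _ _ 1) //; [|lia|lia].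
rewrite base_weightS /common_factor triangleS exprD exprD -(signr_odd _ N) (negbTE evenN).
have -> : (N * L = N * L.-1 + N)%N by rewrite -mulnSr prednK.
by rewrite !exprD mul1r; ring.
Qed.

Lemma detl_rowsN1 mu nu : (size mu <= N.-1)%N -> in_box L.+1 N.-1 nu ->
  detl P (rowsOf (beads N.-1 mu) (beads L.+1 nu))
  = common_factor * ((-1) ^+ (psize nu).+1
      * (fpsC (al1 * al * al2) * X * Zbox (-1) mu (conj_part nu))).
Proof.
move=> le_mu bx; rewrite (@detl_rowsOf _ _ (-1)) //; [|lia|lia].
have oddP : odd N.-1 by move: evenN; rewrite -{1}[N]prednK //= negbK.
have sgE : (-1) ^+ triangle N = - (-1) ^+ triangle N.-1 :> fps K.
  by rewrite -{1}[N]prednK // triangleS exprD -signr_odd oddP expr1 mulN1r.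
have xE : X ^+ (N * L.+1) * X ^+ triangle N.-1 = X ^+ (N * L) * X ^+ triangle N * X.
  have tN : triangle N = (N.-1 + triangle N.-1)%N by rewrite -triangleS prednK.
  by rewrite -!exprD -exprSr tN; congr (_ ^+ _); rewrite mulnS; lia.
rewrite base_weightP // /common_factor; move: (bw N 0) => b0.
rewrite sgE !rmorphM /= exprD exprS.
transitivity ((-1) ^+ psize nu * (-1) ^+ triangle N.-1
  * (X ^+ (N * L.+1) * X ^+ triangle N.-1)
  * (fpsC al1 * fpsC al * fpsC al2 * fpsC b0 * Zbox (-1) mu (conj_part nu))).
  by ring.
by rewrite xE; ring.
Qed.

Definition glued_row i (r : int) : nat -> fps K :=
  if i == 0 then M (absz (r + N%:Z))
  else fun c => X ^+ N * unit_row (fps K) (P.-1 - absz (r + L%:Z)) c.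

Local Notation vac := (rowsOf (vac_beads N) (vac_beads L)).

Lemma size_vac : size vac = P.
Proof. by rewrite size_cat !size_map !size_iota. Qed.

Local Notation idx := (hole_index N).
Local Notation dim := (factor_dim N L).

Lemma detl_vac : detl P vac = common_factor * Zbox 0 empty empty.
Proof.
by rewrite /vac_beads detl_rows0 // mul1r conj_empty.
Qed.

Hypothesis unit0 : Zbox 0 empty empty \is a GRing.unit.

(** A particle and a hole in the same factor make a hook; in different factors they make a row and a
    column in sectors of opposite charges. In each case the new row goes to the front of the block
    of its own factor, and the rows that it passes give the sign of [amplitude]. *)
Lemma detl_replace i j m n : (m < dim (1 - i)%R)%N -> (n < dim j)%N ->
  detl P (take (idx j n) vac ++ glued_row i (Posz m) :: drop (idx j n).+1 vac)
  = detl P vac * amplitude Zbox i j m n.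
Proof.
move=> lt_m lt_n; rewrite detl_vac -mulrA [X in _ * X]mulrC /amplitude divrK //.
pose E b : nat -> fps K := fun c => X ^+ N * unit_row (fps K) (P.-1 - b) c.
pose V1 := map M (vac_beads N); pose V2 := map E (vac_beads L).
have szV1 : size V1 = N by rewrite size_map size_vac_beads.
have szV2 : size V2 = L by rewrite size_map size_vac_beads.
have vacE : vac = V1 ++ V2 by [].
have row0 : glued_row 0 m = M (N + m)%N.
  by rewrite /glued_row eqxx (_ : absz (m%:Z + N%:Z) = (N + m)%N) // addnC.
have row1 : glued_row 1 m = E (L + m)%N.
  by rewrite /glued_row /= (addnC m L).
have sgN k : (-1) ^+ (N + k) = (-1) ^+ k :> fps K.
  by rewrite exprD -signr_odd (negbTE evenN) mul1r.
have bxL (nu : intpart) k l : (size nu <= k)%N -> (part nu 0 <= l)%N -> in_box k l nu.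
  by rewrite /in_box => -> ->.
move: lt_m lt_n; rewrite vacE /hole_index /factor_dim; case: (ord2 i) => ->; case: (ord2 j) => -> /= lt_m lt_n.
- rewrite row0 take_cat drop_cat szV1 lt_n.
  have -> : (if (n.+1 < N)%N then drop n.+1 V1 ++ V2 else drop (n.+1 - N) V2)
     = drop n.+1 V1 ++ V2.
    case: ltnP => // le; have -> : n.+1 = N by lia.
    by rewrite subnn drop0 -szV1 drop_size.
  have := @detl_move _ P [::] (take n V1) (M (N + m)%N) (drop n.+1 V1 ++ V2).
  rewrite /= => ->; last by rewrite size_cat size_cat size_drop size_takel ?szV1 ?szV2; lia.
  rewrite size_takel ?szV1 ?(ltnW lt_n) //.
  have -> : M (N + m)%N :: take n V1 ++ drop n.+1 V1 ++ V2
    = rowsOf (beads N (hook m n)) (beads L empty).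
    by rewrite beads_hook // /glued_rows /= map_cat map_take map_drop -catA.
  rewrite detl_rows0 //; last by rewrite /= size_nseq.
  by rewrite mul1r conj_empty mulrCA.
- rewrite row0 take_cat drop_cat szV1 !ltnNge leq_addr -addnS leq_addr /= !addKn.
  have := @detl_move _ P [::] (V1 ++ take n V2) (M (N + m)%N) (drop n.+1 V2).
  rewrite /= -catA => ->; last first.
    by rewrite size_cat size_cat size_drop size_takel ?szV1 ?szV2; lia.
  rewrite size_cat size_takel ?szV2 ?(ltnW lt_n) // szV1 sgN.
  have -> : M (N + m)%N :: V1 ++ take n V2 ++ drop n.+1 V2
    = rowsOf (beads N.+1 (row_part m)) (beads L.-1 (col_part n)).
    by rewrite beads_row beads_col // /glued_rows /= map_cat map_take map_drop.
  rewrite detl_rows1.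
  + by rewrite mulrCA.
  + by case: (m).
  apply: bxL; last by rewrite part_col; case: (0 < n)%N.
  by rewrite size_conj part_row /=; lia.
- rewrite row1 take_cat drop_cat szV1 lt_n.
  have -> : (if (n.+1 < N)%N then drop n.+1 V1 ++ V2 else drop (n.+1 - N) V2)
     = drop n.+1 V1 ++ V2.
    case: ltnP => // le; have -> : n.+1 = N by lia.
    by rewrite subnn drop0 -szV1 drop_size.
  have szd : size (drop n.+1 V1) = (N - n.+1)%N by rewrite size_drop szV1.
  have mv : size (take n V1 ++ E (L + m)%N :: drop n.+1 V1 ++ V2) = P.
    by rewrite !size_cat /= size_cat szd size_takel ?szV1 ?szV2; lia.
  have sq1 : 1 = (-1) ^+ size (drop n.+1 V1) * (-1) ^+ size (drop n.+1 V1) :> fps K.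
    by rewrite -expr2 -exprM mulnC exprM sqrrN !expr1n.
  rewrite -[LHS]mul1r [X in X * _ = _]sq1 -[LHS]mulrA -(detl_move mv).
  rewrite szd (_ : (-1) ^+ (N - n.+1) = (-1) ^+ n.+1 :> fps K); last first.
    rewrite -[LHS]signr_odd -[RHS]signr_odd; congr (_ ^+ nat_of_bool _).
    by rewrite oddB // (negbTE evenN).
  have -> : take n V1 ++ drop n.+1 V1 ++ E (L + m)%N :: V2
    = rowsOf (beads N.-1 (col_part n)) (beads L.+1 (row_part m)).
    by rewrite beads_row beads_col // /glued_rows /= map_cat map_take map_drop -catA.
  rewrite detl_rowsN1.
  + by rewrite mulrCA.
  + by rewrite size_conj part_row /=; lia.
  apply: bxL; first by case: (m).
  by rewrite part_row /=; lia.
rewrite row1 take_cat drop_cat szV1 !ltnNge leq_addr -addnS leq_addr /= !addKn.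
rewrite -catA; have := @detl_move _ P V1 (take n V2) (E (L + m)%N) (drop n.+1 V2).
move=> ->; last first.
  by rewrite !size_cat /= size_cat size_drop size_takel ?szV1 ?szV2; lia.
rewrite size_takel ?szV2 ?(ltnW lt_n) //.
have -> : V1 ++ E (L + m)%N :: take n V2 ++ drop n.+1 V2
  = rowsOf (beads N empty) (beads L (hook m n)).
  by rewrite beads_hook // /glued_rows /= map_cat map_take map_drop.
rewrite detl_rows0 //; first by rewrite mulrCA.
by apply: bxL; rewrite ?part_hook /= ?size_nseq.
Qed.

Lemma glued_row_hole j n c : (n < dim j)%N ->
  glued_row j (Negz n) c = nth (fun=> 0) vac (idx j n) c.
Proof.
rewrite /factor_dim /hole_index /glued_row /glued_rows; case: (ord2 j) => -> /= lt_n.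
  rewrite nth_cat size_map size_vac_beads lt_n (nth_map 0%N) ?size_vac_beads //.
  by rewrite nth_vac_beads //; congr (M _ c); rewrite NegzE; lia.
rewrite nth_cat size_map size_vac_beads ltnNge leq_addr /= addKn.
rewrite (nth_map 0%N) ?size_vac_beads // nth_vac_beads //.
by congr (_ * unit_row _ (_ - _)%N c); lia.
Qed.

Lemma sum_hole_index (F : nat -> fps K) :
  \sum_(k < P) F k = \sum_(j < 2) \sum_(n < dim j) F (idx j n).
Proof.
rewrite big_split_ord [RHS]big_ord_recl [X in _ = _ + X]big_ord_recl [X in _ = _ + (_ + X)]big_ord0 addr0.
by congr (_ + _).
Qed.

(** A power of X times a unit: it can be cancelled although it has no inverse. *)
Lemma common_factor_lreg : GRing.lreg common_factor.
Proof.
have lregU (x : fps K) : x \is a GRing.unit -> GRing.lreg x by move=> ux; apply: mulrI.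
rewrite /common_factor.
do !apply: lregM; try exact: fpsX_lreg; apply: lregU.
  by rewrite unitrX // unitrN1.
exact/fpsC_unit/base_weight_neq0.
Qed.

Lemma detl_vac_lreg : GRing.lreg (detl P vac).
Proof. by rewrite detl_vac; apply: lregM; [apply: common_factor_lreg|apply: mulrI]. Qed.

Lemma glued_row_particle i m c : (m < dim (1 - i)%R)%N -> (c < P)%N ->
  glued_row i (Posz m) c
  = \sum_(j < 2) \sum_(n < dim j) amplitude Zbox i j m n * glued_row j (Negz n) c.
Proof.
move=> lt_m lt_c; apply: detl_vac_lreg; rewrite (detl_cramer _ size_vac lt_c).
rewrite (sum_hole_index (fun k => detl P (take k vac ++ glued_row i m :: drop k.+1 vac)
  * nth (fun=> 0) vac k c)).
rewrite mulr_sumr; apply: eq_bigr => j _; rewrite mulr_sumr; apply: eq_bigr => n _.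
by rewrite detl_replace // -[LHS]mulrA glued_row_hole.
Qed.

(** The rows in coordinates with respect to those of the vacuum. The amplitudes [Z] are a parameter,
    since both the truncated and the full ones are needed; the factor 1 gives the sum the shape
    required by [detl_lin]. *)
Definition amplitude_row (Z : int -> intpart -> intpart -> fps K) i (r : int) : nat -> fps K :=
  match r with
  | Posz m => fun c => \sum_(j < 2) 1 * \sum_(n < dim j)
                amplitude Z i j m n * unit_row (fps K) (idx j n) c
  | Negz n => unit_row (fps K) (idx i n)
  end.

Lemma idx_lt j n : (n < dim j)%N -> (idx j n < P)%N.
Proof. by rewrite /factor_dim /hole_index; case: (ord2 j) => -> /=; lia. Qed.

Lemma sum_unit_row (F : nat -> fps K) k : (k < P)%N ->
  \sum_(l < P) unit_row (fps K) k l * F l = F k.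
Proof.
move=> lt_k; rewrite (bigD1 (Ordinal lt_k)) //= big1 ?addr0.
  by rewrite /unit_row eqxx mul1r.
move=> l ne; rewrite /unit_row (_ : (l == k :> nat) = false) ?mul0r //.
exact/negbTE.
Qed.

Lemma amplitude_row_glued i r c : - (dim i)%:Z <= r < (dim (1 - i)%R)%:Z -> (c < P)%N ->
  \sum_(k < P) amplitude_row Zbox i r k * nth (fun=> 0) vac k c = glued_row i r c.
Proof.
move=> br lt_c; case: r br => [m|n] br.
  rewrite glued_row_particle //; last by lia.
  transitivity (\sum_(k < P) \sum_(j < 2) \sum_(n < dim j)
     amplitude Zbox i j m n * (unit_row (fps K) (idx j n) k * nth (fun=> 0) vac k c)).
    apply: eq_bigr => k _; rewrite /amplitude_row mulr_suml; apply: eq_bigr => j _.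
    by rewrite mul1r mulr_suml; apply: eq_bigr => n _; rewrite mulrA.
  rewrite exchange_big; apply: eq_bigr => j _; rewrite exchange_big; apply: eq_bigr => n _.
  rewrite -mulr_sumr (sum_unit_row (fun k => nth (fun=> 0) vac k c)) ?idx_lt //.
  by rewrite glued_row_hole.
have lt_n : (n < dim i)%N by lia.
by rewrite (sum_unit_row (fun k => nth (fun=> 0) vac k c)) ?idx_lt // glued_row_hole.
Qed.

Lemma rows_maya (row : 'I_2 -> int -> nat -> fps K) mu nu : in_box N L mu -> in_box L N nu ->
  rows row dim (maya mu, maya nu)
  = [seq row 0 (b%:Z - N%:Z) | b <- beads N mu] ++ [seq row 1 (b%:Z - L%:Z) | b <- beads L nu].
Proof.
by move=> bx bx'; rewrite /rows /= !listing_maya // -!map_comp.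
Qed.

Lemma eq_detl_cat (T : eqType) (f f' g g' : T -> nat -> fps K) (s1 s2 : seq T) :
  (forall r c, r \in s1 -> (c < P)%N -> f r c = f' r c) ->
  (forall r c, r \in s2 -> (c < P)%N -> g r c = g' r c) ->
  detl P ([seq f r | r <- s1] ++ [seq g r | r <- s2])
  = detl P ([seq f' r | r <- s1] ++ [seq g' r | r <- s2]).
Proof.
move=> ff gg; apply: eq_detl => a c lt_a lt_c; rewrite !nth_cat !size_map.
case: ltnP => [lt_s|le_s].
  by case: s1 lt_s ff {gg} => // x s1 lt_s ff; rewrite !(nth_map x) // ff ?mem_nth.
case: (ltnP (a - size s1) (size s2)) => [lt_s|le_s2]; last first.
  by rewrite !nth_default ?size_map.
by case: s2 lt_s gg => // x s2 lt_s gg; rewrite !(nth_map x) // gg ?mem_nth.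
Qed.

(** Multiplying these rows by the vacuum matrix gives the glued rows of [mu] and [nu], so the
    determinant is the quotient of their minor by the vacuum minor, in which [common_factor]
    cancels. *)
Lemma detl_amplitude_rows mu nu : in_box N L mu -> in_box L N nu ->
  detl P (rows (amplitude_row Zbox) dim (maya mu, maya nu))
  = (-1) ^+ psize nu * Zbox 0 mu (conj_part nu) / Zbox 0 empty empty.
Proof.
move=> bx bx'; rewrite rows_maya //.
set rs := _ ++ _.
have szr : size rs = P by rewrite size_cat !size_map !size_iota.
apply: (mulIr unit0); rewrite divrK //.
apply: common_factor_lreg; rewrite -detl_rows0 //; last by case/andP: bx.
rewrite mulrCA -detl_vac -detl_mul // /rs map_cat.
rewrite -[X in detl _ (X ++ _)]map_comp -[X in detl _ (_ ++ X)]map_comp.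
pose f b : nat -> fps K := fun c => \sum_(k < P) amplitude_row Zbox 0 (b%:Z - N%:Z) k
   * nth (fun=> 0) vac k c.
pose g b : nat -> fps K := fun c => \sum_(k < P) amplitude_row Zbox 1 (b%:Z - L%:Z) k
   * nth (fun=> 0) vac k c.
rewrite -[LHS]/(detl P ([seq f b | b <- beads N mu] ++ [seq g b | b <- beads L nu])).
apply: eq_detl_cat => b c /map_iotaP[k lt_k bE] lt_c.
  have := bead_lt bx lt_k; rewrite -bE => lt_b.
  rewrite /f amplitude_row_glued //; last by rewrite /factor_dim /=; lia.
  by rewrite /glued_row /=; congr (M _ c); lia.
have := bead_lt bx' lt_k; rewrite -bE => lt_b.
rewrite /g amplitude_row_glued //; last by rewrite /factor_dim /=; lia.
by rewrite /glued_row /=; congr (_ * unit_row _ (_ - _)%N c); lia.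
Qed.

End Truncation.

Lemma eqm_amplitude k (Z Z' : int -> intpart -> intpart -> fps K) i j m n :
  Z 0 empty empty \is a GRing.unit -> Z' 0 empty empty \is a GRing.unit ->
  (forall s mu nu, -1 <= s -> s <= 1 -> eqm k (Z s mu nu) (Z' s mu nu)) ->
  eqm k (amplitude Z i j m n) (amplitude Z' i j m n).
Proof.
move=> u u' e; apply: eqmM; last by apply: eqmV => //; apply: e.
by case: (i == 0); case: (j == 0); do !(apply: eqmM; first exact: eqm_refl); apply: e.
Qed.

End Bogoliubov.

Section BogoliubovTheorem.

Variables (K : fieldType) (B1 B2 : nat -> nat -> K) (w1 w2 : intpart -> intpart -> K).
Hypothesis char0 : forall n : nat, n.+1%:R != 0 :> K.
Hypothesis det1 : determinantal B1 w1.
Hypothesis det2 : determinantal B2 w2.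
Variables (al1 be1 al be al2 be2 : K).
Hypotheses (al10 : al1 != 0) (be10 : be1 != 0) (al0 : al != 0) (be0 : be != 0).
Hypotheses (al20 : al2 != 0) (be20 : be2 != 0).
Implicit Types (mu nu la : intpart) (i j : 'I_2).

Local Notation Zs := (Zsum w1 w2 al1 be1 al be al2 be2).
Local Notation Zx := (Zbox w1 w2 al1 be1 al be al2 be2).
Local Notation amplitude := (amplitude al1 al al2).
Local Notation amplitude_row := (amplitude_row al1 al al2).
Local Notation empty := empty_part.

(** The coefficients [A] are the untruncated amplitudes and do not depend on a box; the box is
    chosen afterwards, for given [mu], [nu] and power of X. *)
Theorem bogoliubov_of_determinantal :
  exists A, forall mu nu, exp_vac2 (bogoliubov_op A) (maya mu, maya nu)
    = (-1) ^+ psize nu * Zs 0 mu (conj_part nu) / Zs 0 empty empty.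
Proof.
exists (amplitude Zs) => mu nu; apply: fpsP => k.
have [N [L [evenN bx bx' le_kN le_kL]]] : exists N L,
    [/\ ~~ odd N, in_box N L mu, in_box L N nu, (k < N)%N & (k < L)%N].
  (* [N] is even for the signs. Both numbers exceed [k], so that also the boxes of charges 1 and -1
     contain all the partitions of size at most [k]. *)
  exists (2 * (k + size mu + part nu 0).+1)%N, (k + part mu 0 + size nu).+2.
  by rewrite oddM /in_box; split=> //; lia.
have Zb s mu' nu' : -1 <= s -> s <= 1 -> eqm k (Zx N L s mu' nu') (Zs s mu' nu').
  move=> s1 s2; rewrite /Zbox.
  by apply: Ztrunc_eqm; move: le_kN le_kL s1 s2; clear; lia.
have uZ := Zsum_unit det1 det2 al1 be1 al be al2 be2.
have u0 : Zx N L 0 empty empty \is a GRing.unit.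
  by rewrite fps_unitE (Zb 0 empty empty) // -fps_unitE.
rewrite (@exp_vac2_det _ _ (amplitude_row N L Zs) (factor_dim N L)) //.
(* The exponential is exactly the determinant built on the full amplitudes; only here are they
   replaced by the truncated ones, modulo [X ^+ k.+1]. *)
- have -> : fcoef (detl (N + L) (rows (amplitude_row N L Zs) (factor_dim N L) (maya mu, maya nu))) k
    = fcoef (detl (N + L) (rows (amplitude_row N L (Zx N L)) (factor_dim N L) (maya mu, maya nu))) k.
    apply: (@eqm_det _ k) => // a b; rewrite !mxE !rows_maya // !nth_cat !size_map.
    have eqm_row i r c : eqm k (amplitude_row N L Zs i r c) (amplitude_row N L (Zx N L) i r c).
      case: r => [m|n] //; apply: eqm_sum => j _; apply: eqmM => //.
      apply: eqm_sum => n _; apply: eqmM => //.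
      apply: eqm_amplitude => //.
      by move=> s mu' nu' s1 s2 l le_l; rewrite (Zb s mu' nu').
    case: ltnP => [lt_a|le_a].
      by rewrite !(nth_map 0%N) ?size_map //; apply: eqm_row.
    have [lt_s|le_s] := ltnP (a - size (iota 0 N)) (size (iota 0 L)).
      by rewrite !(nth_map 0%N) ?size_map //; apply: eqm_row.
    by rewrite !nth_default // ?size_map.
  rewrite (detl_amplitude_rows det1 det2) //; try exact: leq_ltn_trans le_kN; try exact: leq_ltn_trans le_kL.
  apply: (eqmM (k := k)) => //; first by apply: eqmM => //; apply: Zb.
  by apply: eqmV => //; apply: Zb.
(* For the vacuum all the listed rows are rows of holes, numbered in the order of the listing: the
   matrix is the identity. *)
- have bx0 : in_box N L empty by [].
  have bx0' : in_box L N empty by [].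
  rewrite -maya_empty rows_maya // /detl -[RHS](@matrix.det1 (fps K) (N + L)).
  congr (\det _); apply/matrixP => a b; rewrite !mxE nth_cat !size_map size_iota.
  have lt_a := ltn_ord a; rewrite -[a == b]/(a == b :> nat) eq_sym.
  case: ltnP => [lt_aN|le_a].
    rewrite (nth_map 0%N) ?size_map ?size_iota // nth_beads // bead_empty.
    by rewrite (_ : (N - a.+1)%N%:Z - N%:Z = Negz a) //; clear -lt_aN; lia.
  have lt_aL : (a - N < L)%N by rewrite ltn_subLR.
  rewrite (nth_map 0%N) ?size_map ?size_iota // nth_beads // bead_empty.
  rewrite (_ : (L - (a - N).+1)%N%:Z - L%:Z = Negz (a - N)); last by clear -lt_aL; lia.
  by rewrite /amplitude_row /hole_index /= subnKC.
- move=> n; rewrite -(rmorph_nat (@fpsC K)) fpsC_unit //.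
  by case: n`! (fact_gt0 n).
- by rewrite /box2 /= !fin_box_maya.
by rewrite rows_maya // size_cat !size_map !size_iota.
Qed.

End BogoliubovTheorem.

(** * The topological vertex *)

Section VertexSides.

Variables (K : fieldType) (h : K).
Hypothesis char0 : forall n : nat, n.+1%:R != 0 :> K.
Hypothesis h0 : h != 0.
Hypothesis h1 : forall k : nat, 1 - h ^+ k.+1 != 0.
Implicit Types mu nu la eta : intpart.

Local Notation empty := empty_part.

Lemma kappa_empty : kappa empty = 0.
Proof. by rewrite /kappa big_ord0. Qed.

Definition two_leg mu la : K := \sum_(eta \in [set: intpart]%classic)
  skew_schur (psum_rho h empty) mu eta * skew_schur (psum_rho h empty) la eta.

Lemma determinantal_two_leg : exists B, determinantal B two_leg.
Proof.
exists (fun a b => \sum_(t < b.+1) hsym (psum_rho h empty) (a%:Z - t%:Z)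
                                 * hsym (psum_rho h empty) (b%:Z - t%:Z)).
by move=> n mu la le_mu le_la; apply: sum_skew_schur.
Qed.

(** The sign and the power of [h] cancel those in front of the determinant in [schur_mrho_rho]. *)
Definition corner_leg mu la : K :=
  (-1) ^+ psize mu * h ^ (- kappa la) * (schur (psum_mrho h) mu * schur (psum_rho h mu) la).

Lemma determinantal_corner_leg : determinantal (vertex_mx h) corner_leg.
Proof.
move=> n mu la le_mu le_la; rewrite /corner_leg (schur_mrho_rho _ _ _ le_mu le_la) //.
rewrite mulrA mulrACA -expfzDr // addNr expr0z mulr1.
by rewrite -expr2 -exprM mulnC exprM sqrrN expr1n expr1n mul1r.
Qed.

Lemma determinantal_tr B (w : intpart -> intpart -> K) :
  determinantal B w -> determinantal (fun a b => B b a) (fun mu la => w la mu).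
Proof.
move=> dB n mu la le_mu le_la; rewrite (dB n) // -det_tr; congr (\det _).
by apply/matrixP => i j; rewrite !mxE.
Qed.

Lemma corner_legE mu la : schur (psum_mrho h) mu * schur (psum_rho h mu) la
  = (-1) ^+ psize mu * h ^ kappa la * corner_leg mu la.
Proof.
rewrite /corner_leg [RHS]mulrA [X in _ = X * _]mulrACA -expfzDr // addrN expr0z mulr1.
by rewrite -expr2 -exprM mulnC exprM sqrrN expr1n expr1n mul1r.
Qed.

Lemma sum_skew_schur_empty p p' la :
  \sum_(eta \in [set: intpart]%classic) skew_schur p empty eta * skew_schur p' la eta
  = schur p' la :> K.
Proof.
rewrite (@fsum_seq _ _ [:: empty]) //.
  by rewrite big_seq1 skew_schur_empty eqxx mul1r.
by move=> eta; rewrite inE => /negbTE ne; rewrite skew_schur_empty ne mul0r.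
Qed.

Lemma schur_empty p : schur p empty = 1 :> K.
Proof. by rewrite /schur skew_schur_empty eqxx. Qed.

Lemma vertex_leg1 mu la : vertex h mu empty la = h ^ kappa la * two_leg mu (conj_part la).
Proof. by rewrite /vertex conj_empty schur_empty mul1r mulr1. Qed.

(** The vertex pairs s_(mu^t)(q^-rho) with the variables q^(mu+rho), while the alternants cancel for
    s_mu(q^-rho); [schur_mrho_conj] exchanges the two at the cost of q^(kappa_mu / 2). *)
Lemma vertex_leg2 mu la : vertex h empty mu la
  = h ^ kappa mu * corner_leg mu (conj_part la).
Proof.
rewrite /vertex sum_skew_schur_empty (schur_mrho_conj char0 h0 h1).
rewrite -mulrA -(mulrA (h ^ kappa mu)) corner_legE kappa_conj.
transitivity (((-1) ^+ psize mu * (-1) ^+ psize mu) * (h ^ kappa la * h ^ (- kappa la))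
   * (h ^ kappa mu * corner_leg mu (conj_part la))); first by ring.
by rewrite -expfzDr // addrN expr0z -expr2 -exprM mulnC exprM sqrrN !expr1n !mul1r.
Qed.

Lemma vertex_leg3 la nu : vertex h (conj_part la) nu empty
  = h ^ kappa (conj_part la) * corner_leg (conj_part nu) (conj_part la).
Proof.
rewrite /vertex conj_empty kappa_empty expr0z mulr1.
have -> : \sum_(eta \in [set: intpart]%classic)
     skew_schur (psum_rho h (conj_part nu)) (conj_part la) eta * skew_schur (psum_rho h nu) empty eta
  = schur (psum_rho h (conj_part nu)) (conj_part la).
  by rewrite -[RHS](sum_skew_schur_empty (psum_rho h nu)); apply: eq_fsbigr => eta _; rewrite mulrC.
rewrite -mulrA corner_legE psize_conj !mulrA.
by rewrite -expr2 -exprM mulnC exprM sqrrN !expr1n mul1r.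
Qed.

Lemma vertex_leg4 la nu : vertex h (conj_part la) empty nu
  = h ^ kappa nu * two_leg (conj_part la) (conj_part nu).
Proof. by rewrite /vertex conj_empty schur_empty mul1r mulr1. Qed.

Lemma signz_mul (a : int) n : (-1) ^ (a * n%:Z) = ((-1) ^ a) ^+ n :> K.
Proof. by rewrite -exprz_exp exprnP. Qed.

Lemma signz_neq0 (a : int) : (-1) ^ a != 0 :> K.
Proof. by rewrite expfz_neq0 // oppr_eq0 oner_eq0. Qed.

Lemma hz_neq0 (a : int) : h ^ a != 0.
Proof. exact: expfz_neq0. Qed.

(** Everything about the compact edge is expressed through [conj_part la], over which the gluing sum
    will be reindexed; framings and the prefactors of the vertex go into [al1], [be1] and [be]. *)
Lemma side12 (a1 a2 : int) (e : leg12) : exists B w al1 be1 be,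
  [/\ determinantal B w, al1 != 0, be1 != 0, be != 0 & forall mu la,
    framed_vertex h a1 a2 0 (if e is L1 then mu else empty)
                            (if e is L2 then mu else empty) la
    = al1 ^+ psize mu * be1 ^ kappa mu * be ^ kappa (conj_part la) * w mu (conj_part la)].
Proof.
case: e.
  have [B dB] := determinantal_two_leg.
  exists B, two_leg, ((-1) ^ a1), (h ^ a1), h^-1; split=> //.
  - exact: signz_neq0.
  - exact: hz_neq0.
  - by rewrite invr_eq0.
  move=> mu la; rewrite /framed_vertex vertex_leg1 kappa_empty kappa_conj !mul0r !mulr0 !addr0.
  by rewrite signz_mul exprz_exp -exprN1 exprz_exp mulN1r opprK mulrA.
exists (vertex_mx h), corner_leg, ((-1) ^ a2), (h ^ (a2 + 1)), 1; split=> //.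
- exact: determinantal_corner_leg.
- exact: signz_neq0.
- exact: hz_neq0.
- exact: oner_neq0.
move=> mu la; rewrite /framed_vertex vertex_leg2 kappa_empty !mul0r !mulr0 !addr0 !add0r.
by rewrite signz_mul exp1rz mulr1 exprz_exp mulrDl mul1r expfzDr // !mulrA.
Qed.

Lemma side34 (a3 a4 : int) (e : leg34) : exists B w al2 be2 be,
  [/\ determinantal B w, al2 != 0, be2 != 0, be != 0 & forall la nu,
    framed_vertex h 0 a3 a4 (conj_part la) (if e is L3 then nu else empty)
                                           (if e is L4 then nu else empty)
    = al2 ^+ psize nu * be2 ^ kappa (conj_part nu) * be ^ kappa (conj_part la)
      * w (conj_part la) (conj_part nu)].
Proof.
case: e.
  exists (fun a b => vertex_mx h b a), (fun la nu => corner_leg nu la),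
    ((-1) ^ a3), (h ^ (- a3)), h; split=> //.
  - exact/determinantal_tr/determinantal_corner_leg.
  - exact: signz_neq0.
  - exact: hz_neq0.
  move=> la nu; rewrite /framed_vertex vertex_leg3 kappa_empty !mul0r !mulr0 !addr0 !add0r.
  by rewrite signz_mul exprz_exp (kappa_conj nu) mulrNN !mulrA.
have [B dB] := determinantal_two_leg.
exists B, two_leg, ((-1) ^ a4), (h ^ (- (a4 + 1))), 1; split=> //.
- exact: signz_neq0.
- exact: hz_neq0.
- exact: oner_neq0.
move=> la nu; rewrite /framed_vertex vertex_leg4 kappa_empty !mul0r !mulr0 !add0r.
by rewrite signz_mul exp1rz mulr1 exprz_exp (kappa_conj nu) mulrNN mulrDl mul1r expfzDr // !mulrA.
Qed.

Theorem Zopen_bogoliubov (f a1 a2 a3 a4 : int) (e : leg12) (e' : leg34) :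
  exists A, forall mu nu, Zopen h (fpsX K) f a1 a2 a3 a4 e e' mu nu
    = exp_vac2 (bogoliubov_op A) (maya mu, maya nu).
Proof.
have [B1 [w1 [al1 [be1 [beA [d1 al10 be10 beA0 E1]]]]]] := side12 a1 a2 e.
have [B2 [w2 [al2 [be2 [beB [d2 al20 be20 beB0 E2]]]]]] := side34 a3 a4 e'.
(* The gluing factor has the exponent [- f * kappa la], which is [f * kappa (conj_part la)]. *)
pose al := (-1) ^ (f + 1) : K; pose be := beA * beB * h ^ f.
have al0 : al != 0 by apply: signz_neq0.
have be0 : be != 0 by rewrite !mulf_neq0 ?hz_neq0.
(* Changing the sign of [al2] absorbs the sign [(-1) ^+ psize nu] of
   [bogoliubov_of_determinantal]. *)
have al2N0 : - al2 != 0 by rewrite oppr_eq0.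
have [A AE] := bogoliubov_of_determinantal char0 d1 d2 al10 be10 al0 be0 al2N0 be20.
exists A => mu nu; rewrite AE.
pose Zt (mu nu : intpart) := Ztilde h (fpsX K) f a1 a2 a3 a4
   (if e is L1 then mu else empty) (if e is L2 then mu else empty)
   (if e' is L3 then nu else empty) (if e' is L4 then nu else empty).
have ZtE mu' nu' : Zt mu' nu' = (-1) ^+ psize nu'
    * Zsum w1 w2 al1 be1 al be (- al2) be2 0 mu' (conj_part nu').
  apply: fpsP => k; rewrite -[(-1) ^+ _](rmorph_sign (@fpsC K)) fcoef_fpsCM.
  rewrite -[LHS]/(\sum_(la \in [set: intpart]%classic) _).
  rewrite -[X in _ * X]/(\sum_(la \in [set: intpart]%classic)
    fcoef (wterm w1 w2 al1 be1 al be (- al2) be2 0 mu' (conj_part nu') la) k).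
  rewrite mulr_fsumr [RHS](reindex_fsbigT conj_part); last exact: inv_bij conj_partK.
  apply: eq_fsbigr => la _; rewrite !fcoef_fpsCM psize_conj [RHS]mulrA; congr (_ * _).
  rewrite E1 E2 !mulr0 !expr0z !mulr1 !psize_conj (exprNn al2).
  have -> : (-1) ^ ((f + 1) * psize la) = al ^+ psize la by rewrite signz_mul.
  have -> : be ^ kappa (conj_part la) = beA ^ kappa (conj_part la)
      * beB ^ kappa (conj_part la) * h ^ (- f * kappa la).
    by rewrite /be !expfzMl exprz_exp kappa_conj mulrN mulNr.
  have s2 : (-1) ^+ psize nu' * (-1) ^+ psize nu' = 1 :> K.
    by rewrite -expr2 -exprM mulnC exprM sqrrN !expr1n.
  set s := (-1) ^+ psize nu' in s2 *.
  set u := h ^ _; set x := al ^+ _; set y := al1 ^+ _; set z := al2 ^+ _.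
  transitivity ((s * s) * (y * be1 ^ kappa mu' * beA ^ kappa (conj_part la) *
    w1 mu' (conj_part la) * x * u *
    (z * be2 ^ kappa (conj_part nu') * beB ^ kappa (conj_part la) *
     w2 (conj_part la) (conj_part nu')))); first by rewrite s2 mul1r.
  by ring.
have Z0 : Zclosed h (fpsX K) f a1 a2 a3 a4 = Zt empty empty.
  by rewrite /Zt /Zclosed; case: (e); case: (e').
rewrite /Zopen Z0 -[Ztilde _ _ _ _ _ _ _ _ _ _ _]/(Zt mu nu) !ZtE.
by rewrite mul1r conj_empty.
Qed.

End VertexSides.

Theorem theorem5p1 (F : numFieldType) (p f : int) (hf : framing_matches p f)
    (a1 a2 a3 a4 : int) (e : leg12) (e' : leg34) :
  (* 'X is q^(1/(2N)) and fpsX is Q^(1/M) *)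
  exists N M : nat, [/\ (0 < N)%N, (0 < M)%N &
    exists V : fock2 (fps {fraction {poly F}}), is_bogoliubov V /\
      forall mu nu : intpart,
        Zopen (tofrac ('X : {poly F}) ^+ N) (fpsX {fraction {poly F}} ^+ M)
          f a1 a2 a3 a4 e e' mu nu = bra2 mu nu V].
Proof.
have char0 (n : nat) : n.+1%:R != 0 :> {fraction {poly F}}.
  rewrite -(rmorph_nat (@tofrac {poly F})) tofrac_eq0 -polyC_natr polyC_eq0.
  by rewrite pnatr_eq0.
have h0 : tofrac ('X : {poly F}) != 0 by rewrite tofrac_eq0 polyX_eq0.
have h1 (k : nat) : 1 - tofrac ('X : {poly F}) ^+ k.+1 != 0.
  rewrite -(rmorph1 (@tofrac {poly F})) -rmorphXn -rmorphB tofrac_eq0.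
  rewrite subr_eq0; apply/eqP => /(congr1 (fun q : {poly F} => size q)).
  by rewrite size_poly1 size_polyXn.
have [A AE] := Zopen_bogoliubov char0 h0 h1 f a1 a2 a3 a4 e e'.
(* The coefficients are already power series in Q itself over the rational functions of q^(1/2). *)
exists 1%N, 1%N; split=> //; exists (exp_vac2 (bogoliubov_op A)); split; first by exists A.
by move=> mu nu; rewrite !expr1 AE.
Qed.
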